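(* Let $b>0$ and $B<3$ be constants and let $m=m(n)$ be an integer-valued function with $m(n)\in[bn,Bn]$ for all large $n$. Then there exists a constant $\alpha=\alpha(b,B)>0$ such that $$\mathbf{P}[P_{n,m}\text{ has fewer than }\alpha n\text{ pendant edges}]<e^{-\alpha n}\quad\text{for all large } n.$$
   Context: $\mathcal{P}(n,m)$ denotes the set of all (simple, labelled) planar graphs on the vertex set $\{1,2,\ldots,n\}$ with exactly $m$ edges, and $P_{n,m}$ is a graph chosen uniformly at random from $\mathcal{P}(n,m)$. A pendant edge is an edge incident to a vertex of degree $1$. *)

(* Defs.v *)
From HB Require Import structures.
From mathcomp Require Import all_boot all_order all_algebra.
From mathcomp Require Import all_classical all_reals all_analysis.
Import Order.TTheory GRing.Theory Num.Theory.
Import numFieldNormedType.Exports.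

Set Implicit Arguments.
Unset Strict Implicit.
Unset Printing Implicit Defensive.

Local Open Scope classical_set_scope.
Local Open Scope ring_scope.

(** A simple graph on a finite vertex type [T] is given by its edge set
    [E : {set {set T}}], all of whose members are two-element sets. *)
Definition simple_graph (T : finType) (E : {set {set T}}) : bool :=
  [forall e in E, #|e| == 2%N].

(** [pos] places the vertices in the plane [R * R] and [arc e], restricted to
    [0, 1], is the curve drawn for [e]: a Jordan arc joining the two ends of [e],
    whose interior meets neither a vertex nor the interior of another arc. *)
Record plane_drawing (R : realType) (T : finType) (E : {set {set T}})
    (pos : T -> R * R) (arc : {set T} -> R -> R * R) : Prop := PlaneDrawing {
  pos_inj : injective pos;
  arc_continuous : forall e, e \in E ->
    {within `[0, 1]%classic, continuous (arc e)};
  arc_inj : forall e, e \in E -> {in `[0, 1] &, injective (arc e)};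
  arc_ends : forall e, e \in E ->
    exists u v : T, [/\ e = [set u; v]%SET, arc e 0 = pos u & arc e 1 = pos v];
  arc_avoids_vertices : forall e, e \in E ->
    forall t, t \in `]0, 1[ -> forall v : T, arc e t <> pos v;
  arc_disjoint : forall e f, e \in E -> f \in E -> e != f ->
    forall s t, s \in `]0, 1[ -> t \in `]0, 1[ -> arc e s <> arc f t
}.

Definition planar (R : realType) (T : finType) (E : {set {set T}}) : Prop :=
  exists (pos : T -> R * R) (arc : {set T} -> R -> R * R),
    plane_drawing E pos arc.

(** The labels 1, ..., n are represented by the elements 0, ..., n-1 of ['I_n]. *)
Definition planar_graphs (R : realType) (n m : nat) : {set {set {set 'I_n}}} :=
  [set E : {set {set 'I_n}} |
    [&& simple_graph E, #|E| == m & `[< planar R E >]]]%SET.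

Definition degree (T : finType) (E : {set {set T}}) (v : T) : nat :=
  #|[set e in E | v \in e]%SET|.

Definition pendant_edges (T : finType) (E : {set {set T}}) : {set {set T}} :=
  [set e in E | [exists v in e, degree E v == 1%N]]%SET.

(** Probability that a uniformly random member of [planar_graphs R n m] satisfies
    [Q].  The quotient is 0 if there is no such graph, i.e. for [3 <= n] if
    [3 * n - 6 < m]. *)
Definition prob_planar (R : realType) (n m : nat)
    (Q : pred {set {set 'I_n}}) : R :=
  #|[set E in planar_graphs R n m | Q E]%SET|%:R / #|planar_graphs R n m|%:R.

(* Main.v *)
(** Call a graph bad if it has at most [p] pendant edges, [p] being a small multiple
    of [n].

    Dense case [(1 + e) n <= m]. Hanging [k = d n] new leaves on a bad graph with [n]
    vertices and [m] edges gives a planar graph with [n + k] vertices and [m + k]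
    edges, and each step is undone by pointing at one of at most [p + k] pendant
    edges. Hence the bad graphs, divided by [n!], are at most
    [(2 (p + k) / n) ^ k] times the number [N (n + k, m + k)] of all planar graphs,
    divided by [(n + k)!]. That quotient is at most [e ^ (C d n)] times
    [N (n, m) / n!] with [C] independent of [d], so the first factor wins when [d] is
    small. The growth estimate comes from connected graphs: joining two of them by
    an edge makes their normalised number supermultiplicative, so that Fekete's
    lemma applies along rays of rational slope [m / n]; graphs with [k + 1]
    components are fewer by a factor [16 ^ k / k!]. The upper bound needed by Fekete's
    lemma holds because a planar graph has no [K5] minor: a graph without such a
    minor has either a large matching, which is contracted, or many vertices with a
    common neighbourhood, which are deleted, so there are at most [(C n) ^ n] of them.

    Sparse case [m <= (1 + e) n]. A planar graph with few pendant edges has many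
    isolated vertices, or many components (which is very rare), or many vertices of
    degree 2. An isolated vertex can be hung on another one at the cost of an edge,
    and a vertex of degree 2 can be suppressed and hung as a leaf; either way
    the number of pendant edges grows by at most 3, and each switching multiplies the
    number of graphs by a large constant. Iterating over linearly many values of
    [p] gives an exponentially small proportion. *)
Require Import Defs.
From HB Require Import structures.
From mathcomp Require Import all_boot all_order all_algebra.
From mathcomp Require Import all_classical all_reals all_analysis.
From mathcomp Require Import ring lra zify.
Import Order.TTheory GRing.Theory Num.Theory.
Import numFieldNormedType.Exports.

Set Implicit Arguments.
Unset Strict Implicit.
Unset Printing Implicit Defensive.

(** * Crossing parity and the graph K5 *)

(** Planarity is given by arbitrary continuous arcs, so neither faces nor Euler's formula are at
    hand. That [K5] is not planar comes from a parity count over vertex-disjoint pairs of edges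
    only; hence arcs may be replaced by nearby polylines, no matter how polylines with a common end
    cross. Surgery on drawings rests mostly on one normal form: the plane is slit along a short free
    segment at a vertex and opened up, which puts the drawing into a half-plane with that vertex on
    the boundary.

    The crude bound [(C n) ^ n] suffices because after division by [n!] it is exponential, and this
    is all that a supremum of rates requires.

    The two cases reflect the limits of the methods. Comparing [(n, m)] with [(n + k, m + k)] needs
    connected filler graphs; their ratio of edges to vertices is close to [m / n], but shifted a
    little, and must not fall below 1, so [m / n] has to exceed 1 by a fixed amount. If [m / n] is
    near 1 or smaller, a graph with few leaves and not too many components has linearly many
    vertices of degree 0 or suppressible ones of degree 2, and local switchings suffice. *)

Section CrossingParity.
Local Open Scope ring_scope.
Variable R : realFieldType.
Implicit Types a b p q z : R * R.

(* The order of the abscissas after an infinitesimal rotation, so that no line through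
   two distinct points is vertical. *)
Definition lexlt a b : bool := (a.1 < b.1) || ((a.1 == b.1) && (a.2 < b.2)).

Definition cross (u w : R * R) : R := u.1 * w.2 - u.2 * w.1.

Definition orient a b p : R := cross (b.1 - a.1, b.2 - a.2) (p.1 - a.1, p.2 - a.2).

Definition lerp a b (t : R) : R * R :=
  (a.1 + t * (b.1 - a.1), a.2 + t * (b.2 - a.2)).

Definition seg_disjoint a b p q : Prop :=
  forall s t, 0 <= s <= 1 -> 0 <= t <= 1 -> lerp a b s <> lerp p q t.

Definition between a b p : bool := lexlt a p (+) lexlt b p.

(** The segment crosses the downward vertical ray from [p], read in the rotated order; thus a
    polyline with a vertex exactly below [p] still gets the right parity. *)
Definition above a b p : bool :=
  between a b p && (0 < if lexlt a b then orient a b p else orient b a p).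

Definition below a b p : bool :=
  between a b p && ~~ (0 < if lexlt a b then orient a b p else orient b a p).

Lemma above_below a b p : above a b p (+) below a b p = between a b p.
Proof. by rewrite /above /below; case: between => //=; case: (0 < _). Qed.

Lemma lexltP a b : reflect (a.1 < b.1 \/ (a.1 = b.1 /\ a.2 < b.2)) (lexlt a b).
Proof.
apply: (iffP orP) => -[h|h]; [by left| |by left|].
  by move/andP: h => [/eqP -> ?]; right.
by right; case: h => [-> ->]; rewrite eqxx.
Qed.

Lemma lexlt_total a b : a <> b -> lexlt a b = ~~ lexlt b a.
Proof.
case: a b => [a1 a2] [b1 b2]; rewrite /lexlt /= => neq.
have [//|//|e1] := ltgtP a1 b1; subst; have [//|//|e2] := ltgtP a2 b2; subst => //.
Qed.

Lemma lexlt_trans a b c : lexlt a b -> lexlt b c -> lexlt a c.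
Proof.
move=> /lexltP [h1|[h1 h1']] /lexltP [h2|[h2 h2']]; apply/lexltP;
  first [by left; lra|by right; split; lra|idtac]; try (right; split).

Qed.

Lemma lexltC a b : lexlt a b -> lexlt b a = false.
Proof.
move=> /lexltP h; apply/negP => /lexltP h'; case: h => [h|[h h1]]; case: h' => [h'|[h' h2]]; lra.
Qed.

Lemma aboveC a b p : a <> b -> above a b p = above b a p.
Proof.
move=> neq; rewrite /above /between addbC (lexlt_total neq); by case: (lexlt b a).
Qed.

Lemma belowC a b p : a <> b -> below a b p = below b a p.
Proof.
move=> neq; rewrite /below /between addbC (lexlt_total neq); by case: (lexlt b a).
Qed.

Lemma on_segment a b z : lexlt a b -> ~~ lexlt z a -> ~~ lexlt b z ->
  orient a b z = 0 -> exists2 s, 0 <= s <= 1 & z = lerp a b s.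
Proof.
move=> /lexltP ab /lexltP za /lexltP bz; rewrite /orient /cross /= => o.
case: a b z => [a1 a2] [b1 b2] [z1 z2] in ab za bz o *; rewrite /= in ab za bz o.
have h1 : a1 <= z1 by rewrite leNgt; apply/negP => ?; apply: za; left.
have h2 : z1 <= b1 by rewrite leNgt; apply/negP => ?; apply: bz; left.
case: ab => [ab|[ab ab2]].
  exists ((z1 - a1) / (b1 - a1)).
    rewrite divr_ge0 ?subr_ge0 ?(ltW ab) //= ler_pdivrMr ?subr_gt0 //; lra.
  rewrite /lerp /=; congr pair; first by field; lra.
  have -> : (z1 - a1) / (b1 - a1) * (b2 - a2) = z2 - a2.
    rewrite mulrAC; apply/eqP; rewrite eq_sym eq_sym; apply/eqP.
    have -> : (z1 - a1) * (b2 - a2) = (z2 - a2) * (b1 - a1) by lra.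
    by rewrite mulfK // subr_eq0 gt_eqF.
  ring.
subst b1; have e : z1 = a1 by lra.
subst z1.
have h3 : a2 <= z2 by rewrite leNgt; apply/negP => ?; apply: za; right.
have h4 : z2 <= b2 by rewrite leNgt; apply/negP => ?; apply: bz; right.
exists ((z2 - a2) / (b2 - a2)).
  rewrite divr_ge0 ?subr_ge0 ?(ltW ab2) //= ler_pdivrMr ?subr_gt0 //; lra.
rewrite /lerp /=; congr pair; first by ring.
by field; lra.
Qed.

(** For vectors of the right half-plane the sign of [cross] compares slopes, which is transitive;
    [key] combines the two given cross products with coefficients that are nonnegative there. *)
Lemma slope_trans (u w e : R * R) (o : (0 : R * R) = 0) :
  lexlt 0 u -> lexlt 0 w -> lexlt 0 e ->
  (0 < cross w u -> 0 < cross e w -> 0 < cross e u) /\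
  (cross w u < 0 -> cross e w < 0 -> cross e u < 0).
Proof.
case: u w e => [u1 u2] [w1 w2] [e1 e2]; rewrite /cross /=.
move=> /lexltP /= hu /lexltP /= hw /lexltP /= he.
have key : w1 * (e1 * u2 - e2 * u1) =
  u1 * (e1 * w2 - e2 * w1) + e1 * (w1 * u2 - w2 * u1) by ring.
have u1p : 0 <= u1 by lra.
have e1p : 0 <= e1 by lra.
have [w1p|w1n] := ltP 0 w1; last first.
  have w10 : w1 = 0 by lra.
  have w2p : 0 < w2 by lra.
  by subst w1; split=> h1 h2; nra.
split=> h1 h2.
  rewrite -(pmulr_rgt0 _ w1p) key.
  have [u1p'|u1n] := ltP 0 u1.
    by apply: ltr_wpDr; [rewrite mulr_ge0 // ltW|rewrite mulr_gt0].
  have u10 : u1 = 0 by lra.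
  have [e1p'|e1n] := ltP 0 e1.
    by apply: ltr_wpDl; [rewrite mulr_ge0 // ltW|rewrite mulr_gt0].
  have e10 : e1 = 0 by lra.
  have e2p : 0 < e2 by lra.
  by subst; nra.
rewrite -(pmulr_rlt0 _ w1p) key.
have [u1p'|u1n] := ltP 0 u1.
  have := mulr_ge0 e1p (_ : 0 <= - (w1 * u2 - w2 * u1)).
  have := mulr_gt0 u1p' (_ : 0 < - (e1 * w2 - e2 * w1)).
  move=> /(_ ltac:(lra)) A /(_ ltac:(lra)) B; lra.
have u10 : u1 = 0 by lra.
have [e1p'|e1n] := ltP 0 e1.
  have := mulr_gt0 e1p' (_ : 0 < - (w1 * u2 - w2 * u1)).
  move=> /(_ ltac:(lra)) B; subst; lra.
have e10 : e1 = 0 by lra.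
have e2p : 0 < e2 by lra.
have u2p : 0 < u2 by lra.
by subst; nra.
Qed.

Lemma seg_disjointC a b p q : seg_disjoint a b p q -> seg_disjoint p q a b.
Proof. by move=> h s t hs ht /esym; apply: h. Qed.

Lemma lerp0 a b : lerp a b 0 = a.
Proof. by case: a => a1 a2; rewrite /lerp /= !mul0r !addr0. Qed.
Lemma lerp1 a b : lerp a b 1 = b.
Proof. by case: a b => [a1 a2] [b1 b2]; rewrite /lerp /= !mul1r !subrKC. Qed.
Lemma lerp_rev a b t : lerp a b t = lerp b a (1 - t).
Proof. by rewrite /lerp; congr pair; ring. Qed.

Lemma seg_disjoint_rev a b p q : seg_disjoint a b p q -> seg_disjoint b a p q.
Proof. by move=> h s t hs ht; rewrite lerp_rev; apply: h => //; lra. Qed.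

Lemma orient_lerp a b p q t :
  orient a b (lerp p q t) = orient a b p + t * (orient a b q - orient a b p).
Proof. by rewrite /orient /cross /=; ring. Qed.

(* The two segments are interleaved; if [p] and [b] lay on the same side of [ab]
   and [pq] respectively, the lines would meet between [p] and [b]. *)
Lemma interleaved_parity a b p q : seg_disjoint a b p q ->
  lexlt a p -> lexlt p b -> lexlt b q -> (0 < orient a b p) = ~~ (0 < orient p q b).
Proof.
move=> dis ap pb bq.
have ab := lexlt_trans ap pb; have pq := lexlt_trans pb bq.
have F0 : orient a b p <> 0.
  move=> /(on_segment ab); rewrite (lexltC ap) (lexltC pb) => /(_ isT isT) [s hs e].
  by apply: (dis s 0) => //; [rewrite lexx ler01|rewrite lerp0].
have G0 : orient p q b <> 0.
  move=> /(on_segment pq); rewrite (lexltC pb) (lexltC bq) => /(_ isT isT) [s hs e].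
  by apply: (dis 1 s) => //; [rewrite lexx ler01|rewrite lerp1].
have lexsub x y : lexlt x y -> lexlt 0 (y.1 - x.1, y.2 - x.2).
  by move=> /lexltP h; apply/lexltP => /=; case: h => h; [left; lra|right; split; lra].
have [st1 st2] := slope_trans erefl (lexsub _ _ ap) (lexsub _ _ pb) (lexsub _ _ pq).
(* [k] is the drop of [orient a b] from [p] to [q] and also that of [orient p q] from [b] to [a]. So
   the lines meet at the parameter [orient a b p / k] counted from [p] towards [q], and
   [orient p q b / k] counted from [b] towards [a]. *)
pose k := cross (q.1 - p.1, q.2 - p.2) (p.1 - a.1, p.2 - a.2)
   + cross (q.1 - p.1, q.2 - p.2) (b.1 - p.1, b.2 - p.2).
have Fe : orient a b p = cross (b.1 - p.1, b.2 - p.2) (p.1 - a.1, p.2 - a.2).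
  by rewrite /orient /cross /=; ring.
have Ge : orient p q b = cross (q.1 - p.1, q.2 - p.2) (b.1 - p.1, b.2 - p.2) by [].
have Fq : orient a b q = orient a b p - k by rewrite /orient /k /cross /=; ring.
have Ga : orient p q a = orient p q b - k by rewrite /orient /k /cross /=; ring.
rewrite -Fe -Ge in st1 st2.
have meet : k <> 0 -> 0 < orient a b p / k -> 0 < orient p q b / k -> False.
  move=> k0 tp sp.
  have tk : orient a b p / k * k = orient a b p by apply: divfK; exact/eqP.
  have sk : orient p q b / k * k = orient p q b by apply: divfK; exact/eqP.
  move: tp sp tk sk; move: (orient a b p / k) (orient p q b / k) => t s tp sp tk sk.
  have zE : lerp p q t = lerp a b (1 - s).
    rewrite /lerp; congr pair; apply: (mulIf (introN eqP k0)).
      transitivity (p.1 * k + t * k * (q.1 - p.1)); first by ring.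
      transitivity (b.1 * k - s * k * (b.1 - a.1)); last by ring.
      by rewrite tk sk /orient /k /cross /=; ring.
    transitivity (p.2 * k + t * k * (q.2 - p.2)); first by ring.
    transitivity (b.2 * k - s * k * (b.2 - a.2)); last by ring.
    by rewrite tk sk /orient /k /cross /=; ring.
  have pz : lexlt p (lerp p q t).
    by move/lexltP: pq => pq; apply/lexltP => /=; case: pq => [h|[h h']];
      [left; nra|right; split; nra].
  have zb : lexlt (lerp p q t) b.
    rewrite zE; move/lexltP: ab => ab; apply/lexltP => /=; case: ab => [h|[h h']];
      [left; nra|right; split; nra].
  have az := lexlt_trans ap pz; have zq := lexlt_trans zb bq.
  have oz : orient a b (lerp p q t) = 0.
    by rewrite orient_lerp Fq; lra.
  have [s' hs' e'] : exists2 s, 0 <= s <= 1 & lerp p q t = lerp a b s.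
    by apply: on_segment; rewrite ?(lexltC az) ?(lexltC zb).
  have oz' : orient p q (lerp p q t) = 0.
    by rewrite orient_lerp /orient /cross /=; ring.
  have [t' ht' e''] : exists2 s, 0 <= s <= 1 & lerp p q t = lerp p q s.
    by apply: on_segment; rewrite ?(lexltC pz) ?(lexltC zq).
  by apply: (dis s' t') => //; rewrite -e'.
have [Fp|Fn|/esym//] := ltgtP 0 (orient a b p); have [Gp|Gn|/esym//] := ltgtP 0 (orient p q b) => //; exfalso.
  have kp : 0 < k by rewrite /k -Ge; have := st1 Fp Gp; lra.
  by apply: meet; [lra|rewrite divr_gt0|rewrite divr_gt0].
have kn : k < 0 by rewrite /k -Ge; have := st2 Fn Gn; lra.
by apply: meet; [lra|rewrite -mulrNN -invrN divr_gt0; lra|rewrite -mulrNN -invrN divr_gt0; lra].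
Qed.

End CrossingParity.

Section PolylineParity.
Local Open Scope ring_scope.
Variable R : realFieldType.
Implicit Types a b p q z : R * R.

Lemma lerp_lex p q t : lexlt p q -> 0 <= t <= 1 ->
  ~~ lexlt (lerp p q t) p /\ ~~ lexlt q (lerp p q t).
Proof.
move=> /lexltP pq /andP[t0 t1].
have [->|tn0] := eqVneq t 0; first by rewrite lerp0; split; apply/negP => /lexltP h; lra.
have [->|tn1] := eqVneq t 1; first by rewrite lerp1; split; apply/negP => /lexltP h; lra.
have tp : 0 < t by rewrite lt_def tn0.
have tp' : 0 < 1 - t by rewrite subr_gt0 lt_def eq_sym tn1.
split; apply/negP => /lexltP /=.
  case: pq => [h|[h h']].
    by have := mulr_gt0 tp (_ : 0 < q.1 - p.1) => /(_ ltac:(lra)) ?; lra.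
  by have := mulr_gt0 tp (_ : 0 < q.2 - p.2) => /(_ ltac:(lra)); rewrite h => ? [?|[? ?]]; lra.
case: pq => [h|[h h']].
  by have := mulr_gt0 tp' (_ : 0 < q.1 - p.1) => /(_ ltac:(lra)) ?; lra.
by have := mulr_gt0 tp' (_ : 0 < q.2 - p.2) => /(_ ltac:(lra)); rewrite h => ? [?|[? ?]]; lra.
Qed.

(** [orient a b] is affine along [pq]. A change of sign would produce a zero, and this zero would
    lie on the segment [ab] because [p] and [q] are between [a] and [b]. *)
Lemma nested_parity a b p q : seg_disjoint a b p q ->
  lexlt a p -> lexlt p q -> lexlt q b -> (0 < orient a b p) = (0 < orient a b q).
Proof.
move=> dis ap pq qb.
have aq := lexlt_trans ap pq; have pb := lexlt_trans pq qb; have ab := lexlt_trans aq qb.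
have F0 t : 0 <= t <= 1 -> orient a b (lerp p q t) <> 0.
  move=> ht; move=> /(on_segment ab) H.
  have : ~~ lexlt (lerp p q t) a /\ ~~ lexlt b (lerp p q t).
    have [h1 h2] := lerp_lex pq ht.
    split; apply/negP => h; [move: h1|move: h2]; rewrite ?(lexlt_trans h ap) //.
    by rewrite (lexlt_trans qb h).
  by case=> h1 h2; have [s hs e] := H h1 h2; apply: (dis s t).
have F1 := F0 0; have F2 := F0 1; rewrite lerp0 lerp1 in F1 F2.
have {}F1 := F1 ltac:(lra); have {}F2 := F2 ltac:(lra).
have H : forall x y : R, x < 0 -> 0 < y -> 0 <= x / (x - y) <= 1.
  move=> x y x0 y0; rewrite ler_ndivrMr ?mul1r; last lra.
  rewrite -[x / _]mulrNN -invrN divr_ge0; lra.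
have [Fp|Fn|/esym//] := ltgtP 0 (orient a b p);
have [Gp|Gn|/esym//] := ltgtP 0 (orient a b q) => //; exfalso.
  have k0 : orient a b p - orient a b q != 0 by rewrite subr_eq0 gt_eqF // (lt_trans Gn).
  apply: (F0 (orient a b p / (orient a b p - orient a b q))).
    have := H (- orient a b p) (- orient a b q) ltac:(lra) ltac:(lra).
    by rewrite -opprD -mulrNN -invrN !opprK.
  by rewrite orient_lerp; field.
have k0 : orient a b p - orient a b q != 0 by rewrite subr_eq0 lt_eqF // (lt_trans Fn).
apply: (F0 (orient a b p / (orient a b p - orient a b q))); first exact: H.
by rewrite orient_lerp; field.
Qed.

(** By the order of the four end points: separated segments contribute no term, interleaved ones are
    [interleaved_parity], nested ones [nested_parity], and the other sign patterns violate
    transitivity. *)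
Lemma segment_parity_lt a b p q : seg_disjoint a b p q -> lexlt a b -> lexlt p q ->
  above a b p (+) above a b q (+) below p q a (+) below p q b = false.
Proof.
move=> dis ab pq.
have dis' := seg_disjointC dis.
have neq x y : (forall s t, 0 <= s <= 1 -> 0 <= t <= 1 -> lerp a b s = x -> lerp p q t = y -> x <> y).
  by move=> s t hs ht <- <-; apply: dis.
have nap : p <> a by apply/nesym/(neq _ _ 0 0); rewrite ?lerp0 // lexx ler01.
have naq : q <> a by apply/nesym/(neq _ _ 0 1); rewrite ?lerp0 ?lerp1 // lexx ler01.
have nbp : p <> b by apply/nesym/(neq _ _ 1 0); rewrite ?lerp0 ?lerp1 // lexx ler01.
have nbq : q <> b by apply/nesym/(neq _ _ 1 1); rewrite ?lerp1 // lexx ler01.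
rewrite /above /below /between ab pq.
rewrite (lexlt_total nap) (lexlt_total naq) (lexlt_total nbp) (lexlt_total nbq).
have I1 := interleaved_parity dis; have I2 := interleaved_parity dis'.
have N1 := nested_parity dis; have N2 := nested_parity dis'.
have T1 := @lexlt_trans _ a p b; have T2 := @lexlt_trans _ p q b.
have T3 := @lexlt_trans _ a p q; have T4 := @lexlt_trans _ p a b.
have T5 := @lexlt_trans _ a b q.
rewrite ?(lexlt_total nap) ?(lexlt_total naq) in I1 I2 N1 N2 T1 T2 T3 T4 T5.
rewrite ?(lexlt_total nbp) ?(lexlt_total nbq) in I1 I2 N1 N2 T1 T2 T3 T4 T5.
rewrite ?ab ?pq in I1 I2 N1 N2 T1 T2 T3 T4 T5.
case: (lexlt a p) I1 I2 N1 N2 T1 T2 T3 T4 T5; case: (lexlt a q);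
case: (lexlt b p); case: (lexlt b q) => //= I1 I2 N1 N2 T1 T2 T3 T4 T5;
rewrite ?addbF ?addFb //.
all: first [by move: (T1 isT isT) | by move: (T2 isT isT) | by move: (T3 isT isT)
  | by move: (T4 isT isT) | by move: (T5 isT isT) | idtac].
all: first [by rewrite (I1 isT isT isT); case: (0 < _) | by rewrite (I2 isT isT isT); case: (0 < _)
  | by rewrite (N1 isT isT isT) addbb | by rewrite (N2 isT isT isT) addbb | idtac].
Qed.

Lemma segment_parity a b p q : seg_disjoint a b p q ->
  above a b p (+) above a b q (+) below p q a (+) below p q b = false.
Proof.
move=> dis; have [ab|/eqP nab] := eqVneq a b.
  by rewrite /above /between ab !addbb.
have [pq|/eqP npq] := eqVneq p q.
  by rewrite /below /between pq !addbb.
have [ab|ab] := boolP (lexlt a b); have [pq|pq] := boolP (lexlt p q).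
- exact: segment_parity_lt.
- have qp : lexlt q p by rewrite (lexlt_total (nesym npq)) pq.
  rewrite (addbC (above a b p)) !(belowC _ npq).
  by apply: segment_parity_lt => //; apply/seg_disjointC/seg_disjoint_rev/seg_disjointC.
- have ba : lexlt b a by rewrite (lexlt_total (nesym nab)) ab.
  rewrite -addbA (addbC (below p q a)) addbA !(aboveC _ nab).
  by apply: segment_parity_lt => //; apply/seg_disjoint_rev.
- have qp : lexlt q p by rewrite (lexlt_total (nesym npq)) pq.
  have ba : lexlt b a by rewrite (lexlt_total (nesym nab)) ab.
  rewrite -addbA (addbC (below p q a)) addbA !(aboveC _ nab).
  rewrite (addbC (above b a p)) !(belowC _ npq).
  apply: segment_parity_lt => //; apply/seg_disjoint_rev.
  by apply/seg_disjointC/seg_disjoint_rev/seg_disjointC.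
Qed.

Fixpoint poly_sum (f : R * R -> R * R -> bool) a (s : seq (R * R)) : bool :=
  if s is b :: s' then f a b (+) poly_sum f b s' else false.

Fixpoint poly_all (P : R * R -> R * R -> Prop) a (s : seq (R * R)) : Prop :=
  if s is b :: s' then P a b /\ poly_all P b s' else True.

Lemma poly_allW (P Q : R * R -> R * R -> Prop) a s :
  (forall x y, P x y -> Q x y) -> poly_all P a s -> poly_all Q a s.
Proof. by move=> PQ; elim: s a => //= b s IH a [/PQ ? /IH]. Qed.

Lemma poly_all_cat (P : R * R -> R * R -> Prop) a s t :
  poly_all P a s -> poly_all P (last a s) t -> poly_all P a (s ++ t).
Proof. by elim: s a => //= b s IH a [? ?] ?; split=> //; apply: IH. Qed.

Definition poly_above a s p := poly_sum (fun x y => above x y p) a s.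
Definition poly_below a s p := poly_sum (fun x y => below x y p) a s.

(** The [between] terms telescope along the polyline and leave only its two ends. *)
Lemma poly_above_below a s p :
  poly_below a s p = poly_above a s p (+) lexlt a p (+) lexlt (last a s) p.
Proof.
elim: s a => [|b s IH] a /=; first by rewrite /poly_above /poly_below /=; case: lexlt.
rewrite /poly_below /poly_above /= in IH *; rewrite IH.
have -> : below a b p = above a b p (+) between a b p.
  by rewrite -above_below addKb.
rewrite /between; case: (above a b p); case: (lexlt a p); case: (lexlt b p);
by case: (poly_sum _ _ _); case: (lexlt _ p).
Qed.

(** Sum of [segment_parity] over all pairs of segments; the terms at an inner vertex of either
    polyline occur twice and cancel. *)
Lemma polyline_parity a s p t :
  poly_all (fun x y => poly_all (seg_disjoint x y) p t) a s ->
  poly_above a s p (+) poly_above a s (last p t)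
    (+) poly_below p t a (+) poly_below p t (last a s) = false.
Proof.
have single x y p' t' : poly_all (seg_disjoint x y) p' t' ->
  above x y p' (+) above x y (last p' t') (+) poly_below p' t' x (+) poly_below p' t' y = false.
  elim: t' p' => [|q t' IH] p' /=; first by rewrite addbb.
  move=> [/segment_parity h1 /IH h2]; rewrite /poly_below /= in h2 *.
  move: h1 h2; case: (above x y p'); case: (above x y q); case: (above x y (last q t'));
  case: (below p' q x); case: (below p' q y) => //= _;
  by case: (poly_sum _ _ _); case: (poly_sum _ _ _).
elim: s a => [|b s IH] a /=; first by rewrite addbb.
move=> [/single h1 /IH h2]; rewrite /poly_above /= in h2 *.
move: h1 h2; case: (above a b p); case: (above a b (last p t));
case: (poly_below p t a); case: (poly_below p t b) => //= _;
by case: (poly_sum _ _ _); case: (poly_sum _ _ _); case: (poly_below _ _ _).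
Qed.

End PolylineParity.

Section K5Polylines.
Local Open Scope ring_scope.
Variable R : realFieldType.

(** Turns a parity relation into evenness of a sum of naturals, a form in which [lia] can add up
    many of them. *)
Lemma addb8 (a b c d e f g h : bool) :
  a (+) b (+) (c (+) d (+) e) (+) (f (+) g (+) h) = false ->
  exists t, (a + b + c + d + e + f + g + h)%N = t.*2.
Proof.
by case: a; case: b; case: c; case: d; case: e; case: f; case: g; case: h => // _;
  first [by exists 0%N | by exists 1%N | by exists 2%N | by exists 3%N | by exists 4%N | idtac].
Qed.

(* Summing the parity relations over the fifteen disjoint pairs of edges of [K5], every
   [poly_above] term occurs twice, while each pair of vertices contributes six order
   bits, and the number of reversed ones is odd. *)
Lemma K5_polylines (x : nat -> R * R) (l : nat -> nat -> seq (R * R)) :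
  (forall i j, (i < j < 5)%N -> x i <> x j) ->
  (forall i j, (i < j < 5)%N -> last (x i) (l i j) = x j) ->
  (forall i j k m, (i < j < 5)%N -> (k < m < 5)%N -> uniq [:: i; j; k; m] ->
    poly_all (fun a b => poly_all (seg_disjoint a b) (x k) (l k m)) (x i) (l i j)) ->
  False.
Proof.
move=> xinj lst dis.
pose d i j k : nat := poly_above (x i) (l i j) (x k).
pose o i k : nat := lexlt (x i) (x k).
have E i j k m : (i < j < 5)%N && (k < m < 5)%N && uniq [:: i; j; k; m] ->
    exists t, (d i j k + d i j m + d k m i + o k i + o m i + d k m j + o k j + o m j)%N = t.*2.
  move=> /andP[/andP[ij km] u]; apply: addb8.
  have := polyline_parity (dis _ _ _ _ ij km u).
  by rewrite !lst // !poly_above_below !lst.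
have O i k : (i < k < 5)%N -> (o i k + o k i = 1)%N.
  move=> ik; rewrite /o (lexlt_total (xinj _ _ ik)); by case: lexlt.
have [t1 e1] := E 0 1 2 3 isT; have [t2 e2] := E 0 1 2 4 isT; have [t3 e3] := E 0 1 3 4 isT.
have [t4 e4] := E 0 2 1 3 isT; have [t5 e5] := E 0 2 1 4 isT; have [t6 e6] := E 0 2 3 4 isT.
have [t7 e7] := E 0 3 1 2 isT; have [t8 e8] := E 0 3 1 4 isT; have [t9 e9] := E 0 3 2 4 isT.
have [ta ea] := E 0 4 1 2 isT; have [tb eb] := E 0 4 1 3 isT; have [tc ec] := E 0 4 2 3 isT.
have [td ed] := E 1 2 3 4 isT; have [te ee] := E 1 3 2 4 isT; have [tf ef] := E 1 4 2 3 isT.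
have O1 := O 0 1 isT; have O2 := O 0 2 isT; have O3 := O 0 3 isT; have O4 := O 0 4 isT.
have O5 := O 1 2 isT; have O6 := O 1 3 isT; have O7 := O 1 4 isT.
have O8 := O 2 3 isT; have O9 := O 2 4 isT; have OA := O 3 4 isT.
clear -e1 e2 e3 e4 e5 e6 e7 e8 e9 ea eb ec ed ee ef O1 O2 O3 O4 O5 O6 O7 O8 O9 OA.
clearbody d o; lia.
Qed.
End K5Polylines.

Section EdgeRelations.
Variable T : finType.
Implicit Types (E : {set {set T}}) (S : {set T}) (e : rel T).

Definition edge_rel E : rel T := fun x y => (x != y) && ([set x; y]%SET \in E).

Definition within_rel S e : rel T := fun x y => [&& x \in S, y \in S & e x y].

Definition connected_in e S : Prop :=
  forall x y, x \in S -> y \in S -> connect (within_rel S e) x y.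

(** A minor isomorphic to the complete graph on [k] vertices, given by its branch sets. *)
Definition minorK k e : Prop := exists f : 'I_k -> {set T},
  [/\ forall i, f i != finset.set0, forall i, connected_in e (f i),
      forall i j, i != j -> [disjoint f i & f j]
    & forall i j, i != j -> exists x y, [/\ x \in f i, y \in f j & e x y]].

Lemma edge_rel_sym E : symmetric (edge_rel E).
Proof. by move=> x y; rewrite /edge_rel eq_sym finset.setUC. Qed.

Lemma within_rel_sym S e : symmetric e -> symmetric (within_rel S e).
Proof. by move=> se x y; rewrite /within_rel se andbCA. Qed.

End EdgeRelations.

(** * Plane drawings and their approximation by polylines *)

Section Drawings.
Local Open Scope ring_scope.
Variables (R : realType) (T : finType).
Implicit Types (E : {set {set T}}) (pos : T -> R * R) (arc : {set T} -> R -> R * R).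

(* A plane drawing whose arcs are moreover continuous on the whole real line. *)
Record drawing E pos arc : Prop := Drawing {
  dr_pos_inj : injective pos;
  dr_cont : forall e, e \in E -> continuous (arc e);
  dr_inj : forall e, e \in E -> forall s t, 0 <= s <= 1 -> 0 <= t <= 1 ->
    arc e s = arc e t -> s = t;
  dr_ends : forall e, e \in E ->
    exists u v : T, [/\ e = [set u; v]%SET, arc e 0 = pos u & arc e 1 = pos v];
  dr_vertices : forall e, e \in E ->
    forall t, 0 < t < 1 -> forall v : T, arc e t <> pos v;
  dr_disjoint : forall e f, e \in E -> f \in E -> e != f ->
    forall s t, 0 < s < 1 -> 0 < t < 1 -> arc e s <> arc f t }.

(** Composition with [clamp] extends an arc beyond [[0, 1]] by constants, so that continuity within
    a subspace becomes plain continuity. *)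
Definition clamp (t : R) : R := Num.max 0 (Num.min 1 t).

Lemma clamp_itv t : 0 <= clamp t <= 1.
Proof. by rewrite /clamp le_max lexx /= ge_max ler01 ge_min lexx. Qed.

Lemma clamp_id t : 0 <= t <= 1 -> clamp t = t.
Proof. by move=> /andP[t0 t1]; rewrite /clamp (min_idPr t1) (max_idPr t0). Qed.

Lemma clamp_lip t s : `|clamp t - clamp s| <= `|t - s|.
Proof.
have h1 := ler_norm (t - s); have h2 := ler_norm (s - t); rewrite distrC in h2.
have cE u : clamp u = if u <= 0 then 0 else if 1 <= u then 1 else u.
  rewrite /clamp; case: (leP 1 u) => h3; case: (leP u 0) => h4.
  - by lra.
  - by rewrite (max_idPr ler01).
  - by [].
  - by [].
rewrite ler_norml !cE; case: (leP t 0) => ?; case: (leP s 0) => ?;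
case: (leP 1 t) => ?; case: (leP 1 s) => ?; lra.
Qed.

Lemma continuous_clamp (f : R -> R * R) :
  ({within `[0, 1], continuous f})%classic -> continuous (f \o clamp).
Proof.
move=> /subspace_continuousP cf t.
have c01 : `[0, 1]%classic (clamp t) by rewrite /= in_itv /= clamp_itv.
apply/cvgrPdist_lt => e e0.
have /cvgrPdist_lt /(_ e e0) := cf _ c01; rewrite near_withinE => /nbhs_ballP [d d0 hd].
apply/nbhs_ballP; exists d => // s ts; apply: hd; last by rewrite /= in_itv /= clamp_itv.
exact: le_lt_trans (clamp_lip _ _) ts.
Qed.

Lemma planar_drawing E : planar R E <-> exists pos arc, drawing E pos arc.
Proof.
split=> -[pos [arc d]].
  exists pos, (fun e => arc e \o clamp); split.
  - exact: (pos_inj d).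
  - by move=> e eE; apply: continuous_clamp; exact: (arc_continuous d).
  - move=> e eE s t s01 t01 /=; rewrite !clamp_id // => h.
    by apply: (arc_inj d eE) => //; rewrite in_itv.
  - move=> e eE; have [u [v [? h0 h1]]] := arc_ends d eE.
    by exists u, v; rewrite /= !clamp_id ?lexx ?ler01.
  - move=> e eE t t01 v /=; rewrite clamp_id; last by case/andP: t01 => /ltW -> /ltW ->.
    by apply: (arc_avoids_vertices d eE); rewrite in_itv.
  - move=> e f eE fE ef s t s01 t01 /=.
    rewrite !clamp_id; last 2 first.
    + by case/andP: t01 => /ltW -> /ltW ->.
    + by case/andP: s01 => /ltW -> /ltW ->.
    by apply: (arc_disjoint d eE fE ef); rewrite in_itv.
exists pos, arc; split.
- exact: (dr_pos_inj d).
- by move=> e eE; apply: continuous_subspaceT; exact: (dr_cont d eE).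
- by move=> e eE s t; rewrite !in_itv /= => hs ht; exact: (dr_inj d eE).
- exact: (dr_ends d).
- by move=> e eE t; rewrite in_itv /=; exact: (dr_vertices d eE).
- by move=> e f eE fE ef s t; rewrite !in_itv /=; exact: (dr_disjoint d eE fE ef).
Qed.

Lemma continuous_lip (f : R -> R * R) (g : R -> R) (C : R) :
  (forall t s, `|g t - g s| <= C * `|t - s|) -> continuous f -> continuous (f \o g).
Proof.
move=> lip cf t; apply/cvgrPdist_lt => e e0.
have /cvgrPdist_lt /(_ e e0) /nbhs_ballP [d d0 hd] := cf (g t).
have C0 : 0 < `|C| + 1 by rewrite ltr_wpDl.
apply/nbhs_ballP; exists (d / (`|C| + 1)); first by rewrite /= divr_gt0.
move=> s; rewrite /ball /= ltr_pdivlMr // => ts; apply: hd.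
apply: le_lt_trans (lip _ _) _; apply: le_lt_trans ts.
rewrite mulrC ler_wpM2l //; have := ler_norm C; lra.
Qed.

Lemma continuous_rev (f : R -> R * R) : continuous f -> continuous (fun t : R => f (1 - t)).
Proof.
apply: (@continuous_lip f (fun t : R => 1 - t) 1) => t s.
by rewrite mul1r opprB addrC addrA subrK distrC.
Qed.

Definition near_on (f : R -> R * R) (eps : R) (a b : R * R) : Prop :=
  [/\ exists2 t, 0 <= t <= 1 & a = f t, exists2 t, 0 <= t <= 1 & b = f t & `|a - b| < eps].

(** Induction along the interval: by continuity at the supremum of the parameters reached by such
    chains, one more vertex leads from just below the supremum to a point beyond it, unless the
    supremum is 1 and is itself reached. *)
Lemma arc_chain (f : R -> R * R) (eps : R) : continuous f -> 0 < eps ->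
  exists2 s, last (f 0) s = f 1 & poly_all (near_on f eps) (f 0) s.
Proof.
move=> cf e0.
pose A : set R := [set t | 0 <= t <= 1 /\
  exists2 s, last (f 0) s = f t & poly_all (near_on f eps) (f 0) s]%classic.
have A0 : A 0 by split; [rewrite lexx ler01|exists [::]].
have hA : has_sup A by split; [exists 0|exists 1 => t [/andP[]]].
have c0 : 0 <= sup A by apply: sup_upper_bound hA _ A0.
have c1 : sup A <= 1 by apply: ge_sup; [exists 0|move=> t [/andP[]]].
have /cvgrPdist_lt /(_ (eps / 2)) := cf (sup A).
rewrite divr_gt0 // => /(_ isT) /nbhs_ballP [d d0 hd].
have [t At tc] := sup_adherent d0 hA.
have tc' : t <= sup A by apply: sup_upper_bound hA _ At.
case: At => t01 [s ls ps].
pose x := Num.min (sup A + d / 2) 1.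
have x01 : 0 <= x <= 1.
  by rewrite /x le_min ler01 ge_min lexx orbT !andbT addr_ge0 // divr_ge0 // ltW.
have hc y : `|sup A - y| < d -> `|f (sup A) - f y| < eps / 2 by move=> h; apply: hd.
have Ax : A x.
  split=> //; exists (rcons s (f x)); first by rewrite last_rcons.
  rewrite -cats1; apply: poly_all_cat => //=; split=> //; rewrite ls.
  split; [by exists t|by exists x|].
  have -> : f t - f x = (f (sup A) - f x) - (f (sup A) - f t).
    by rewrite opprB [RHS]addrC subrKA.
  apply: (le_lt_trans (ler_normB _ _)).
  rewrite (splitr eps) ltrD // hc // ltr_norml /x; last lra.
  by case: (leP (sup A + d / 2) 1) => ?; lra.
have xc : x <= sup A by apply: sup_upper_bound hA _ Ax.
have x1 : x = 1 by move: xc; rewrite /x; case: (leP (sup A + d / 2) 1) => ?; lra.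
by case: Ax => _ [s' ? ?]; exists s' => //; rewrite -x1.
Qed.

Lemma arcs_apart (f g : R -> R * R) : continuous f -> continuous g ->
  (forall s t, 0 <= s <= 1 -> 0 <= t <= 1 -> f s <> g t) ->
  exists2 d, 0 < d & forall s t, 0 <= s <= 1 -> 0 <= t <= 1 -> d <= `|f s - g t|.
Proof.
move=> cf cg fg.
pose K : set (R * R) := (`[0, 1] `*` `[0, 1])%classic.
pose h (p : R * R) : R := `|f p.1 - g p.2|.
have K0 : (K !=set0)%classic by exists (0, 0); split; rewrite /= in_itv /= lexx ler01.
have cK : compact K by apply: compact_setX; exact: segment_compact.
have ch : ({within K, continuous h})%classic.
  apply: continuous_subspaceT => p; apply: cvg_norm; apply: cvgB.
    by apply: (@continuous_comp _ _ _ fst f); [exact: cvg_fst|exact: cf].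
  by apply: (@continuous_comp _ _ _ snd g); [exact: cvg_snd|exact: cg].
have [[s t]] := compact_EVT_min K0 cK ch.
rewrite inE => -[/=]; rewrite !in_itv /= => s01 t01 hm.
exists (h (s, t)); first by rewrite normr_gt0 subr_eq0; apply/eqP; exact: fg.
move=> s' t' s'01 t'01; apply: (hm (s', t')).
by rewrite inE; split; rewrite /= in_itv.
Qed.

Lemma disjoint_edges_apart E pos arc e f : drawing E pos arc -> e \in E -> f \in E ->
  [disjoint e & f] -> forall s t, 0 <= s <= 1 -> 0 <= t <= 1 -> arc e s <> arc f t.
Proof.
move=> d eE fE dis.
have ends e' : e' \in E -> forall s, 0 <= s <= 1 ->
    (0 < s < 1) \/ (exists2 u, u \in e' & arc e' s = pos u).
  move=> e'E s /andP[s0 s1]; have [u [v [-> h0 h1]]] := dr_ends d e'E.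
  have [->|n0] := eqVneq s 0; first by right; exists u => //; rewrite !inE eqxx.
  have [->|n1] := eqVneq s 1; first by right; exists v => //; rewrite !inE eqxx orbT.
  by left; rewrite !lt_def n0 s0 eq_sym n1 s1.
have ef : e != f.
  apply/eqP => ef; have [u [v [e' _ _]]] := dr_ends d eE.
  by move: dis; rewrite -ef -finset.setI_eq0 finset.setIid e' => /eqP/setP/(_ u); rewrite !inE eqxx.
move=> s t hs ht; case: (ends e eE s hs) => [s01|[u ue ->]]; case: (ends f fE t ht) => [t01|[v vf ->]].
- exact: (dr_disjoint d).
- exact: (dr_vertices d).
- by apply/nesym; exact: (dr_vertices d).
- by move=> /(dr_pos_inj d) uv; move: dis; rewrite disjoint_subset => /fintype.subsetP/(_ u ue); rewrite inE uv vf.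
Qed.

Lemma edges_apart E pos arc : drawing E pos arc -> exists2 d, 0 < d &
  forall e f, e \in E -> f \in E -> [disjoint e & f] ->
    forall s t, 0 <= s <= 1 -> 0 <= t <= 1 -> d <= `|arc e s - arc f t|.
Proof.
move=> dr.
have H (p : {set T} * {set T}) : exists d, 0 < d /\ (p.1 \in E -> p.2 \in E -> [disjoint p.1 & p.2] ->
    forall s t, 0 <= s <= 1 -> 0 <= t <= 1 -> d <= `|arc p.1 s - arc p.2 t|).
  case: (boolP [&& p.1 \in E, p.2 \in E & [disjoint p.1 & p.2]]) => [/and3P[h1 h2 h3]|h].
    have [d d0 hd] := arcs_apart (dr_cont dr h1) (dr_cont dr h2) (disjoint_edges_apart dr h1 h2 h3).
    by exists d.
  by exists 1; split=> // h1 h2 h3; rewrite h1 h2 h3 in h.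
have [D hD] := boolp.choice H.
exists (\big[Num.min/1]_p D p).
  elim/big_ind: _ => // [x y x0 y0|p _]; first by rewrite lt_min x0.
  by have [] := hD p.
move=> e f eE fE ef s t hs ht; have [_ h] := hD (e, f).
apply: le_trans (h eE fE ef s t hs ht).
exact: bigmin_le.
Qed.

Lemma edge_path_chain E pos arc (S : {set T}) (eps : R) x y : drawing E pos arc -> 0 < eps ->
  connect (within_rel S (edge_rel E)) x y ->
  exists2 s, last (pos x) s = pos y & poly_all (fun a b => exists e, [/\ e \in E, e \subset S &
     near_on (arc e) eps a b]) (pos x) s.
Proof.
move=> dr e0 /connectP [p pp ->] {y}; elim: p x pp => [|y p IH] x /=; first by exists [::].
move=> /andP[/and3P[xS yS /andP[xy xyE]] /IH [s ls ps]].
have step : exists2 s, last (pos x) s = pos y & poly_all (fun a b => exists e,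
    [/\ e \in E, e \subset S & near_on (arc e) eps a b]) (pos x) s.
  have sub : [set x; y]%SET \subset S by rewrite finset.subUset !finset.sub1set xS.
  have [u [v [euv h0 h1]]] := dr_ends dr xyE.
  have : (x = u /\ y = v) \/ (x = v /\ y = u).
    have xin : x \in [set u; v]%SET by rewrite -euv !inE eqxx.
    have yin : y \in [set u; v]%SET by rewrite -euv !inE eqxx orbT.
    move: xin yin xy; rewrite !inE => /orP[]/eqP -> /orP[]/eqP ->; rewrite ?eqxx // => _; by auto.
  case=> -[-> ->]; rewrite -h0 -h1.
    have [s' ls' ps'] := arc_chain (dr_cont dr xyE) e0.
    by exists s' => //; apply: poly_allW ps' => a b ?; exists [set x; y]%SET.
  have [s'] := arc_chain (continuous_rev (dr_cont dr xyE)) e0.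
  rewrite subr0 subrr => ls' ps'; exists s' => //.
  apply: poly_allW ps' => a b [[t t01 ->] [t' t'01 ->] ?]; exists [set x; y]%SET; split=> //.
  by split=> //; [exists (1 - t) => //|exists (1 - t') => //]; lra.
have [s1 ls1 ps1] := step.
exists (s1 ++ s); first by rewrite last_cat ls1.
by apply: poly_all_cat => //; rewrite ls1.
Qed.

(** Each segment stays within [d / 2] of its starting point, which is on its curve; a common point
    would bring the two curves nearer than [d]. *)
Lemma near_on_seg_disjoint (d : R) (f g : R -> R * R) a b p q :
  (forall s t, 0 <= s <= 1 -> 0 <= t <= 1 -> d <= `|f s - g t|) ->
  near_on f (d / 2) a b -> near_on g (d / 2) p q -> seg_disjoint a b p q.
Proof.
move=> fg [[t1 ht1 ->] _ ab] [[t2 ht2 ->] _ pq] s t hs ht zz.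
have lerpN (x y : R * R) u : 0 <= u <= 1 -> `|x - lerp x y u| <= `|x - y|.
  move=> /andP[u0 u1]; have -> : x - lerp x y u = u *: (x - y).
    by case: x y => [x1 x2] [y1 y2]; rewrite /lerp; congr pair => /=; rewrite /GRing.scale /=; ring.
  by rewrite normrZ ger0_norm // ler_piMl.
have := fg _ _ ht1 ht2; rewrite leNgt => /negP; apply.
have -> : f t1 - g t2 = (f t1 - lerp (f t1) b s) - (g t2 - lerp (g t2) q t).
  by rewrite zz opprB addrA subrK.
apply: le_lt_trans (ler_normB _ _) _.
by rewrite (splitr d) ltrD // (le_lt_trans (lerpN _ _ _ _)).
Qed.

(** A root [r i] is chosen in each branch set, and [r i], [r j] are joined by a path inside [f i]
    and [f j]. For disjoint pairs of indices the paths use disjoint edges, whose arcs have a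
    positive distance, so fine polylines along them are disjoint. [K5_polylines] asks for no
    more. *)
Lemma planar_no_K5 E : planar R E -> ~ minorK 5 (edge_rel E).
Proof.
move=> /planar_drawing [pos [arc dr]] [f [f0 fc fd fa]].
have [d d0 hd] := edges_apart dr.
have Hr (i : 'I_5) : exists x, x \in f i by apply/finset.set0Pn.
have [r hr] := boolp.choice Hr.
have mono (S S' : {set T}) x y : S \subset S' -> connect (within_rel S (edge_rel E)) x y ->
    connect (within_rel S' (edge_rel E)) x y.
  move=> sub; apply: connect_sub => u v /and3P[uS vS uv]; apply: connect1.
  by rewrite /within_rel uv !(fintype.subsetP sub).
have conn i j : i != j -> connect (within_rel (f i :|: f j)%SET (edge_rel E)) (r i) (r j).
  move=> ij; have [x [y [xi yj xy]]] := fa i j ij.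
  apply: (@connect_trans _ _ x).
    by apply: (mono (f i)); [exact: finset.subsetUl|exact: fc].
  apply: (@connect_trans _ _ y).
    by apply: connect1; rewrite /within_rel !inE xi yj orbT.
  by apply: (mono (f j)); [exact: finset.subsetUr|exact: fc].
pose Q (S : {set T}) a b := exists e, [/\ e \in E, e \subset S & near_on (arc e) (d / 2) a b].
have d20 : 0 < d / 2 by rewrite divr_gt0.
have H (p : 'I_5 * 'I_5) : exists s, p.1 != p.2 ->
    last (pos (r p.1)) s = pos (r p.2) /\ poly_all (Q (f p.1 :|: f p.2)%SET) (pos (r p.1)) s.
  case: p => i j /=; have [->|ij] := eqVneq i j; first by exists [::].
  by have [s ? ?] := edge_path_chain dr d20 (conn i j ij); exists s.
have [l hl] := boolp.choice H.
pose o (i : nat) : 'I_5 := inord i.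
have oE i : (i < 5)%N -> o i = i :> nat by move=> ?; rewrite inordK.
have oinj i j : (i < 5)%N -> (j < 5)%N -> i != j -> o i != o j.
  by move=> i5 j5; apply: contra => /eqP /(congr1 val) /=; rewrite !oE // => ->.
apply: (@K5_polylines R (fun i => pos (r (o i))) (fun i j => l (o i, o j))).
- move=> i j /andP[ij j5] /(dr_pos_inj dr) rr.
  have n := oinj i j (ltn_trans ij j5) j5 (negbT (ltn_eqF ij)).
  by have := fd _ _ n; rewrite disjoint_subset => /fintype.subsetP /(_ _ (hr _)); rewrite inE rr hr.
- move=> i j /andP[ij j5].
  by have [] := hl (o i, o j) (oinj i j (ltn_trans ij j5) j5 (negbT (ltn_eqF ij))).
- move=> i j k m /andP[ij j5] /andP[km m5] u.
  have i5 := ltn_trans ij j5; have k5 := ltn_trans km m5.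
  have [_ P1] := hl (o i, o j) (oinj i j i5 j5 (negbT (ltn_eqF ij))).
  have [_ P2] := hl (o k, o m) (oinj k m k5 m5 (negbT (ltn_eqF km))).
  apply: poly_allW P1 => a b [e [eE eS ne]]; apply: poly_allW P2 => p q [e' [e'E e'S ne']].
  apply: near_on_seg_disjoint ne ne'; apply: hd => //.
  apply: (disjointWl eS); apply: (disjointWr e'S).
  move: u; rewrite /= !inE !negb_or => /and4P[/and3P[_ ik im] /andP[jk jm] _ _].
  by rewrite -finset.setI_eq0 finset.setIUl !finset.setIUr !finset.setU_eq0 !finset.setI_eq0 !fd ?oinj.
Qed.

End Drawings.

(** * Average degree and the K5 minor *)

Section Models.
Variables (T : finType) (e : rel T).
Hypothesis e_sym : symmetric e.
Local Open Scope nat_scope.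
Local Notation set0 := finset.set0.
Local Notation subsetP := fintype.subsetP.
Implicit Types (B C D U : {set T}) (M N : {set {set T}}).

Definition touch B C : bool := [exists x in B, exists y in C, e x y].

Definition madj B C : bool := (B != C) && touch B C.

(* A minor of [e], given by its branch sets. *)
Definition model M : Prop :=
  [/\ finset.trivIset M, set0 \notin M & forall B, B \in M -> connected_in e B].

(** Ordered pairs are counted: this is the sum of the degrees of the minor. *)
Definition mdeg M : nat := #|[set p | [&& p.1 \in M, p.2 \in M & madj p.1 p.2]]|.

Lemma touchP B C : reflect (exists x y, [/\ x \in B, y \in C & e x y]) (touch B C).
Proof.
apply: (iffP existsP) => [[x /andP[xB /existsP[y /andP[yC xy]]]]|[x [y [xB yC xy]]]].
  by exists x, y.
by exists x; rewrite xB; apply/existsP; exists y; rewrite yC.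
Qed.

Lemma touchC B C : touch B C = touch C B.
Proof. by apply/touchP/touchP => -[x [y [? ? ?]]]; exists y, x; rewrite e_sym. Qed.

Lemma madjC B C : madj B C = madj C B.
Proof. by rewrite /madj touchC eq_sym. Qed.

Lemma touchW B C B' C' : B \subset B' -> C \subset C' -> touch B C -> touch B' C'.
Proof.
move=> /subsetP sB /subsetP sC /touchP[x [y [? ? ?]]]; apply/touchP.
by exists x, y; split; auto.
Qed.

Lemma connect_within_mono B C x y : B \subset C ->
  connect (within_rel B e) x y -> connect (within_rel C e) x y.
Proof.
move=> sub; apply: connect_sub => u v /and3P[uS vS uv]; apply: connect1.
by rewrite /within_rel uv !(subsetP sub).
Qed.

Lemma connected_inU B C : connected_in e B -> connected_in e C -> touch B C ->
  connected_in e (B :|: C).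
Proof.
move=> cB cC /touchP[b [c [bB cC' bc]]].
have BC : connect (within_rel (B :|: C) e) b c.
  by apply: connect1; rewrite /within_rel !inE bB cC' orbT.
have CB : connect (within_rel (B :|: C) e) c b.
  by apply: connect1; rewrite /within_rel !inE bB cC' orbT e_sym.
have mB := @connect_within_mono B (B :|: C) _ _ (finset.subsetUl _ _).
have mC := @connect_within_mono C (B :|: C) _ _ (finset.subsetUr _ _).
move=> x y; rewrite !inE => /orP[xB|xC] /orP[yB|yC].
- exact/mB/cB.
- by apply: connect_trans (mB _ _ (cB _ _ xB bB)) _; apply: connect_trans BC _; exact/mC/cC.
- by apply: connect_trans (mC _ _ (cC _ _ xC cC')) _; apply: connect_trans CB _; exact/mB/cB.
- exact/mC/cC.
Qed.

Lemma model_disjoint M B C : model M -> B \in M -> C \in M -> B != C -> [disjoint B & C].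
Proof. by move=> [/finset.trivIsetP tr _ _]; exact: tr. Qed.

Lemma model_sub M N : N \subset M -> model M -> model N.
Proof.
move=> sub [/finset.trivIsetP tr n0 con]; split.
- by apply/finset.trivIsetP => B C ? ?; apply: tr; exact: (subsetP sub).
- by apply: contra n0; exact: (subsetP sub).
- by move=> B ?; apply: con; exact: (subsetP sub).
Qed.

Section Contract.
Variables (M : {set {set T}}) (B C : {set T}).
Hypotheses (mM : model M) (BM : B \in M) (CM : C \in M) (BC : madj B C).

Let U := B :|: C.
Definition contract := U |: (M :\ B :\ C).

Let h D := if (D == B) || (D == C) then U else D.

Let UB : B \subset U. Proof. exact: finset.subsetUl. Qed.
Let UC : C \subset U. Proof. exact: finset.subsetUr. Qed.
Let nBC : B != C. Proof. by case/andP: BC. Qed.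

Let M0 D : D \in M -> exists x, x \in D.
Proof. by move=> DM; apply/finset.set0Pn; apply: contraTneq DM => ->; case: mM. Qed.

Let UD D : D \in M -> D != B -> D != C -> [disjoint U & D].
Proof.
move=> DM DB DC; rewrite -finset.setI_eq0 finset.setIUl finset.setU_eq0 !finset.setI_eq0.
by rewrite !(model_disjoint mM) // eq_sym.
Qed.

Let UnM : U \notin M.
Proof.
apply/negP => UM; have [[x xB] [y yC]] := (M0 BM, M0 CM).
have xU := subsetP UB x xB; have yU := subsetP UC y yC.
have [UBe|UBn] := eqVneq U B.
  by have := model_disjoint mM BM CM nBC; rewrite disjoint_sym disjoint_subset => /subsetP/(_ y yC);
    rewrite inE -UBe yU.
by have := model_disjoint mM UM BM UBn; rewrite disjoint_sym disjoint_subset => /subsetP/(_ x xB);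
    rewrite inE xU.
Qed.

Let hM D : D \in M -> h D \in contract.
Proof.
move=> DM; rewrite /h /contract; case: eqVneq => [_|DB] /=; first by rewrite !inE eqxx.
by case: eqVneq => [_|DC]; rewrite !inE ?eqxx // DM DB DC orbT.
Qed.

Let hsub D : D \subset h D.
Proof. by rewrite /h; case: eqVneq => [->//|_] /=; case: eqVneq => [->|]. Qed.

Lemma card_contract : #|contract|.+1 = #|M|.
Proof.
rewrite /contract cardsU1 !inE (negbTE UnM) !andbF /= add1n.
by rewrite [RHS](cardsD1 B) BM (cardsD1 C (M :\ B)) !inE CM eq_sym nBC /= !add1n.
Qed.

Lemma contract_model : model contract.
Proof.
have [/finset.trivIsetP tr n0 con] := mM; split.
- apply/finset.trivIsetP => D D'; rewrite !inE => /orP[/eqP->|/and3P[DC DB DM]] /orP[/eqP->|/and3P[DC' DB' DM']].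
  + by rewrite eqxx.
  + by move=> _; exact: UD.
  + by move=> _; rewrite disjoint_sym; exact: UD.
  + exact: tr.
- have [x xB] := M0 BM; rewrite !inE (negbTE n0) !andbF orbF; apply/eqP => U0.
  by have := subsetP UB x xB; rewrite -U0 inE.
- move=> D; rewrite !inE => /orP[/eqP->|/and3P[_ _ DM]]; last exact: con.
  by apply: connected_inU; [exact: con|exact: con|case/andP: BC].
Qed.

Lemma contract_finer D : D \in contract -> exists2 D', D' \in M & D' \subset D.
Proof.
rewrite !inE => /orP[/eqP->|/and3P[_ _ DM]]; first by exists B.
by exists D.
Qed.

Lemma cover_contract : finset.cover contract \subset finset.cover M.
Proof.
apply/finset.bigcupsP => D; rewrite !inE => /orP[/eqP->|/and3P[_ _ DM]].
  by rewrite finset.subUset; apply/andP; split; [exact: (finset.bigcup_sup _ BM)|exact: (finset.bigcup_sup _ CM)].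
exact: finset.bigcup_sup.
Qed.

Definition common := [set D in M | madj D B && madj D C].

(** The contraction loses the edge between [B] and [C] and, for each common neighbour, one of two
    edges that become parallel. [Z] lists the lost ordered pairs, choosing the edge at [C]; outside
    [Z] the map induced by [h] is injective. *)
Lemma mdeg_contract : mdeg M <= mdeg contract + (#|common|.+1).*2.
Proof.
pose X := [set p : {set T} * {set T} | [&& p.1 \in M, p.2 \in M & madj p.1 p.2]].
pose Z := ((B, C) |: ((C, B) |: ([set (C, D) | D in common] :|: [set (D, C) | D in common]))).
have cZ : #|Z| <= (#|common|.+1).*2.
  rewrite doubleS -addnn !cardsU1.
  have := (leq_card_setU [set (C, D) | D in common] [set (D, C) | D in common]).1.
  have := leq_imset_card (fun D => (C, D)) common; have := leq_imset_card (fun D => (D, C)) common.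
  case: (_ \notin _); case: (_ \notin _) => h1 h2 h3; have := leq_trans h3 (leq_add h2 h1); rewrite ?add1n ?add0n ?ltnS => h4; first [exact: h4 | exact: leqW | exact: (leqW (leqW h4))].
rewrite /mdeg -/X -(cardsID Z X) addnC; apply: leq_add; last first.
  exact: leq_trans (subset_leq_card (finset.subsetIr _ _)) cZ.
have hinj D E : D \in M -> E \in M -> h D = h E -> D = E \/ (D = B /\ E = C) \/ (D = C /\ E = B).
  move=> DM EM; rewrite /h.
  case: (eqVneq D B) => dB; case: (eqVneq E B) => eB;
    case: (eqVneq D C) => dC; case: (eqVneq E C) => eC /= eU;
    first [by left; congruence|by right; left|by right; right
      |by move: UnM; rewrite eU EM|by move: UnM; rewrite -eU DM].
pose hh (p : {set T} * {set T}) := (h p.1, h p.2).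
rewrite -(@card_in_imset _ _ hh (mem (X :\: Z))).
  apply/subset_leq_card/subsetP => p /imsetP[[D D'] pX ->]; rewrite inE /hh /=; move: pX; rewrite [in X in X -> _]inE [in X in X -> _]inE.
  rewrite [in X in X -> _]inE [in X in X -> _]inE [in X in X -> _]inE [in X in X -> _]inE !negb_or /=.
  move=> /andP[/and4P[n1 n2 _ _]]; rewrite inE /= => /and3P[DM DM' DD]; rewrite !hM //=.
  apply/andP; split; last by apply: touchW (hsub D) (hsub D') _; case/andP: DD.
  apply/eqP => /(hinj _ _ DM DM')[?|[[? ?]|[? ?]]]; subst.
  - by move: DD; rewrite /madj eqxx.
  - by rewrite eqxx in n1.
  - by rewrite eqxx in n2.
have common_fst D : D \in M -> madj B D -> madj C D -> (C, D) \in Z.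
  move=> DM BD CD; rewrite !inE; apply/orP; right; apply/orP; right; apply/orP; left.
  by apply: imset_f; rewrite !inE DM madjC BD madjC.
have common_snd D : D \in M -> madj D B -> madj D C -> (D, C) \in Z.
  move=> DM BD CD; rewrite !inE; apply/orP; right; apply/orP; right; apply/orP; right.
  by apply: imset_f; rewrite !inE DM BD.
have irr D : madj D D = false by rewrite /madj eqxx.
have ZBC : (B, C) \in Z by rewrite !inE eqxx.
have ZCB : (C, B) \in Z by rewrite !inE eqxx orbT.
move=> [D1 D2] [E1 E2] /finset.setDP[]; rewrite inE /= => /and3P[M1 M2 A1] n1.
move=> /finset.setDP[]; rewrite inE /= => /and3P[M3 M4 A2] n2 [/(hinj _ _ M1 M3) r1 /(hinj _ _ M2 M4) r2].
case: r1 => [?|[[? ?]|[? ?]]]; case: r2 => [?|[[? ?]|[? ?]]]; subst; rewrite ?irr // in A1 A2 *;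
  by move: n1 n2; rewrite ?ZBC ?ZCB ?(common_fst _ M2) ?(common_fst _ M4) ?(common_snd _ M1) ?(common_snd _ M3) ?andbF.
Qed.

End Contract.
End Models.

Section Mader.
Variables (T : finType) (e : rel T).
Hypothesis e_sym : symmetric e.
Local Open Scope nat_scope.
Local Notation set0 := finset.set0.
Local Notation subsetP := fintype.subsetP.
Implicit Types (B C D U : {set T}) (M N : {set {set T}}).
Local Notation madj := (madj e).
Local Notation model := (model e).
Local Notation mdeg := (mdeg e).

Lemma mdegE M : mdeg M = \sum_(B in M) #|[set C in M | madj B C]|.
Proof.
rewrite /mdeg -sum1_card (eq_bigl (fun p => (p.1 \in M) && (madj p.1 p.2 && (p.2 \in M)))); last first.
  by move=> p; rewrite inE; congr andb; rewrite andbC.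
rewrite -(pair_big_dep (mem M) (fun B C => madj B C && (C \in M)) (fun _ _ => 1)) /=.
by apply: eq_bigr => B BM; rewrite -sum1_card; apply: eq_bigl => C; rewrite inE andbC.
Qed.

(** The last two clauses serve the induction: a block adjacent to and disjoint from all blocks of
    [M] is then adjacent to and disjoint from all blocks of [N], so it can be added to the
    clique. *)
Definition clique_minor k M N := [/\ model N, #|N| = k, {in N &, forall B C, B != C -> madj B C},
  forall D, D \in N -> exists2 D', D' \in M & D' \subset D
  & finset.cover N \subset finset.cover M].

(* Contract an edge whose ends have few common neighbours; if there is none, the
   neighbourhood of any block is dense enough for a smaller clique minor, to which
   the block is added. *)
Theorem mader k M : 2 <= k -> model M -> 0 < #|M| -> 2 ^ k * #|M| <= 4 * mdeg M ->
  exists N, clique_minor k M N.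
Proof.
elim: k M => // k IHk M; rewrite leq_eqVlt => /orP[/eqP k1|k2].
  move=> mM M0 deg; have : 0 < mdeg M by move: deg; case: (mdeg M) => //; rewrite muln0 leqn0 muln_eq0 expn_eq0 /= => /eqP h; rewrite h in M0.
  move=> /card_gt0P[[B C]]; rewrite inE /= => /and3P[BM CM BC].
  have nBC : B != C by case/andP: BC.
  have sub : [set B; C] \subset M by rewrite finset.subUset !finset.sub1set BM.
  exists [set B; C]; split.
  - exact: model_sub sub mM.
  - by rewrite cards2 nBC -k1.
  - by move=> D E; rewrite !inE => /orP[]/eqP-> /orP[]/eqP->; rewrite ?eqxx // madjC.
  - by move=> D /(subsetP sub) DM; exists D.
  - apply/finset.bigcupsP => D /(subsetP sub) DM; exact: (finset.bigcup_sup _ DM).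
have {}IHk := IHk _ k2.
move: {2}(#|M|) (leqnn #|M|) => n; elim: n M => [|n IHn] M Mn mM M0 deg; first by rewrite lt0n -leqn0 Mn in M0.
(* Contraction lowers [4 * mdeg] by at most [8 * (#|common| + 1)] and [2 ^ k.+1 * #|M|] by
   [2 ^ k.+1], so under this condition the density hypothesis survives. *)
have [/existsP[B /existsP[C /and4P[BM CM BC le]]]|none] := boolP [exists B, exists C,
    [&& B \in M, C \in M, madj B C & 8 * (#|common e M B C|).+1 <= 2 ^ k.+1]].
  have cc := card_contract mM BM CM BC; have cd := mdeg_contract e_sym mM BM CM BC.
  have c0 : 0 < #|contract M B C|.
    by apply/card_gt0P; exists (B :|: C); rewrite !inE eqxx.
  have [||||N [mN cN aN fN sN]] := IHn (contract M B C).
  - by rewrite -ltnS cc.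
  - exact: contract_model.
  - exact: c0.
  - move: deg le cd; rewrite -cc mulnS -muln2; move: (2 ^ k.+1) (2 ^ k.+1 * _) => K x; lia.
  exists N; split=> //.
    move=> D /fN[D' /(contract_finer BM) [D'' ? s1] s2]; exists D'' => //.
    exact: fintype.subset_trans s1 s2.
  exact: fintype.subset_trans sN (cover_contract BM CM).
have deg0 : 0 < mdeg M.
  by move: deg; case: (mdeg M) => //; rewrite muln0 leqn0 muln_eq0 expn_eq0 /= => /eqP h; rewrite h in M0.
have /card_gt0P[[B C0]] := deg0; rewrite inE /= => /and3P[BM C0M BC0].
pose MB := [set D in M | madj B D].
have MBM : MB \subset M by apply/subsetP => D; rewrite inE => /andP[].
have [|||N [mN cN aN fN sN]] := IHk MB.
- exact: model_sub mM.
- by apply/card_gt0P; exists C0; rewrite inE C0M.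
- rewrite mdegE big_distrr /= mulnC -sum_nat_const; apply: leq_sum => C; rewrite inE => /andP[CM BC].
  move: none; rewrite negb_exists => /forallP/(_ B); rewrite negb_exists => /forallP/(_ C).
  rewrite BM CM BC /= -ltnNge.
  have <- : common e M B C = [set D in MB | madj C D].
    by apply/setP => D; rewrite !inE -andbA; congr (_ && _); rewrite !(madjC e_sym D).
  (* For [c] common neighbours, [2 ^ k < 4 * (c + 1)] improves to [2 ^ k <= 4 * c], since 4 divides
     [2 ^ k]. *)
  case: k k2 {IHk deg IHn} => [|[|k]] // _; rewrite !expnS; move: (2 ^ k) => K; lia.
have BnMB : B \notin MB by rewrite inE /madj eqxx andbF.
have Bdis D : D \in N -> [disjoint B & D].
  move=> DN; rewrite disjoint_sym; apply/pred0P => x /=; apply/negP => /andP[xD xB].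
  have /finset.bigcupP[D' D'MB xD'] : x \in finset.cover MB.
    by apply: (subsetP sN); apply/finset.bigcupP; exists D.
  have BD' : B != D' by apply: contraNneq BnMB => ->.
  have := model_disjoint mM BM (subsetP MBM _ D'MB) BD'.
  by rewrite disjoint_subset => /subsetP/(_ x xB); rewrite inE xD'.
have Badj D : D \in N -> madj B D.
  move=> DN; have [D' D'MB sub] := fN D DN; rewrite /madj; apply/andP; split.
    apply/eqP => BD; have := Bdis D DN; rewrite -BD -finset.setI_eq0 finset.setIid => /eqP B0.
    by have [_ /negP n0 _] := mM; apply: n0; rewrite -B0.
  by move: D'MB; rewrite inE => /and3P[_ _]; apply: touchW.
have BN : B \notin N by apply/negP => /Badj; rewrite /madj eqxx.
have [/finset.trivIsetP tr n0 con] := mN; have [_ n0M conM] := mM.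
exists (B |: N); split.
- split.
  + apply/finset.trivIsetP => D E; rewrite !inE => /orP[/eqP->|DN] /orP[/eqP->|EN]; rewrite ?eqxx //.
    * by move=> _; exact: Bdis.
    * by move=> _; rewrite disjoint_sym; exact: Bdis.
    * exact: tr.
  + by rewrite !inE negb_or n0 andbT; apply: contraNneq n0M => ->.
  + by move=> D; rewrite !inE => /orP[/eqP->|DN]; [exact: conM|exact: con].
- by rewrite cardsU1 BN cN.
- move=> D E; rewrite !inE => /orP[/eqP->|DN] /orP[/eqP->|EN]; rewrite ?eqxx //.
  + by move=> _; exact: Badj.
  + by move=> _; rewrite madjC //; exact: Badj.
  + exact: aN.
- move=> D; rewrite !inE => /orP[/eqP->|DN]; first by exists B.
  by have [D' /(subsetP MBM) ? ?] := fN D DN; exists D'.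
- apply/finset.bigcupsP => D; rewrite !inE => /orP[/eqP->|DN]; first exact: finset.bigcup_sup.
  have sub1 : D \subset finset.cover MB by apply: fintype.subset_trans sN; exact: finset.bigcup_sup.
  apply: fintype.subset_trans sub1 _; apply/finset.bigcupsP => D' /(subsetP MBM) ?.
  exact: finset.bigcup_sup.
Qed.

Lemma clique_minorK k M N : clique_minor k M N -> minorK k e.
Proof.
move=> [mN cN aN _ _]; have [tr n0 con] := mN.
exists (fun i : 'I_k => enum_val (cast_ord (esym cN) i)); split.
- by move=> i; apply: contraNneq n0 => <-; exact: enum_valP.
- by move=> i; apply: con; exact: enum_valP.
- move=> i j ij; apply: (model_disjoint mN); try exact: enum_valP.
  by apply: contraNneq ij => /enum_val_inj /cast_ord_inj ->.
- move=> i j ij; apply/touchP.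
  have /(aN _ _ (enum_valP _) (enum_valP _)) : enum_val (cast_ord (esym cN) i) != enum_val (cast_ord (esym cN) j).
    by apply: contraNneq ij => /enum_val_inj /cast_ord_inj ->.
  by case/andP.
Qed.

(** The factor 8 is [2 ^ 5 / 4] from [mader]. *)
Lemma mdeg_noK5 M : ~ minorK 5 e -> model M -> mdeg M <= 8 * #|M|.
Proof.
move=> no mM; rewrite leqNgt; apply/negP => lt; apply: no.
have M0 : 0 < #|M|.
  rewrite lt0n; apply/eqP => M0; move: lt; rewrite M0 muln0 => /card_gt0P[[B C]].
  by rewrite inE /=; move/eqP: M0; rewrite cards_eq0 => /eqP->; rewrite !inE.
have [//||||N] := @mader 5 M; try done.
  have -> : 2 ^ 5 = 32 by []. lia.
exact: clique_minorK.
Qed.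

End Mader.

(** * Neighbourhoods of the vertices outside a vertex cover *)

Section Twins.
Variables (T : finType) (e : rel T).
Hypothesis e_sym : symmetric e.
Hypothesis noK5 : ~ minorK 5 e.
Local Open Scope nat_scope.
Local Notation set0 := finset.set0.
Local Notation subsetP := fintype.subsetP.
Implicit Types (B C D U S X A : {set T}) (M N Q : {set {set T}}).

Definition cliques M := [set Q : {set {set T}} | (Q \subset M) &&
  [forall B in Q, forall C in Q, (B != C) ==> madj e B C]].

Lemma cliquesP M Q : reflect (Q \subset M /\ {in Q &, forall B C, B != C -> madj e B C}) (Q \in cliques M).
Proof.
rewrite inE; apply: (iffP andP) => -[sub h]; split=> //.
  move=> B C BQ CQ; move/forall_inP: h => h.
  by have /forall_inP/(_ C CQ)/implyP := h B BQ.
by apply/forall_inP => B BQ; apply/forall_inP => C CQ; apply/implyP; exact: h.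
Qed.

(** Some block has at most 8 neighbours. The cliques through it are given by subsets of its
    neighbourhood, at most [2 ^ 8] of them; the others are counted after its removal. *)
Lemma card_cliques M : model e M -> #|cliques M| <= 256 * #|M| + 1.
Proof.
move: {2}(#|M|) (leqnn #|M|) => n; elim: n M => [|n IH] M Mn mM.
  have M0 : M = finset.set0 by apply/eqP; rewrite -cards_eq0 -leqn0.
  apply: leq_trans (_ : #|[set (finset.set0 : {set {set T}})]| <= _); last by rewrite cards1 addn1.
  by apply/subset_leq_card/subsetP => Q /cliquesP[]; rewrite M0 finset.subset0 inE.
have [M0|[B0 B0M]] := finset.set_0Vmem M.
  by apply: IH => //; rewrite M0 finset.cards0.
have [B BM dB] : exists2 B, B \in M & #|[set C in M | madj e B C]| <= 8.
  have := mdeg_noK5 e_sym noK5 mM; rewrite mdegE // => le.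
  have [/existsP[B /andP[BM dB]]|/existsPn H] := boolP [exists B, (B \in M) && (#|[set C in M | madj e B C]| <= 8)].
    by exists B.
  exfalso; have : 9 * #|M| <= 8 * #|M|.
    apply: leq_trans le; rewrite mulnC -sum_nat_const; apply: leq_sum => B BM.
    by have := H B; rewrite BM /= -ltnNge.
  by have := cardsD1 B0 M; rewrite B0M; lia.
pose NB := [set C in M | madj e B C].
have sub : cliques M \subset cliques (M :\ B) :|: [set B |: Q | Q in finset.powerset NB].
  apply/subsetP => Q /cliquesP[QM cQ]; rewrite finset.in_setU.
  have [BQ|BnQ] := boolP (B \in Q); last first.
    by apply/orP; left; apply/cliquesP; split=> //; rewrite finset.subsetD1 QM.
  apply/orP; right; apply/imsetP; exists (Q :\ B); last by rewrite finset.setD1K.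
  rewrite finset.powersetE; apply/subsetP => C; rewrite !inE => /andP[CB CQ].
  by rewrite (subsetP QM _ CQ) cQ // eq_sym.
apply: leq_trans (subset_leq_card sub) _.
apply: leq_trans (leq_card_setU _ _).1 _.
have cM : #|M| = #|M :\ B|.+1 by rewrite (cardsD1 B) BM.
have h1 : #|cliques (M :\ B)| <= 256 * #|M :\ B| + 1.
  by apply: IH; [rewrite -ltnS -cM|apply: model_sub mM; exact: finset.subsetDl].
have h2 : #|[set B |: Q | Q in finset.powerset NB]| <= 256.
  apply: leq_trans (leq_imset_card _ _) _; rewrite finset.card_powerset.
  by rewrite -[256]/(2 ^ 8) leq_exp2l.
by rewrite cM; lia.
Qed.

Section Cover.
Variables (A X : {set T}).
Hypothesis eA : forall x y, e x y -> x \in A.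
Hypothesis e_irr : irreflexive e.
Hypothesis cov : forall x y, e x y -> (x \in X) || (y \in X).

Let nbh v := [set y | e v y].

(* A partial contraction onto the vertex cover [X]: a vertex outside [X] is either kept
   or sent to a neighbour in [X]. *)
Definition hub_map (g : {ffun T -> T}) : bool :=
  [forall v, if v \in X then g v == v else (g v == v) || ((g v \in X) && e v (g v))].

Definition hub_block (g : {ffun T -> T}) x := [set v | g v == x].

Definition hub_blocks g := [set hub_block g x | x in X].

Lemma hub_fix g x : hub_map g -> x \in X -> g x = x.
Proof. by move=> /forallP/(_ x); case: (x \in X) => // /eqP. Qed.

Lemma hub_step g v : hub_map g -> g v <> v -> [/\ v \notin X, g v \in X & e v (g v)].
Proof.
move=> /forallP/(_ v) + /eqP/negbTE gv; rewrite gv; case: (v \in X) => //=.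
by case/andP.
Qed.

Lemma hub_block_inj g : hub_map g -> {in X &, injective (hub_block g)}.
Proof.
move=> hg x y xX yX /setP/(_ x); rewrite !inE (hub_fix hg xX) eqxx.
by move/esym/eqP.
Qed.

Lemma hub_model g : hub_map g -> model e (hub_blocks g).
Proof.
move=> hg; split.
- apply/finset.trivIsetP => _ _ /imsetP[x xX ->] /imsetP[y yX ->] nxy.
  apply/pred0P => v /=; rewrite !inE; apply/negP => /andP[/eqP vx /eqP vy].
  by move: nxy; rewrite -vx -vy eqxx.
- apply/imsetP => -[x xX /setP/(_ x)]; by rewrite !inE (hub_fix hg xX) eqxx.
- move=> _ /imsetP[x xX ->].
  have xB : x \in hub_block g x by rewrite inE (hub_fix hg xX).
  have tox v : v \in hub_block g x -> connect (within_rel (hub_block g x) e) v x.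
    move=> vB; have [gv|/eqP gv] := eqVneq (g v) v.
      by move: (vB); rewrite inE gv => /eqP ->.
    apply: connect1; rewrite /within_rel vB xB /=.
    by have [_ _] := hub_step hg gv; move: vB; rewrite inE => /eqP ->.
  move=> u v uB vB; apply: connect_trans (tox u uB) _.
  by rewrite (sym_connect_sym (@within_rel_sym _ _ _ e_sym)) tox.
Qed.

Lemma card_hub_blocks g : hub_map g -> #|hub_blocks g| = #|X|.
Proof. by move=> hg; rewrite card_in_imset //; exact: hub_block_inj. Qed.

Definition hub_deg g := #|[set p | [&& p.1 \in X, p.2 \in X & madj e (hub_block g p.1) (hub_block g p.2)]]|.

Lemma hub_degE g : hub_map g -> hub_deg g <= 8 * #|X|.
Proof.
move=> hg; rewrite -(card_hub_blocks hg).
apply: leq_trans (mdeg_noK5 e_sym noK5 (hub_model hg)).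
rewrite /hub_deg -(@card_in_imset _ _ (fun p => (hub_block g p.1, hub_block g p.2))).
  apply/subset_leq_card/subsetP => _ /imsetP[p + ->]; rewrite inE => /and3P[p1 p2 p12].
  by rewrite inE /= p12 !imset_f.
move=> [x y] [x' y']; rewrite !inE /= => /and3P[? ? _] /and3P[? ? _] [h1 h2].
by rewrite (hub_block_inj hg _ _ h1) // (hub_block_inj hg _ _ h2).
Qed.

(** Among the maps in which each moved vertex is paid for by an adjacency of blocks, [g] maximises
    the adjacencies. If an unmoved [v] had neighbours [x], [y] in non-adjacent blocks, sending [v]
    to [x] would create a new adjacency, which pays for [v]. *)
Lemma saturated_hub_map : exists2 g, hub_map g & #|[set v | g v != v]| <= hub_deg g /\
  forall v, v \notin X -> g v = v -> {in nbh v &, forall x y, x != y ->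
    madj e (hub_block g x) (hub_block g y)}.
Proof.
pose good g := hub_map g && (#|[set v | g v != v]| <= hub_deg g).
have good0 : good [ffun v => v].
  apply/andP; split; first by apply/forallP => v; rewrite ffunE eqxx /=; case: ifP.
  rewrite (_ : [set v | _] = set0) ?finset.cards0 //.
  by apply/setP => v; rewrite !inE ffunE eqxx.
have [g /andP[hg cg] gmax] := arg_maxnP hub_deg good0.
exists g => //; split=> // v vX gv x y; rewrite !inE => vx vy xy.
apply/negPn/negP => nadj.
have xX : x \in X by have := cov vx; rewrite (negbTE vX).
have yX : y \in X by have := cov vy; rewrite (negbTE vX).
pose g' := [ffun w => if w == v then x else g w].
have hg' : hub_map g'.
  apply/forallP => w; rewrite ffunE; case: (eqVneq w v) => [->|wv]; last by have /forallP/(_ w) := hg.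
  by rewrite (negbTE vX) xX vx orbT.
have sub z : hub_block g z \subset hub_block g' z \/ z \notin X.
  have [zX|] := boolP (z \in X); last by right.
  left; apply/subsetP => w; rewrite !inE ffunE; case: (eqVneq w v) => [->|//].
  by rewrite gv => /eqP vz; rewrite vz zX in vX.
have lt : hub_deg g < hub_deg g'.
  apply: proper_card; apply/fintype.properP; split.
    apply/subsetP => -[a b]; rewrite !inE /= => /and3P[aX bX /andP[ab tab]].
    rewrite aX bX /madj /=; apply/andP; split.
      by apply: contraNneq ab => /(hub_block_inj hg' aX bX) ->.
    have [sa|] := sub a; last by rewrite aX.
    have [sb|] := sub b; last by rewrite bX.
    exact: touchW tab.
  exists (x, y); last by rewrite inE /= (negbTE nadj) !andbF.
  rewrite inE /= xX yX /madj /=; apply/andP; split.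
    by apply: contraNneq xy => /(hub_block_inj hg' xX yX) ->.
  apply/touchP; exists v, y; split=> //; first by rewrite inE ffunE eqxx.
  rewrite inE ffunE; case: (eqVneq y v) => [yv|_]; first by rewrite -yv yX in vX.
  by rewrite (hub_fix hg yX).
have /gmax : good g'.
  rewrite /good hg' /=; apply: leq_trans lt.
  apply: leq_trans (_ : #|v |: [set w | g w != w]| <= _).
    apply/subset_leq_card/subsetP => w; rewrite !inE ffunE; by case: (eqVneq w v).
  by rewrite cardsU1 inE gv eqxx /= add1n ltnS.
by move=> h; have := leq_trans lt h; rewrite ltnn.
Qed.

(** Moved vertices number at most [8 * #|X|]. The neighbourhood of an unmoved one is a clique among
    the [#|X|] hub blocks, so [card_cliques] adds [256 * #|X| + 1]. *)
Lemma card_neighborhoods : #|[set nbh v | v in A :\: X]| <= 264 * #|X| + 1.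
Proof.
have [g hg [cJ sat]] := saturated_hub_map.
pose J := [set v | g v != v].
have sub : [set nbh v | v in A :\: X] \subset [set nbh v | v in J] :|:
    [set [set y in X | hub_block g y \in (Q : {set {set T}})] | Q in cliques (hub_blocks g)].
  apply/subsetP => _ /imsetP[v + ->]; rewrite !finset.in_setD => /andP[vX vA].
  rewrite finset.in_setU; have [gv|gv] := eqVneq (g v) v; last first.
    by rewrite imset_f // inE.
  apply/orP; right; apply/imsetP; exists [set hub_block g y | y in nbh v].
    apply/cliquesP; split.
      apply/subsetP => _ /imsetP[y + ->]; rewrite inE => vy; apply: imset_f.
      by have := cov vy; rewrite (negbTE vX).
    move=> _ _ /imsetP[x xv ->] /imsetP[y yv ->] nxy; apply: (sat v) => //.
    by apply: contraNneq nxy => ->.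
  apply/setP => y; rewrite !inE; apply/idP/andP => [vy|[yX]].
    have yX : y \in X by have := cov vy; rewrite (negbTE vX).
    by split=> //; apply: imset_f; rewrite inE.
  move=> /imsetP[z]; rewrite inE => vz /(hub_block_inj hg yX) -> //.
  by have := cov vz; rewrite (negbTE vX).
apply: leq_trans (subset_leq_card sub) _; apply: leq_trans (leq_card_setU _ _).1 _.
have h1 : #|[set nbh v | v in J]| <= 8 * #|X|.
  apply: leq_trans (leq_imset_card _ _) _; exact: leq_trans cJ (hub_degE hg).
have h2 := leq_trans (leq_imset_card (fun Q => [set y in X | hub_block g y \in (Q : {set {set T}})])
  (cliques (hub_blocks g))) (card_cliques (hub_model hg)).
rewrite card_hub_blocks // in h2; apply: leq_trans (leq_add h1 h2) _; lia.
Qed.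

(** One representative of each neighbourhood is kept, and [S] consists of all other vertices outside
    [X]. *)
Lemma twins : exists S (r : T -> T), [/\ S \subset A :\: X,
  forall v, v \in S -> r v \in (A :\: X) :\: S,
  forall v, v \in S -> nbh (r v) = nbh v & #|A :\: X| <= #|S| + 264 * #|X| + 1].
Proof.
pose I := A :\: X.
pose rep v := odflt v [pick w in I | nbh w == nbh v].
have repP v : v \in I -> rep v \in I /\ nbh (rep v) = nbh v.
  move=> vI; rewrite /rep; case: pickP => [w /andP[? /eqP ?] //|/(_ v)].
  by rewrite /= vI eqxx.
have rep_eq v w : v \in I -> w \in I -> nbh v = nbh w -> rep v = rep w.
  move=> vI wI vw; rewrite /rep (eq_pick (Q := fun u => (u \in I) && (nbh u == nbh w))); last first.
    by move=> u /=; rewrite vw.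
  by case: pickP => // /(_ v); rewrite /= vI vw eqxx.
exists [set v in I | rep v != v], rep; split.
- by apply/subsetP => v; rewrite inE => /andP[].
- move=> v; rewrite inE => /andP[vI _]; have [rI nr] := repP v vI.
  by rewrite finset.in_setD rI andbT inE rI negbK /=; apply/eqP; exact: rep_eq.
- by move=> v; rewrite inE => /andP[/repP[_ ->]].
rewrite -/I -addnA -(cardsID [set v | rep v != v] I); apply: leq_add.
  by apply/subset_leq_card/subsetP => v; rewrite !inE.
apply: leq_trans card_neighborhoods.
rewrite -(@card_in_imset _ _ nbh (mem (I :\: [set v | rep v != v]))).
  by apply/subset_leq_card/imsetS; exact: finset.subsetDl.
move=> v w /finset.setDP[vI]; rewrite inE negbK => /eqP rv /finset.setDP[wI].
by rewrite inE negbK => /eqP rw vw; rewrite -rv -rw; apply: rep_eq.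
Qed.

End Cover.
End Twins.

(** * Counting graphs without a K5 minor *)

Section FiberCount.
Local Open Scope nat_scope.
Lemma leq_card_fibers (aT rT : finType) (f : aT -> rT) (X : {set aT}) (Y : {set rT}) c :
  (forall x, x \in X -> f x \in Y) ->
  (forall y, y \in Y -> #|[set x in X | f x == y]| <= c) -> #|X| <= #|Y| * c.
Proof.
move=> fXY fib; rewrite -sum1_card (partition_big f (mem Y)) //=.
rewrite -sum_nat_const; apply: leq_sum => y yY; apply: leq_trans (fib y yY).
by rewrite -sum1_card; apply: eq_leq; apply: eq_bigl => x; rewrite inE.
Qed.

Lemma leq_card_bigcup (I T : finType) (P : pred I) (F : I -> {set T}) :
  #|\bigcup_(i | P i) F i| <= \sum_(i | P i) #|F i|.
Proof.
elim/big_rec2: _ => [|i n B _ h]; first by rewrite finset.cards0.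
by apply: leq_trans (leq_card_setU _ _).1 _; rewrite leq_add2l.
Qed.
End FiberCount.

Section SmallClass.
Variable T : finType.
Local Open Scope nat_scope.
Local Notation set0 := finset.set0.
Local Notation subsetP := fintype.subsetP.
Implicit Types (A S : {set T}) (E H : {set {set T}}) (r : {ffun T -> T}).

Definition graphs_on A : {set {set {set T}}} :=
  [set E : {set {set T}} | [forall e in E, (e \subset A) && (#|e| == 2)]].

Lemma graphs_onP A E : reflect (forall e, e \in E -> e \subset A /\ #|e| = 2) (E \in graphs_on A).
Proof.
rewrite inE; apply: (iffP forall_inP) => h e eE; first by have /andP[? /eqP] := h e eE.
by have [-> ->] := h e eE.
Qed.

Definition K5free A : {set {set {set T}}} :=
  [set E in graphs_on A | `[< ~ minorK 5 (edge_rel E) >]].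

Lemma K5freeP A E : reflect (E \in graphs_on A /\ ~ minorK 5 (edge_rel E)) (E \in K5free A).
Proof. by apply: (iffP finset.setIdP) => -[? /asboolP]. Qed.

Lemma minorK_mono k (e e' : rel T) : (forall x y, e x y -> e' x y) -> minorK k e -> minorK k e'.
Proof.
move=> ee' [f [f0 fc fd fa]]; exists f; split=> //.
  move=> i x y xi yi; apply: connect_sub (fc i x y xi yi) => u v /and3P[ui vi uv].
  by apply: connect1; rewrite /within_rel ui vi ee'.
by move=> i j ij; have [x [y [? ? /ee' ?]]] := fa i j ij; exists x, y.
Qed.

Lemma edge_relW E E' x y : E \subset E' -> edge_rel E x y -> edge_rel E' x y.
Proof. by move=> /subsetP sub /andP[xy /sub ?]; rewrite /edge_rel xy. Qed.

Lemma edgeE A E x y : E \in graphs_on A -> ([set x; y] \in E) = edge_rel E x y.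
Proof.
move=> /graphs_onP gE; rewrite /edge_rel; case: eqVneq => [->|//] /=.
by apply/negP => /gE[_]; rewrite cards2 eqxx.
Qed.

Lemma card_K5free_edges A E : E \in K5free A -> #|E| <= 8 * #|A|.
Proof.
move=> /K5freeP[/graphs_onP gE nE].
pose M := [set [set x] | x in A].
have cM : #|M| = #|A| by apply: card_imset; exact: finset.set1_inj.
have mM : model (edge_rel E) M.
  split.
  - apply/finset.trivIsetP => _ _ /imsetP[x _ ->] /imsetP[y _ ->] xy.
    by rewrite disjoints1 inE; apply: contraNneq xy => ->.
  - by apply/imsetP => -[x _ /setP/(_ x)]; rewrite !inE eqxx.
  - by move=> _ /imsetP[x _ ->] u v; rewrite !inE => /eqP-> /eqP->.
have := mdeg_noK5 (@edge_rel_sym _ E) nE mM; rewrite cM; apply: leq_trans.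
rewrite /mdeg -(card_in_imset (f := fun p => p)) ?imset_id //.
apply: leq_trans (leq_imset_card (fun p => p.1 :|: p.2) _).
apply/subset_leq_card/subsetP => e eE; have [eA /eqP/cards2P[x [y [xy exy]]]] := gE e eE.
apply/imsetP; exists ([set x], [set y]); last by [].
rewrite inE /= !imset_f ?(subsetP eA) ?exy ?inE ?eqxx ?orbT //=.
rewrite /madj; apply/andP; split; first by apply: contraNneq xy => /finset.set1_inj ->.
by apply/touchP; exists x, y; rewrite !inE /edge_rel xy -exy eE.
Qed.

Definition quotient_graph r E : {set {set T}} := [set e in [set r @: e | e : {set T} in E] | #|e| == 2].

Section Reduction.
Variables (A S : {set T}) (r : {ffun T -> T}).
Hypothesis SA : S \subset A.
Hypothesis r_out : forall v, v \notin S -> r v = v.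
Hypothesis r_in : forall v, v \in S -> r v \in A :\: S.

Let r_nS v : r v \notin S.
Proof.
have [vS|vS] := boolP (v \in S); last by rewrite r_out.
by have := r_in vS; rewrite !inE => /andP[].
Qed.
Let rr v : r (r v) = r v. Proof. exact/r_out/r_nS. Qed.
Let r_A v : v \in A -> r v \in A :\: S.
Proof.
have [vS|vS] := boolP (v \in S); first by rewrite r_in.
by rewrite r_out // inE vS.
Qed.

Let quotientP E a b : E \in graphs_on A -> edge_rel (quotient_graph r E) a b ->
  [/\ r a = a, r b = b & exists x y, [/\ edge_rel E x y, r x = a & r y = b]].
Proof.
move=> gE /andP[ab]; rewrite inE => /andP[/imsetP[e eE re] _].
have [_ /eqP/cards2P[x [y [xy exy]]]] := graphs_onP _ _ gE e eE; subst e.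
rewrite imsetU1 imset_set1 in re.
have fix' z : z \in [set a; b] -> r z = z by rewrite re !inE => /orP[]/eqP->.
have ra : r a = a by apply: fix'; rewrite !inE eqxx.
have rb : r b = b by apply: fix'; rewrite !inE eqxx orbT.
have aE : a \in [set r x; r y] by rewrite -re !inE eqxx.
have bE : b \in [set r x; r y] by rewrite -re !inE eqxx orbT.
have exy : edge_rel E x y by rewrite /edge_rel xy.
split=> //; move: aE bE ab; rewrite !inE => /orP[]/eqP-> /orP[]/eqP->; rewrite ?eqxx // => _.
  by exists x, y.
by exists y, x; rewrite edge_rel_sym.
Qed.

(** Here the quotient is a contraction of edges of [E], so preimages under [r] of branch sets are
    again connected branch sets. *)
Lemma quotient_K5free E : E \in K5free A -> (forall v, v \in S -> [set v; r v] \in E) ->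
  quotient_graph r E \in K5free (A :\: S).
Proof.
move=> /K5freeP[gE nE] hS; apply/K5freeP; split.
  apply/graphs_onP => e; rewrite inE => /andP[/imsetP[e' e'E ->] /eqP ->]; split=> //.
  have [e'A _] := graphs_onP _ _ gE e' e'E.
  by apply/subsetP => _ /imsetP[x xe ->]; apply: r_A; exact: (subsetP e'A).
move=> [f [f0 fc fd fa]]; apply: nE.
pose f' i := [set x | r x \in f i].
have tor i x : x \in f' i -> connect (within_rel (f' i) (edge_rel E)) x (r x) /\
    connect (within_rel (f' i) (edge_rel E)) (r x) x.
  move=> xi; have [xS|xS] := boolP (x \in S); last by rewrite r_out.
  have xr : within_rel (f' i) (edge_rel E) x (r x).
    by rewrite /within_rel xi inE rr; move: xi; rewrite inE => -> /=; rewrite -(edgeE _ _ gE) hS.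
  split; apply: connect1 => //; rewrite within_rel_sym //; exact: edge_rel_sym.
exists f'; split.
- move=> i; have [j ij] : exists j : 'I_5, i != j.
    by exists (if i == ord0 then ord_max else ord0); case: (eqVneq i ord0) => [->|].
  have [x [y [xi _ /(quotientP gE)[rx _ _]]]] := fa i j ij.
  by apply/finset.set0Pn; exists x; rewrite inE rx.
- move=> i x y xi yi.
  have [cx _] := tor i x xi; have [_ cy] := tor i y yi.
  apply: connect_trans cx _; apply: connect_trans _ cy.
  move: xi yi; rewrite !inE => xi yi.
  apply: connect_sub (fc i _ _ xi yi) => a b /and3P[ai bi /(quotientP gE)[ra rb [u [v [uv ru rv]]]]].
  have ui : u \in f' i by rewrite inE ru.
  have vi : v \in f' i by rewrite inE rv.
  have [_ cu] := tor i u ui; have [cv _] := tor i v vi; rewrite ru in cu; rewrite rv in cv.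
  apply: connect_trans cu _; apply: connect_trans _ cv; apply: connect1.
  by rewrite /within_rel ui vi.
- move=> i j ij; apply/pred0P => x /=; rewrite !inE; apply/negP => /andP[xi xj].
  by have := fd i j ij; rewrite disjoint_subset => /subsetP/(_ _ xi); rewrite inE xj.
- move=> i j ij; have [a [b [ai bj /(quotientP gE)[_ _ [u [v [uv ru rv]]]]]]] := fa i j ij.
  by exists u, v; rewrite !inE ru rv.
Qed.

(** Given its quotient [H], the graph [E] is a subset of a list [L]: the contracted edges, at most
    [#|A|], and for each of the at most [8 * #|A|] edges of [H] the subsets of its preimage. Fibres
    of [r] have at most two elements, so such a preimage has at most 4 vertices and 16 subsets;
    [1 + 8 * 16 = 129]. *)
Lemma card_contract_codes : {in S &, injective r} ->
  #|[set E in K5free A | [forall v in S, [set v; r v] \in E]]|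
    <= #|K5free (A :\: S)| * 2 ^ (129 * #|A|).
Proof.
move=> rinj; apply: (leq_card_fibers (f := quotient_graph r)).
  by move=> E; rewrite inE => /andP[EK /forall_inP hS]; exact: quotient_K5free.
move=> H HK.
pose L := [set [set v; r v] | v in S] :|: \bigcup_(h in H) finset.powerset [set x in A | r x \in h].
have sub : [set E in [set E in K5free A | [forall v in S, [set v; r v] \in E]] | quotient_graph r E == H]
    \subset finset.powerset L.
  apply/subsetP => E; rewrite inE => /andP[+ /eqP EH]; rewrite inE => /andP[/K5freeP[gE _] /forall_inP hS].
  rewrite finset.powersetE; apply/subsetP => e eE.
  have [eA /eqP/cards2P[x [y [xy exy]]]] := graphs_onP _ _ gE e eE.
  have re : r @: e = [set r x; r y] by rewrite exy imsetU1 imset_set1.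
  have [rxy|rxy] := eqVneq (r x) (r y); last first.
    rewrite finset.in_setU; apply/orP; right; apply/finset.bigcupP; exists (r @: e).
      by rewrite -EH inE imset_f //= re cards2 rxy.
    rewrite finset.powersetE; apply/subsetP => z ze; rewrite inE (subsetP eA) //=.
    exact: imset_f.
  rewrite finset.in_setU; apply/orP; left; apply/imsetP.
  have [xS|xS] := boolP (x \in S); have [yS|yS] := boolP (y \in S).
  - by move: xy; rewrite (rinj x y xS yS rxy) eqxx.
  - by exists x => //; rewrite rxy (r_out yS) exy.
  - by exists y => //; rewrite -rxy (r_out xS) exy finset.setUC.
  - by move: xy; rewrite -(r_out xS) rxy (r_out yS) eqxx.
apply: leq_trans (subset_leq_card sub) _; rewrite finset.card_powerset leq_exp2l //.
have cS : #|S| <= #|A| := subset_leq_card SA.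
have cAS : #|A :\: S| <= #|A| := subset_leq_card (finset.subsetDl _ _).
have cH : #|H| <= 8 * #|A| by apply: leq_trans (card_K5free_edges HK) _; rewrite leq_mul2l.
apply: leq_trans (leq_card_setU _ _).1 _.
apply: leq_trans (_ : #|A| + #|H| * 16 <= _); last by lia.
apply: leq_add; first exact: leq_trans (leq_imset_card _ _) cS.
apply: leq_trans (leq_card_bigcup _ _) _; rewrite -sum_nat_const; apply: leq_sum => h hH.
rewrite finset.card_powerset -[16]/(2 ^ 4) leq_exp2l //.
have [gH _] := K5freeP _ _ HK; have [_ ch] := graphs_onP _ _ gH h hH.
rewrite -[4]/(2 * 2) -ch; apply: (leq_card_fibers (f := r)); first by move=> x; rewrite inE => /andP[].
move=> a ah.
apply: leq_trans (_ : #|[set a] :|: [set x in S | r x == a]| <= _).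
  apply/subset_leq_card/subsetP => x; rewrite !inE => /andP[_ /eqP rx].
  by have [xS|xS] := boolP (x \in S); rewrite ?rx ?eqxx ?orbT // -rx r_out // eqxx.
apply: leq_trans (leq_card_setU _ _).1 _; rewrite cards1 ?ch add1n ltnS.
apply/card_le1_eqP => x y; rewrite !inE => /andP[xS /eqP rx] /andP[yS /eqP ry].
by apply: rinj => //; rewrite rx.
Qed.

(** Replacing each vertex by its twin [r v] does not affect membership in [E], so [E] is determined
    by its edges inside [A :\: S]. *)
Lemma card_twin_codes :
  #|[set E in K5free A | [forall v in S, forall y, ([set r v; y] \in E) == ([set v; y] \in E)]]|
    <= #|K5free (A :\: S)|.
Proof.
pose f E : {set {set T}} := [set e in E | e \subset A :\: S].
pose X := [set E in K5free A | [forall v in S, forall y, ([set r v; y] \in E) == ([set v; y] \in E)]].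
have key E : E \in X -> forall e, (e \in E) = [&& e \subset A, #|e| == 2 & r @: e \in f E].
  rewrite inE => /andP[/K5freeP[gE _] /forall_inP tw] e.
  have swap v y : ([set r v; y] \in E) = ([set v; y] \in E).
    have [vS|vS] := boolP (v \in S); last by rewrite r_out.
    by have /forallP/(_ y)/eqP := tw v vS.
  have [/andP[eA e2]|ne] := boolP ((e \subset A) && (#|e| == 2)); last first.
    apply/idP/idP => [eE|/and3P[eA e2 _]]; last by rewrite eA e2 in ne.
    by move: ne; have [-> ->] := graphs_onP _ _ gE e eE.
  have sub : r @: e \subset A :\: S.
    by apply/subsetP => _ /imsetP[x xe ->]; apply: r_A; exact: (subsetP eA).
  rewrite eA e2 inE sub andbT /=; have /cards2P[x [y [xy ->]]] := e2.
  rewrite imsetU1 imset_set1. by rewrite -(swap x y) finset.setUC -(swap y (r x)) finset.setUC.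
rewrite -/X -(@card_in_imset _ _ f (mem X)).
  apply/subset_leq_card/subsetP => _ /imsetP[E + ->]; rewrite inE => /andP[/K5freeP[gE nE] _].
  apply/K5freeP; split.
    apply/graphs_onP => e; rewrite inE => /andP[eE sub]; split=> //.
    by have [] := graphs_onP _ _ gE e eE.
  apply: contra_not nE; apply: minorK_mono => x y; apply: edge_relW.
  by apply/subsetP => e; rewrite inE => /andP[].
by move=> E E' EX E'X ff; apply/setP => e; rewrite (key _ EX) (key _ E'X) ff.
Qed.

End Reduction.

(** [S] holds one end of each edge of a maximum matching and [r] gives the other end; an edge
    avoiding all ends would extend the matching. *)
Lemma maximal_matching A E : E \in graphs_on A -> exists S r,
  [/\ S \subset A, forall v, v \notin S -> r v = v, forall v, v \in S -> r v \in A :\: S,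
      {in S &, injective r} & (forall v, v \in S -> [set v; r v] \in E) /\
      forall x y, edge_rel E x y -> (x \in S :|: r @: S) || (y \in S :|: r @: S)].
Proof.
move=> gE.
pose good (p : {set T} * {ffun T -> T}) := [&& p.1 \subset A, [forall v, (v \notin p.1) ==> (p.2 v == v)],
  [forall v in p.1, p.2 v \in A :\: p.1], [forall v in p.1, forall w in p.1, (p.2 v == p.2 w) ==> (v == w)]
  & [forall v in p.1, [set v; p.2 v] \in E]].
have good0 : good (set0, [ffun v => v]).
  apply/and5P; split=> /=; first exact: finset.sub0set.
  - by apply/forallP => v; rewrite ffunE eqxx implybT.
  - by apply/forall_inP => v; rewrite inE.
  - by apply/forall_inP => v; rewrite inE.
  - by apply/forall_inP => v; rewrite inE.
have [[S r] /and5P[/= SA /forallP h1 /forall_inP h2 /forall_inP h3 /forall_inP h4] smax] :=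
  arg_maxnP (fun p : {set T} * {ffun T -> T} => #|p.1|) good0.
exists S, r; split=> //.
- by move=> v vS; have /implyP/(_ vS)/eqP := h1 v.
- by move=> v w vS wS /eqP vw; have /forall_inP/(_ w wS)/implyP/(_ vw)/eqP := h3 v vS.
split=> // x y xyE; apply/negPn/negP; rewrite negb_or => /andP[xX yX].
have xyE' : [set x; y] \in E by case/andP: xyE.
have xy : x != y by case/andP: xyE.
have [sub _] := graphs_onP _ _ gE _ xyE'.
have xA : x \in A by apply: (subsetP sub); rewrite !inE eqxx.
have yA : y \in A by apply: (subsetP sub); rewrite !inE eqxx orbT.
move: xX yX; rewrite !finset.in_setU !negb_or => /andP[xS xr] /andP[yS yr].
pose r' := [ffun v => if v == x then y else r v].
have rx : r' x = y by rewrite ffunE eqxx.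
have rv v : v \in S -> r' v = r v.
  by move=> vS; rewrite ffunE; case: (eqVneq v x) => // vx; rewrite -vx vS in xS.
have : good (x |: S, r').
  apply/and5P; split=> /=.
  - by rewrite finset.subUset finset.sub1set xA.
  - apply/forallP => v; apply/implyP; rewrite !inE negb_or ffunE => /andP[/negbTE -> vS].
    by have /implyP/(_ vS) := h1 v.
  - apply/forall_inP => v; rewrite !inE => /orP[/eqP->|vS].
      by rewrite rx negb_or eq_sym xy yS.
    rewrite rv // negb_or; have := h2 v vS; rewrite inE => /andP[-> ->]; rewrite !andbT.
    by apply: contraNneq xr => <-; rewrite imset_f.
  - apply/forall_inP => v vS; apply/forall_inP => w wS; apply/implyP.
    move: vS wS; rewrite !inE => /orP[/eqP->|vS] /orP[/eqP->|wS]; rewrite ?rx ?rv //.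
    + by move=> /eqP h; move: yr; rewrite h imset_f.
    + by move=> /eqP h; move: yr; rewrite -h imset_f.
    + by have /forall_inP/(_ w wS)/implyP := h3 v vS.
  - by apply/forall_inP => v; rewrite !inE => /orP[/eqP->|vS]; rewrite ?rx ?rv ?h4.
move/smax => /=; rewrite cardsU1 xS add1n => h.
by have := leq_trans h (leqnn _); rewrite ltnn.
Qed.

(** If the matching is not linear in [#|A|], its ends form a cover [X] with [550 * #|X| < #|A|], and
    all but [264 * #|X| + 1] of the vertices outside [X] can be deleted as twins. The constant 1100
    makes [265 * #|X|] less than half of [#|A|]. *)
Lemma reduction_exists A E : E \in K5free A -> 3 <= #|A| -> exists S r,
  [/\ S \subset A, #|A| <= 1100 * #|S|, forall v, v \notin S -> r v = v,
      forall v, v \in S -> r v \in A :\: S &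
      ({in S &, injective r} /\ forall v, v \in S -> [set v; r v] \in E) \/
      (forall v, v \in S -> forall y, ([set r v; y] \in E) = ([set v; y] \in E))].
Proof.
move=> /K5freeP[gE nE] A3.
have [S [r [SA r1 r2 r3 [r4 r5]]]] := maximal_matching gE.
have [le|gt] := leqP #|A| (1100 * #|S|).
  by exists S, r; split=> //; left.
pose X := S :|: r @: S.
have cX : #|X| <= 2 * #|S|.
  apply: leq_trans (leq_card_setU _ _).1 _; rewrite mul2n -addnn leq_add2l.
  exact: leq_imset_card.
have cX' : #|A :\: X| >= #|A| - #|X|.
  by rewrite finset.cardsD leq_sub2l // subset_leq_card // finset.subsetIr.
have [S' [r' [S'A r'1 r'2 cS']]] := twins (@edge_rel_sym _ E) nE A r5.
pose r'' := [ffun v => if v \in S' then r' v else v].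
exists S', r''; split.
- exact: fintype.subset_trans S'A (finset.subsetDl _ _).
- by move: cS' cX' cX gt A3; rewrite -/X; lia.
- by move=> v vS; rewrite ffunE (negbTE vS).
- move=> v vS; rewrite ffunE vS; have := r'1 v vS; rewrite !inE; by case/andP=> -> /andP[_ ->].
- right=> v vS y; rewrite ffunE vS !(edgeE _ _ gE).
  by have /setP/(_ y) := r'2 v vS; rewrite !inE.
Qed.

Lemma card_retractions S : #|[set r : {ffun T -> T} | [forall v, (v \notin S) ==> (r v == v)]]| = #|T| ^ #|S|.
Proof.
pose F v : pred T := if v \in S then predT else pred1 v.
have -> : #|[set r : {ffun T -> T} | [forall v, (v \notin S) ==> (r v == v)]]| = #|family F|.
  apply: eq_card => r; rewrite inE; apply/forallP/familyP => h v; have := h v; rewrite /F.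
    by case: (v \in S) => //= /eqP ->; rewrite inE.
  by case: (v \in S).
rewrite card_family foldrE big_image /= (eq_bigr (fun v => if v \in S then #|T| else 1)).
  by rewrite -big_mkcond /= prod_nat_const.
by move=> v _; rewrite /F; case: ifP => _; rewrite ?card1.
Qed.

(** One reduction costs [2 ^ #|A|] for the choice of [S], [#|T| ^ #|S|] for [r] and
    [2 ^ (130 * #|A|)] for the code, of either kind. As [1100 * #|S| >= #|A|], the factor
    [2 ^ (k * #|S|)] gained by removing [S] pays for [2 ^ (131 * #|A|)]. *)
Lemma card_K5free k A : 131 * 1100 <= k -> #|K5free A| <= (2 ^ k * #|T|) ^ #|A|.
Proof.
move=> hk; move: {2}(#|A|) (leqnn #|A|) => n; elim: n A => [|n IH] A An.
  have A0 : A = set0 by apply/eqP; rewrite -cards_eq0 -leqn0.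
  rewrite A0 finset.cards0 expn0.
  apply: leq_trans (_ : #|[set (finset.set0 : {set {set T}})]| <= _); last by rewrite cards1.
  apply/subset_leq_card/subsetP => E /K5freeP[/graphs_onP gE _]; rewrite inE.
  apply/eqP/setP => e; rewrite inE; apply/negP => /gE[]; rewrite finset.subset0 => /eqP ->.
  by rewrite finset.cards0.
have [A3|A3] := leqP 3 #|A|; last first.
  have [A0|A0] := posnP #|A|; first by apply: IH; rewrite A0.
  apply: leq_trans (_ : #|finset.powerset (finset.powerset A)| <= _).
    apply/subset_leq_card/subsetP => E /K5freeP[/graphs_onP gE _]; rewrite finset.powersetE.
    by apply/subsetP => e /gE[? _]; rewrite finset.powersetE.
  rewrite !finset.card_powerset; apply: leq_trans (_ : 2 ^ 4 <= _).
    by rewrite leq_exp2l //; case: #|A| A3 A0 => [|[|[|]]].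
  have T0 : 0 < #|T| by apply: leq_trans A0 _; exact: max_card.
  rewrite expnMn; apply: leq_trans (leq_pmulr _ _); last by rewrite expn_gt0 T0.
  rewrite -expnM leq_exp2l //; apply: (@leq_mul 4 1) => //; exact: leq_trans hk.
pose R S := [set r : {ffun T -> T} | [forall v, (v \notin S) ==> (r v == v)]].
pose XA S r := [set E in K5free A | [forall v in S, [set v; r v] \in E]].
pose XB S r := [set E in K5free A | [forall v in S, forall y, ([set r v; y] \in E) == ([set v; y] \in E)]].
pose ok S r := [forall v in S, r v \in A :\: S] && (r \in R S).
pose inj S r := [forall v in S, forall w in S, (r v == r w) ==> (v == w)].
pose Y S r := (if inj S r then XA S r else finset.set0) :|: XB S r.
have sub : K5free A \subset \bigcup_(S : {set T} | (S \subset A) && (#|A| <= 1100 * #|S|))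
    \bigcup_(r : {ffun T -> T} | ok S r) Y S r.
  apply/subsetP => E EK; have [S [r [SA cS r1 r2 h]]] := reduction_exists EK A3.
  apply/finset.bigcupP; exists S; first by rewrite SA.
  apply/finset.bigcupP; exists r.
    apply/andP; split; first by apply/forall_inP.
    by rewrite inE; apply/forallP => v; apply/implyP => /r1 ->.
  rewrite /Y finset.in_setU; apply/orP; case: h => [[ri rE]|tw]; [left|right].
    have -> : inj S r.
      by apply/forall_inP => v vS; apply/forall_inP => w wS; apply/implyP => /eqP/ri->.
    by rewrite inE EK; apply/forall_inP.
  by rewrite inE EK; apply/forall_inP => v vS; apply/forallP => y; rewrite tw.
have T0 : 0 < #|T| by apply: leq_trans (max_card (mem A)); apply: leq_trans A3.
apply: leq_trans (subset_leq_card sub) _; apply: leq_trans (leq_card_bigcup _ _) _.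
have bound S : (S \subset A) && (#|A| <= 1100 * #|S|) ->
    #|\bigcup_(r : {ffun T -> T} | ok S r) Y S r| <= #|T| ^ #|A| * 2 ^ (k * #|A| - #|A|).
  move=> /andP[SA cS].
  apply: leq_trans (leq_card_bigcup _ _) _.
  apply: leq_trans (_ : #|R S| * (2 ^ (130 * #|A|) * #|K5free (A :\: S)|) <= _).
    rewrite -sum_nat_const; apply: leq_trans (_ : \sum_(r : {ffun T -> T} | ok S r) 2 ^ (130 * #|A|) * #|K5free (A :\: S)| <= _); last first.
      rewrite big_mkcond [leqRHS]big_mkcond; apply: leq_sum => r _; rewrite /ok.
      by case: (r \in R S); rewrite ?andbF // andbT; case: ifP.
    apply: leq_sum => r /andP[/forall_inP r2]; rewrite inE => /forallP r1.
    have r1' v : v \notin S -> r v = v by move=> vS; have /implyP/(_ vS)/eqP := r1 v.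
    rewrite /Y; apply: leq_trans (leq_card_setU _ _).1 _.
    have hB := card_twin_codes r1' r2.
    have hA : #|if inj S r then XA S r else finset.set0| <= #|K5free (A :\: S)| * 2 ^ (129 * #|A|).
      case: ifP => [/forall_inP ri|_]; last by rewrite finset.cards0.
      apply: card_contract_codes => // v w vS wS /eqP vw.
      by have /forall_inP/(_ w wS)/implyP/(_ vw)/eqP := ri v vS.
    apply: leq_trans (leq_add hA hB) _; rewrite -[X in _ + X <= _]muln1 -mulnDr [leqRHS]mulnC leq_mul2l; apply/orP; right.
    apply: leq_trans (_ : 2 ^ (129 * #|A|) * 2 <= _); first by have := expn_gt0 2 (129 * #|A|); lia.
    by rewrite -expnSr leq_exp2l //; lia.
  rewrite card_retractions.
  have cAS : #|A :\: S| = #|A| - #|S|.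
    by rewrite finset.cardsD (finset.setIidPr SA).
  have cSA := subset_leq_card SA.
  have S0 : 0 < #|S| by lia.
  have h := IH (A :\: S) ltac:(lia).
  apply: leq_trans (_ : #|T| ^ #|S| * (2 ^ (130 * #|A|) * (2 ^ k * #|T|) ^ #|A :\: S|) <= _).
    by rewrite !leq_mul2l h !orbT.
  rewrite cAS expnMn (mulnC ((2 ^ k) ^ _)) (mulnCA (2 ^ (130 * _))) mulnA -expnD subnKC // leq_mul2l; apply/orP; right.
  rewrite -expnM -expnD leq_exp2l //.
  have : 131 * #|A| <= k * #|S| by apply: leq_trans (_ : 131 * 1100 * #|S| <= _); [lia|rewrite leq_mul2r hk orbT].
  by rewrite mulnBr; have := leq_mul (leqnn k) cSA; lia.
apply: leq_trans (_ : \sum_(S : {set T} | (S \subset A) && (#|A| <= 1100 * #|S|))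
    #|T| ^ #|A| * 2 ^ (k * #|A| - #|A|) <= _); first by apply: leq_sum => S hS; exact: bound.
apply: leq_trans (_ : \sum_(S in finset.powerset A) #|T| ^ #|A| * 2 ^ (k * #|A| - #|A|) <= _).
  rewrite big_mkcond [leqRHS]big_mkcond; apply: leq_sum => S _.
  by rewrite finset.powersetE; case: (S \subset A) => //=; case: ifP.
rewrite sum_nat_const finset.card_powerset mulnCA -expnD subnKC; last first.
  by apply: leq_pmull; apply: leq_trans hk.
by rewrite expnMn -expnM mulnC.
Qed.

End SmallClass.

(** * Operations on plane drawings *)

Section PlaneTools.
Local Open Scope ring_scope.
Variables (R : realType).

Lemma finite_radius (I : finType) (P : I -> R -> Prop) :
  (forall i d d', 0 < d' -> d' <= d -> P i d -> P i d') -> (forall i, exists2 d, 0 < d & P i d) ->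
  exists2 d, 0 < d & forall i, P i d.
Proof.
move=> mono H.
have H' i : exists d, 0 < d /\ P i d by have [d ? ?] := H i; exists d.
have [D hD] := boolp.choice H'.
have d0 : 0 < \big[Num.min/1]_i D i.
  elim/big_ind: _ => // [x y x0 y0|i _]; first by rewrite lt_min x0.
  by have [] := hD i.
exists (\big[Num.min/1]_i D i) => // i; have [_] := hD i.
by apply: mono => //; exact: bigmin_le.
Qed.

Lemma small_avoid_seq (r : R) (s : seq R) : 0 < r ->
  exists2 d, 0 < d & forall y, 0 < y < d -> (y < r) && (y \notin s).
Proof.
move=> r0; elim: s => [|z s [d d0 hd]]; first by exists r => // y /andP[_ ->].
exists (if 0 < z then Num.min d z else d); first by case: ifP => // z0; rewrite lt_min d0.
move=> y /andP[y0 yd]; rewrite inE negb_or.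
have [z0|z0] := ltP 0 z.
  move: yd; rewrite z0 lt_min => /andP[yd yz].
  by have /andP[-> ->] := hd y ltac:(by rewrite y0 yd); rewrite lt_eqF.
move: yd; rewrite (ltNge 0 z) z0 /= => yd; have /andP[-> ->] := hd y ltac:(by rewrite y0 yd).
by rewrite gt_eqF // (le_lt_trans z0).
Qed.

Lemma cont_pair (f g : R -> R) : continuous f -> continuous g ->
  continuous (fun t : R => (f t, g t) : R * R).
Proof. by move=> cf cg t; exact: (cvg_pair (cf t) (cg t)). Qed.

Lemma cont_add (f g : R -> R * R) : continuous f -> continuous g ->
  continuous (fun t : R => f t + g t).
Proof. by move=> cf cg t; apply: cvgD; [exact: cf|exact: cg]. Qed.

Lemma cont_affine (p w : R * R) : continuous (fun t : R => p + t *: w).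
Proof.
move=> t; apply: cvgD; first exact: cvg_cst.
exact: scalel_continuous.
Qed.

Lemma cont_norm (f : R -> R * R) (p : R * R) : continuous f -> continuous (fun t : R => `|f t - p|).
Proof.
by move=> cf t; apply: cvg_norm; apply: cvgB; [exact: cf|exact: cvg_cst].
Qed.

Lemma cont_at (h : R -> R) t eps : continuous h -> 0 < eps ->
  exists2 d, 0 < d & forall s, `|t - s| < d -> `|h t - h s| < eps.
Proof.
move=> ch e0; have /cvgrPdist_lt /(_ eps e0) /nbhs_ballP [d d0 hd] := ch t.
by exists d => // s ts; apply: hd.
Qed.

Lemma last_exit (h : R -> R) (r : R) : continuous h -> h 0 < r -> r < h 1 ->
  exists tau, [/\ 0 < tau < 1, h tau = r & forall t, tau < t <= 1 -> r < h t].
Proof.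
move=> ch h0 h1.
pose A : set R := (fun t => 0 <= t <= 1 /\ h t <= r).
have A0 : A 0 by split; [rewrite lexx ler01|exact: ltW].
have hA : has_sup A by split; [exists 0|exists 1 => t [/andP[]]].
have c0 : 0 <= sup A by apply: sup_upper_bound hA _ A0.
have c1 : sup A <= 1 by apply: ge_sup; [exists 0|move=> t [/andP[]]].
have beyond t : sup A < t <= 1 -> r < h t.
  move=> /andP[st t1]; rewrite ltNge; apply/negP => ht.
  have : t <= sup A by apply: sup_upper_bound hA _ _; split=> //; rewrite t1 andbT (le_trans c0) // ltW.
  by rewrite leNgt st.
have hs : h (sup A) = r.
  apply/eqP; rewrite eq_le; apply/andP; split; rewrite leNgt; apply/negP => hr.
    have [d d0 hd] := @cont_at h (sup A) (h (sup A) - r) ch ltac:(lra).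
    have [t At tc] := sup_adherent d0 hA.
    have tc' : t <= sup A by apply: sup_upper_bound hA _ At.
    have := hd t; rewrite ger0_norm ?subr_ge0 // => /(_ ltac:(lra)) /ltr_normlW.
    by case: At => _ ?; lra.
  have [d d0 hd] := @cont_at h (sup A) (r - h (sup A)) ch ltac:(lra).
  have n1 : sup A < 1.
    by rewrite lt_def c1 andbT; apply/eqP => e1; rewrite -e1 in hr; lra.
  pose t := Num.min (sup A + d / 2) 1.
  have tp : sup A < t <= 1.
    by rewrite /t lt_min ge_min lexx orbT andbT n1 andbT ltrDl divr_gt0.
  have := beyond t tp; have := hd t.
  rewrite distrC ger0_norm; last by case/andP: tp => /ltW; lra.
  have -> : (t - sup A < d) by rewrite /t; case: (leP (sup A + d / 2) 1) => ?; lra.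
  by move=> /(_ isT); rewrite distrC => /ltr_normlW; lra.
exists (sup A); split=> //; apply/andP; split.
  by rewrite lt_def c0 andbT; apply/eqP => e0; rewrite e0 in hs; lra.
by rewrite lt_def c1 andbT; apply/eqP => e1; rewrite -e1 in hs; lra.
Qed.

End PlaneTools.

(** * A free segment at a vertex of a drawing *)

Section Access.
Local Open Scope ring_scope.
Variables (R : realType) (T : finType).
Implicit Types (E : {set {set T}}) (pos : T -> R * R) (arc : {set T} -> R -> R * R).

Lemma dr_endpoint E pos arc e t : drawing E pos arc -> e \in E -> 0 <= t <= 1 ->
  (0 < t < 1) \/ (exists2 u, u \in e & arc e t = pos u).
Proof.
move=> d eE /andP[s0 s1]; have [u [v [-> h0 h1]]] := dr_ends d eE.
have [->|n0] := eqVneq t 0; first by right; exists u => //; rewrite !inE eqxx.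
have [->|n1] := eqVneq t 1; first by right; exists v => //; rewrite !inE eqxx orbT.
by left; rewrite !lt_def n0 s0 eq_sym n1 s1.
Qed.

Lemma drawing_orient E pos arc v : drawing E pos arc ->
  exists arc', [/\ drawing E pos arc', forall e, e \in E -> v \in e -> arc' e 0 = pos v
    & forall e t, arc' e t = arc e t \/ arc' e t = arc e (1 - t)].
Proof.
move=> d.
pose rev e : bool := arc e 1 == pos v.
pose sg e (t : R) := if rev e then 1 - t else t.
have sg01 e t : 0 <= t <= 1 -> 0 <= sg e t <= 1 by rewrite /sg; case: ifP => _; lra.
have sg01' e t : 0 < t < 1 -> 0 < sg e t < 1 by rewrite /sg; case: ifP => _; lra.
exists (fun e t => arc e (sg e t)); split.
  split.
  - exact: (dr_pos_inj d).
  - move=> e eE; rewrite /sg; case: (rev e); last exact: (dr_cont d).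
    exact: continuous_rev (dr_cont d eE).
  - move=> e eE s t hs ht /(dr_inj d eE (sg01 e _ hs) (sg01 e _ ht)).
    by rewrite /sg; case: ifP => _; lra.
  - move=> e eE; have [x [y [ee h0 h1]]] := dr_ends d eE.
    rewrite /sg; case: (rev e); last by exists x, y.
    by exists y, x; rewrite subr0 subrr finset.setUC.
  - by move=> e eE t /(sg01' e) ht; exact: (dr_vertices d).
  - by move=> e f eE fE ef s t /(sg01' e) hs /(sg01' f) ht; exact: (dr_disjoint d).
2: by move=> e t; rewrite /sg; case: ifP; auto.
move=> e eE ve; rewrite /sg /rev; case: eqVneq => [|ne]; first by rewrite subr0.
have [x [y [ee h0 h1]]] := dr_ends d eE; rewrite h0.
move: ve; rewrite ee !inE => /orP[/eqP->//|/eqP vy]; by rewrite h1 vy eqxx in ne.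
Qed.

Lemma dr_ends_neq E pos arc e : drawing E pos arc -> e \in E -> arc e 0 <> arc e 1.
Proof.
by move=> d eE /(dr_inj d eE) h; have := h _ _; rewrite !lexx !ler01 => /(_ isT isT); lra.
Qed.

Lemma free_disc E pos arc v : drawing E pos arc -> exists2 r : R, 0 < r &
  (forall u, u != v -> r < `|pos u - pos v|) /\
  (forall e, e \in E -> v \notin e -> forall t, 0 <= t <= 1 -> r < `|arc e t - pos v|).
Proof.
move=> d.
have H1 u : exists2 r : R, 0 < r & (u != v -> r < `|pos u - pos v|).
  have [->|n] := eqVneq u v; first by exists 1.
  have p : 0 < `|pos u - pos v| by rewrite normr_gt0 subr_eq0 (inj_eq (dr_pos_inj d)).
  by exists (`|pos u - pos v| / 2) => [|_]; lra.
have H2 e : exists2 r : R, 0 < r & (e \in E -> v \notin e ->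
    forall t, 0 <= t <= 1 -> r < `|arc e t - pos v|).
  have [/andP[eE ve]|n] := boolP ((e \in E) && (v \notin e)); last first.
    by exists 1 => // h h'; rewrite h h' in n.
  have cc : continuous (fun _ : R => pos v) by move=> t; exact: cvg_cst.
  have [|dd dd0 hd] := arcs_apart (dr_cont d eE) cc.
    move=> s t hs _; case: (dr_endpoint d eE hs) => [s01|[u ue ->]]; first exact: (dr_vertices d).
    by move=> /(dr_pos_inj d) uv; rewrite -uv ue in ve.
  by exists (dd / 2) => [|_ _ t ht]; [lra|have := hd t t ht ht; lra].
have [r1 r10 h1] := finite_radius (fun u a b _ ba h n => le_lt_trans ba (h n)) H1.
have [r2 r20 h2] := finite_radius (fun e a b _ ba h n n' t ht => le_lt_trans ba (h n n' t ht)) H2.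
exists (Num.min r1 r2); first by rewrite lt_min r10.
split; first by move=> u uv; apply: le_lt_trans (h1 u uv); rewrite ge_min lexx.
by move=> e eE ve t ht; apply: le_lt_trans (h2 e eE ve t ht); rewrite ge_min lexx orbT.
Qed.

(* Inside a small disc around [v] every arc is replaced by the radius ending at
   the point where the arc leaves the disc for the last time. *)
Lemma accessible E v : planar R E -> exists pos arc (c : R * R),
  [/\ drawing E pos arc, c <> pos v,
     forall s u, 0 < s <= 1 -> pos v + s *: (c - pos v) <> pos u &
     forall s e t, 0 < s <= 1 -> e \in E -> 0 <= t <= 1 -> pos v + s *: (c - pos v) <> arc e t].
Proof.
move=> /planar_drawing [pos [arc0 d0]].
have [arc [d orient _]] := drawing_orient v d0.
have [r r0 [hu he]] := free_disc v d.
have Htau (e : {set T}) : exists tau : R, e \in E -> v \in e ->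
    [/\ 0 < tau < 1, `|arc e tau - pos v| = r & forall t, tau < t <= 1 -> r < `|arc e t - pos v|].
  have [/andP[eE ve]|n] := boolP ((e \in E) && (v \in e)); last first.
    by exists 0 => h h'; rewrite h h' in n.
  have h0 : `|arc e 0 - pos v| < r by rewrite orient // subrr normr0.
  have h1 : r < `|arc e 1 - pos v|.
    have [x [y [ee ex ey]]] := dr_ends d eE; rewrite ey; apply: hu.
    by apply/eqP => yv; apply: (dr_ends_neq d eE); rewrite orient // ey yv.
  by have [tau ht] := last_exit (cont_norm (p := pos v) (dr_cont d eE)) h0 h1; exists tau.
have [tau htau] := boolp.choice Htau.
pose q (e : {set T}) := arc e (tau e).
pose mn (t a : R) := Num.min (t / a) 1.
pose rad (e : {set T}) (t : R) := pos v + mn t (tau e) *: (q e - pos v).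
(* A sum instead of a case distinction makes continuity immediate: up to [tau e] the second summand
   vanishes, and afterwards [rad e t] stays at [q e]. *)
pose arc' (e : {set T}) (t : R) := if v \in e then rad e t + (arc e (Num.max t (tau e)) - q e) else arc e t.
have lo e t : e \in E -> v \in e -> t <= tau e ->
    arc' e t = pos v + (t / tau e) *: (q e - pos v).
  move=> eE ve ht; have [/andP[t0 _] _ _] := htau e eE ve.
  rewrite /arc' ve (max_idPr ht) subrr addr0 /rad /mn (min_idPl _) //.
  by rewrite ler_pdivrMr // mul1r.
have hi e t : e \in E -> v \in e -> tau e <= t -> arc' e t = arc e t.
  move=> eE ve ht; have [/andP[t0 _] _ _] := htau e eE ve.
  rewrite /arc' ve (max_idPl ht) /rad /mn (min_idPr _).
    by rewrite scale1r subrKC addrC subrK.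
  by rewrite ler_pdivlMr // mul1r.
have nlo e t : e \in E -> v \in e -> 0 <= t <= tau e -> `|arc' e t - pos v| = t / tau e * r.
  move=> eE ve /andP[t0 ht]; have [/andP[ta0 _] nr _] := htau e eE ve.
  by rewrite lo // addrC addKr normrZ nr ger0_norm // divr_ge0 // ltW.
have nlo' e t : e \in E -> v \in e -> 0 <= t <= tau e -> `|arc' e t - pos v| <= r.
  move=> eE ve ht; have [/andP[ta0 _] nr _] := htau e eE ve.
  by rewrite nlo // ler_piMl ?(ltW r0) // ler_pdivrMr // mul1r; case/andP: ht.
have nhi e t : e \in E -> v \in e -> tau e < t <= 1 -> r < `|arc' e t - pos v|.
  move=> eE ve /andP[ht t1]; have [_ _ h] := htau e eE ve.
  by rewrite hi // ?ltW // h // ht.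
have out e t : e \in E -> v \notin e -> 0 <= t <= 1 -> r < `|arc' e t - pos v|.
  by move=> eE ve ht; rewrite /arc' (negbTE ve) he.
have e0 e : e \in E -> v \in e -> arc' e 0 = pos v.
  move=> eE ve; have [/andP[ta0 _] _ _] := htau e eE ve.
  by rewrite lo // ?ltW // mul0r scale0r addr0.
have e1 e : e \in E -> arc' e 1 = arc e 1.
  move=> eE; have [ve|ve] := boolP (v \in e); last by rewrite /arc' (negbTE ve).
  by have [/andP[_ ta1] _ _] := htau e eE ve; rewrite hi // ltW.
have d' : drawing E pos arc'.
  split.
  - exact: (dr_pos_inj d).
  - move=> e eE; rewrite /arc'; case: (boolP (v \in e)) => ve; last exact: (dr_cont d).
    have [/andP[ta0 ta1] _ _] := htau e eE ve.
    apply: cont_add.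
      apply: (@continuous_lip R (fun s => pos v + s *: (q e - pos v)) (fun t => mn t (tau e)) (tau e)^-1).
        move=> t s; have := ler_norm (t - s); have := ler_norm (s - t).
        rewrite (distrC s t) => h1 h2.
        have ti : 0 < (tau e)^-1 by rewrite invr_gt0.
        have m1 := ler_wpM2l (ltW ti) h1; have m2 := ler_wpM2l (ltW ti) h2.
        rewrite /mn ler_norml; case: (leP (t / tau e) 1) => ?; case: (leP (s / tau e) 1) => ?; 
          have := mulr_ge0 (ltW ti) (normr_ge0 (t - s)); lra.
      exact: cont_affine.
    apply: (@cont_add R (fun t => arc e (Num.max t (tau e))) (fun=> - q e)); last by move=> t; exact: cvg_cst.
    apply: (@continuous_lip R (arc e) (fun t => Num.max t (tau e)) 1); last exact: (dr_cont d).
    move=> t s; have := ler_norm (t - s); have := ler_norm (s - t); rewrite (distrC s t) mul1r ler_norml.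
    by case: (leP t (tau e)) => ?; case: (leP s (tau e)) => ?; lra.
  - move=> e eE s t hs ht eq; have [ve|ve] := boolP (v \in e); last first.
      by move: eq; rewrite /arc' (negbTE ve); exact: (dr_inj d).
    have [/andP[ta0 ta1] _ _] := htau e eE ve.
    have [s1|s1] := leP s (tau e); have [t1|t1] := leP t (tau e).
    + have := nlo e s eE ve; have := nlo e t eE ve; rewrite eq; case/andP: hs => -> _; case/andP: ht => -> _.
      rewrite s1 t1 => -> // /(_ isT) /(mulIf (lt0r_neq0 r0)) /(mulIf (invr_neq0 (lt0r_neq0 ta0))).
      by [].
    + have := nlo' e s eE ve; rewrite s1 eq; case/andP: hs => -> _ /(_ isT).
      by rewrite leNgt nhi // t1; case/andP: ht.
    + have := nlo' e t eE ve; rewrite t1 -eq; case/andP: ht => -> _ /(_ isT).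
      by rewrite leNgt nhi // s1; case/andP: hs.
    + by move: eq; rewrite !hi ?ltW //; exact: (dr_inj d).
  - move=> e eE; have [x [y [ee h0 h1]]] := dr_ends d eE; exists x, y; rewrite e1 //; split=> //.
    have [ve|ve] := boolP (v \in e); last by rewrite /arc' (negbTE ve).
    by rewrite e0 // -h0 orient.
  - move=> e eE t ht u eq; have [ve|ve] := boolP (v \in e); last first.
      by move: eq; rewrite /arc' (negbTE ve); exact: (dr_vertices d).
    have [/andP[ta0 ta1] _ _] := htau e eE ve.
    case/andP: (ht) => t0 t1; have [s1|s1] := leP t (tau e); last first.
      by move: eq; rewrite hi ?ltW //; exact: (dr_vertices d).
    have [uv|uv] := eqVneq u v.
      have := nlo e t eE ve; rewrite (ltW t0) s1 eq uv subrr normr0 => /(_ isT) /esym/eqP.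
      by rewrite mulf_eq0 (gt_eqF r0) orbF gt_eqF // divr_gt0.
    by have := nlo' e t eE ve; rewrite (ltW t0) s1 eq => /(_ isT); rewrite leNgt hu.
  - move=> e f eE fE ef s t hs ht eq.
    have hs' : 0 <= s <= 1 by lra. have ht' : 0 <= t <= 1 by lra.
    have s0 : 0 <= s by lra. have t0 : 0 <= t by lra.
    have s1 : s <= 1 by lra. have t1 : t <= 1 by lra.
    have [ve|ve] := boolP (v \in e); have [vf|vf] := boolP (v \in f); last first.
    + by move: eq; rewrite /arc' (negbTE ve) (negbTE vf); exact: (dr_disjoint d).
    + have [t2|t2] := leP t (tau f).
        by have := nlo' f t fE vf; rewrite t0 t2 -eq => /(_ isT); rewrite leNgt out.
      by move: eq; rewrite (hi f) ?(ltW t2) // /arc' (negbTE ve); exact: (dr_disjoint d).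
    + have [s2|s2] := leP s (tau e).
        by have := nlo' e s eE ve; rewrite s0 s2 eq => /(_ isT); rewrite leNgt out.
      by move: eq; rewrite (hi e) ?(ltW s2) // /arc' (negbTE vf); exact: (dr_disjoint d).
    have [/andP[te0 te1] _ _] := htau e eE ve; have [/andP[tf0 tf1] _ _] := htau f fE vf.
    have [s2|s2] := leP s (tau e); have [t2|t2] := leP t (tau f).
    + have := nlo e s eE ve; have := nlo f t fE vf; rewrite s0 s2 t0 t2 eq => -> // /(_ isT).
      move=> /(mulIf (lt0r_neq0 r0)) lam.
      move: eq; rewrite !lo // lam => /addrI /scalerI; rewrite mulf_neq0 ?invr_neq0 ?gt_eqF //; last by lra.
      by move=> /(_ isT) /addIr; apply: (dr_disjoint d); rewrite ?te0 ?tf0.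
    + by have := nlo' e s eE ve; rewrite s0 s2 eq => /(_ isT); rewrite leNgt nhi ?t2.
    + by have := nlo' f t fE vf; rewrite t0 t2 -eq => /(_ isT); rewrite leNgt nhi ?s2.
    + by move: eq; rewrite !hi ?ltW //; exact: (dr_disjoint d).
(* The norm of [R * R] is the maximum norm, so [(r, y)] with [0 < y < r] has norm [r], like all
   vectors [q e - pos v]. A value of [y] different from their second coordinates gives a direction
   different from all radii. *)
have [dy dy0 hdy] := small_avoid_seq [seq (q e - pos v).2 | e : {set T} in E] r0.
pose y := dy / 2.
have /andP[yr yq] := hdy y ltac:(rewrite /y; lra).
have y0 : 0 < y by rewrite /y; lra.
pose c : R * R := pos v + (r, y).
have cv : c - pos v = (r, y) by rewrite /c addrC addKr.
have nc : `|c - pos v| = r.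
  by rewrite cv prod_normE /= !ger0_norm ?ltW // (max_idPl _) // ltW.
have np s : 0 < s -> s <= 1 -> `|pos v + s *: (c - pos v) - pos v| = s * r.
  by move=> s0 s1; rewrite addrC addKr normrZ nc ger0_norm // ltW.
have nple s : 0 < s -> s <= 1 -> s * r <= r by move=> s0 s1; rewrite ler_piMl // ltW.
exists pos, arc', c; split=> //.
- by move=> cv'; move: nc; rewrite cv' subrr normr0 => r0'; rewrite -r0' ltxx in r0.
- move=> s u /andP[s0 s1] eq; have [uv|uv] := eqVneq u v.
    have := np s s0 s1; rewrite eq uv subrr normr0 => /esym/eqP.
    by rewrite mulf_eq0 (gt_eqF r0) (gt_eqF s0).
  by have := nple s s0 s1; rewrite -np // eq leNgt hu.
- move=> s e t /andP[s0 s1] eE ht eq.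
  case/andP: (ht) => t0 t1.
  have [ve|ve] := boolP (v \in e); last by have := nple s s0 s1; rewrite -np // eq leNgt out.
  have [/andP[te0 te1] _ _] := htau e eE ve.
  have [t2|t2] := leP t (tau e); last by have := nple s s0 s1; rewrite -np // eq leNgt nhi ?t2.
  have := np s s0 s1; rewrite eq nlo ?t0 // => /(mulIf (lt0r_neq0 r0)) lam.
  move: eq; rewrite lo // lam => /addrI /scalerI; rewrite gt_eqF // => /(_ isT) cq.
  move/negP: yq; apply; apply/mapP; exists e; first by rewrite mem_enum.
  by rewrite -cq cv.
Qed.

End Access.

(** * Opening the plane along a slit *)

Section NormalForm.
Local Open Scope ring_scope.
Variables (R : realType).
Notation P := (R * R)%type.

Lemma drawing_map (T : finType) (E : {set {set T}}) pos arc (psi : P -> P) (K : P -> Prop) :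
  drawing E pos arc -> (forall v, K (pos v)) ->
  (forall e t, e \in E -> 0 <= t <= 1 -> K (arc e t)) ->
  (forall p q, K p -> K q -> psi p = psi q -> p = q) ->
  (forall p, K p -> {for p, continuous psi}) ->
  drawing E (psi \o pos) (fun e t => psi (arc e (clamp t))).
Proof.
move=> d kpos karc inj cont.
have itv (t : R) : 0 < t < 1 -> 0 <= t <= 1 by lra.
split.
- by move=> x y /inj h; apply: (dr_pos_inj d); exact: h.
- move=> e eE t.
  apply: (@continuous_comp _ _ _ (arc e \o @clamp R) psi).
    apply: (@continuous_lip R (arc e) (@clamp R) 1); last exact: (dr_cont d).
    by move=> x y; rewrite mul1r; exact: clamp_lip.
  by apply: cont; apply: karc => //; exact: clamp_itv.
- move=> e eE s t hs ht; rewrite !clamp_id // => /inj h.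
  by apply: (dr_inj d eE) => //; apply: h; exact: karc.
- move=> e eE; have [x [y [ee h0 h1]]] := dr_ends d eE; exists x, y.
  by rewrite !clamp_id ?lexx ?ler01 // h0 h1.
- move=> e eE t ht v; rewrite clamp_id ?itv // => /inj h; apply: (dr_vertices d eE ht).
  by apply: h => //; apply: karc => //; exact: itv.
- move=> e f eE fE ef s t hs ht; rewrite !clamp_id ?itv // => /inj h.
  by apply: (dr_disjoint d eE fE ef hs ht); apply: h; apply: karc => //; exact: itv.
Qed.

(** The complex quotient [w / d]. *)
Definition cdiv (d w : P) : P :=
  ((w.1 * d.1 + w.2 * d.2) / (d.1 ^+ 2 + d.2 ^+ 2), (w.2 * d.1 - w.1 * d.2) / (d.1 ^+ 2 + d.2 ^+ 2)).

Definition inversion (z : P) : P := (z.1 / (z.1 ^+ 2 + z.2 ^+ 2), z.2 / (z.1 ^+ 2 + z.2 ^+ 2)).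

(* Parabolic coordinates: the plane slit along the negative half-axis is mapped
   onto the right half-plane. *)
Definition parabolic (z : P) : P := (Num.sqrt (z.1 ^+ 2 + z.2 ^+ 2) + z.1, z.2).

(** Division sends the segment from [c] to [v] to [[0, 1]], with [c] at 0 and [v] at 1. Inversion
    moves it to the half-line from 1 to infinity, the reflected shift to the negative half-axis with
    [v] at the origin, where [parabolic] applies. *)
Definition slit_map (v c : P) (z : P) : P :=
  let w := inversion (cdiv (v.1 - c.1, v.2 - c.2) (z.1 - c.1, z.2 - c.2)) in parabolic (1 - w.1, w.2).

Lemma sqnorm_gt0 (d : P) : d <> 0 -> 0 < d.1 ^+ 2 + d.2 ^+ 2.
Proof.
case: d => a b d0; rewrite lt_def addr_ge0 ?sqr_ge0 // andbT paddr_eq0 ?sqr_ge0 //=.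
by rewrite !sqrf_eq0; apply/negP => /andP[/eqP a0 /eqP b0]; apply: d0; rewrite a0 b0.
Qed.

Lemma cdivK d w : d <> 0 ->
  ((cdiv d w).1 * d.1 - (cdiv d w).2 * d.2, (cdiv d w).1 * d.2 + (cdiv d w).2 * d.1) = w.
Proof.
move=> /sqnorm_gt0 D0; case: w => a b; rewrite /cdiv /=.
by congr pair; field; rewrite gt_eqF.
Qed.

Lemma inversionK z : z <> 0 -> inversion (inversion z) = z.
Proof.
move=> /sqnorm_gt0; case: z => a b /= D0; rewrite /inversion /=.
have n0 : a ^+ 2 + b ^+ 2 != 0 by rewrite gt_eqF.
have -> : (a / (a ^+ 2 + b ^+ 2)) ^+ 2 + (b / (a ^+ 2 + b ^+ 2)) ^+ 2 = (a ^+ 2 + b ^+ 2)^-1 by field.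
by congr pair; field.
Qed.

Lemma parabolic_ge0 z : 0 <= (parabolic z).1.
Proof.
rewrite /parabolic /=; have : `|z.1| <= Num.sqrt (z.1 ^+ 2 + z.2 ^+ 2).
  by rewrite -sqrtr_sqr ler_wsqrtr // lerDl sqr_ge0.
by rewrite ler_norml; lra.
Qed.

Lemma parabolic_eq0 z : (parabolic z).1 = 0 -> z.2 = 0 /\ z.1 <= 0.
Proof.
rewrite /parabolic /= => h; have s : Num.sqrt (z.1 ^+ 2 + z.2 ^+ 2) = - z.1 by lra.
have z1 : z.1 <= 0 by have := sqrtr_ge0 (z.1 ^+ 2 + z.2 ^+ 2); lra.
split=> //; have := congr1 (fun x => x ^+ 2) s; rewrite /= sqr_sqrtr ?addr_ge0 ?sqr_ge0 // sqrrN => h'.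
by apply/eqP; rewrite -sqrf_eq0; apply/eqP; lra.
Qed.

(** If [s] is the first coordinate of the image of [(x, y)], then [y ^ 2 = s ^ 2 - 2 s x], which
    determines [x] when [s] is nonzero. *)
Lemma parabolic_inj z w : 0 < (parabolic z).1 -> parabolic z = parabolic w -> z = w.
Proof.
rewrite /parabolic /=; case: z w => a b [a' b'] /= s0 [h1 h2]; subst b'.
have e (x y s : R) : Num.sqrt (x ^+ 2 + y ^+ 2) + x = s -> y ^+ 2 = s ^+ 2 - 2 * s * x.
  move=> h; have h' : Num.sqrt (x ^+ 2 + y ^+ 2) = s - x by lra.
  by have := congr1 (fun z => z ^+ 2) h'; rewrite /= sqr_sqrtr ?addr_ge0 ?sqr_ge0 // => h''; lra.
have e1 := e a b _ erefl; have e2 := e a' b _ (esym h1).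
congr pair; set s := _ + _ in s0 e1 e2.
have : 2 * s * a = 2 * s * a' by lra.
by apply: mulfI; rewrite mulf_neq0 // gt_eqF.
Qed.

Section SlitMap.
Variables v c : P.
Hypothesis vc : c <> v.
Let K z := z <> c /\ forall s, 0 < s < 1 -> z <> v + s *: (c - v).

Let d : P := (v.1 - c.1, v.2 - c.2).
Let d0 : d <> 0.
Proof.
move=> [h1 h2]; apply: vc; rewrite (surjective_pairing c) (surjective_pairing v); congr pair; lra.
Qed.
Let D0 : (v.1 - c.1) ^+ 2 + (v.2 - c.2) ^+ 2 != 0.
Proof. by rewrite gt_eqF //; exact: (sqnorm_gt0 d0). Qed.

Let W z := cdiv d (z.1 - c.1, z.2 - c.2).

Let W_inj z w : W z = W w -> z = w.
Proof.
move=> h; have := cdivK (z.1 - c.1, z.2 - c.2) d0; rewrite -/(W z) h cdivK // => -[h1 h2].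
rewrite (surjective_pairing z) (surjective_pairing w); congr pair; lra.
Qed.

Let W0 z : z <> c -> W z <> 0.
Proof.
move=> zc Wz; apply: zc; apply: W_inj; rewrite Wz /W /cdiv /= !subrr !mul0r add0r subr0 !mul0r.
by [].
Qed.

Lemma slit_map_apex : slit_map v c v = (0, 0).
Proof.
rewrite /slit_map /cdiv /inversion /parabolic /=.
have -> : (v.2 - c.2) * (v.1 - c.1) - (v.1 - c.1) * (v.2 - c.2) = 0 by ring.
rewrite -!expr2 divff // mul0r expr0n /= addr0 expr1n mul1r invr1 subrr mul0r.
by rewrite expr0n /= !addr0 sqrtr0.
Qed.

Lemma slit_map_gt0 z : K z -> z <> v -> 0 < (slit_map v c z).1.
Proof.
move=> [zc zs] zv; rewrite lt_def parabolic_ge0 andbT; apply/eqP => e0.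
have [hb ha] : (inversion (W z)).2 = 0 /\ 1 - (inversion (W z)).1 <= 0 by exact: (parabolic_eq0 e0).
have N0 := sqnorm_gt0 (W0 zc).
have := cdivK (z.1 - c.1, z.2 - c.2) d0; rewrite -/(W z).
move: N0 hb ha; case: (W z) => a b; rewrite /inversion /= => N0 hb ha [e1 e2].
have b0 : b = 0 by move/eqP: hb; rewrite mulf_eq0 invr_eq0 (gt_eqF N0) orbF => /eqP.
subst b; move: N0 ha e1 e2; rewrite expr0n /= !mul0r subr0 !addr0 /d /= => N0 ha e1 e2.
have a2 : a ^+ 2 <= a by move: ha; rewrite subr_le0 ler_pdivlMr // mul1r.
have a0 : 0 < a by apply: lt_le_trans a2.
have a1 : a <= 1 by rewrite -(ler_pM2r a0) mul1r -expr2.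
have [a1'|a1'] := eqVneq a 1.
  apply: zv; subst a; rewrite (surjective_pairing z) (surjective_pairing v); congr pair; lra.
apply: (zs (1 - a)); first by rewrite subr_gt0 gtrBl a0 lt_def eq_sym a1' a1.
rewrite (surjective_pairing z); congr pair => /=; rewrite /GRing.scale /=; lra.
Qed.

Lemma slit_map_inj z w : K z -> K w -> slit_map v c z = slit_map v c w -> z = w.
Proof.
move=> Kz Kw e.
have wlog_inj z' w' : K z' -> K w' -> z' <> v -> slit_map v c z' = slit_map v c w' -> z' = w'.
  move=> Kz' Kw' z'v e'; have := slit_map_gt0 Kz' z'v.
  move=> /parabolic_inj /(_ e') [h1 h2]; apply: W_inj.
  have [zc _] := Kz'; have [wc _] := Kw'.
  rewrite -(inversionK (W0 zc)) -(inversionK (W0 wc)); congr inversion.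
  rewrite [LHS]surjective_pairing [RHS]surjective_pairing; congr pair; last exact: h2.
  by move/addrI/oppr_inj: h1 => h1; exact: h1.
have [zv|/eqP zv] := eqVneq z v; last exact: wlog_inj.
have [wv|/eqP wv] := eqVneq w v; last exact/esym/wlog_inj.
by rewrite zv wv.
Qed.

Section Continuity.
Local Open Scope classical_set_scope.
Local Open Scope ring_scope.
Lemma slit_map_continuous z : z <> c -> {for z, continuous (slit_map v c)}.
Proof.
move=> zc; have N0 := gt_eqF (sqnorm_gt0 (W0 zc)).
have cf : (fun p : P => p.1) x @[x --> z] --> z.1 by exact: cvg_fst.
have cs : (fun p : P => p.2) x @[x --> z] --> z.2 by exact: cvg_snd.
have cst (k : R) : (fun _ : P => k) x @[x --> z] --> k by exact: cvg_cst.
have c1 : (fun p => (W p).1) x @[x --> z] --> (W z).1.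
  rewrite /W /cdiv /=; apply: cvgM; last exact: cst.
  by apply: cvgD; apply: cvgM => //; apply: cvgB.
have c2 : (fun p => (W p).2) x @[x --> z] --> (W z).2.
  rewrite /W /cdiv /=; apply: cvgM; last exact: cst.
  by apply: cvgB; apply: cvgM => //; apply: cvgB.
have cN : (fun p => ((W p).1 ^+ 2 + (W p).2 ^+ 2)^-1) x @[x --> z] --> ((W z).1 ^+ 2 + (W z).2 ^+ 2)^-1.
  by apply: cvgV; rewrite ?N0 //; apply: cvgD; apply: cvgM.
have cA : (fun p => 1 - (inversion (W p)).1) x @[x --> z] --> 1 - (inversion (W z)).1.
  by apply: cvgB; [exact: cst|rewrite /inversion /=; exact: cvgM].
have cB : (fun p => (inversion (W p)).2) x @[x --> z] --> (inversion (W z)).2.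
  by rewrite /inversion /=; exact: cvgM.
have cS : (fun p => Num.sqrt ((1 - (inversion (W p)).1) ^+ 2 + (inversion (W p)).2 ^+ 2)) x @[x --> z] -->
    Num.sqrt ((1 - (inversion (W z)).1) ^+ 2 + (inversion (W z)).2 ^+ 2).
  apply: continuous_cvg; first exact: sqrt_continuous.
  by apply: cvgD; apply: cvgM.
exact: (cvg_pair (cvgD cS cA) cB).
Qed.

End Continuity.
End SlitMap.

(** [slit_map] is applied to the free segment given by [accessible]; the drawing meets this segment
    only in [v], which becomes a boundary point. *)
Lemma normal_form (T : finType) (E : {set {set T}}) v : planar R E -> exists (pos : T -> P) (arc : {set T} -> R -> P),
  [/\ drawing E pos arc, pos v = (0, 0), forall u, u != v -> 0 < (pos u).1
    & forall e t, e \in E -> 0 < t < 1 -> 0 < (arc e t).1].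
Proof.
move=> /(accessible v) [pos [arc [c [d cv segv sege]]]].
have K1 u : pos u <> c /\ forall s, 0 < s < 1 -> pos u <> pos v + s *: (c - pos v).
  split=> [uc|s hs uc]; last by apply: (segv s u); [lra|].
  by apply: (segv 1 u); rewrite ?lexx ?ltr01 // scale1r subrKC uc.
have K2 e t : e \in E -> 0 <= t <= 1 ->
    arc e t <> c /\ forall s, 0 < s < 1 -> arc e t <> pos v + s *: (c - pos v).
  move=> eE ht; split=> [uc|s hs uc]; last by apply: (sege s e t) => //; lra.
  by apply: (sege 1 e t); rewrite ?lexx ?ltr01 // scale1r subrKC uc.
have := drawing_map d K1 K2 (slit_map_inj cv) (fun p Kp => slit_map_continuous cv Kp.1).
move=> d'; eexists; eexists; split; first exact: d'.
- exact: slit_map_apex.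
- by move=> u uv /=; apply: slit_map_gt0 => //; move=> /(dr_pos_inj d) /eqP; rewrite (negbTE uv).
- move=> e t eE ht /=; have ht' : 0 <= t <= 1 by lra.
  rewrite clamp_id //; apply: slit_map_gt0 => //; first exact: K2.
  exact: (dr_vertices d).
Qed.

End NormalForm.

Section PlanarOperations.
Local Open Scope ring_scope.
Variables (R : realType).
Notation P := (R * R)%type.
Local Notation subsetP := fintype.subsetP.

Lemma planar_sub (T : finType) (E E' : {set {set T}}) :
  E' \subset E -> planar R E -> planar R E'.
Proof.
move=> /subsetP sub /planar_drawing [pos [arc d]]; apply/planar_drawing; exists pos, arc; split.
- exact: (dr_pos_inj d).
- by move=> e /sub; exact: (dr_cont d).
- by move=> e /sub; exact: (dr_inj d).
- by move=> e /sub; exact: (dr_ends d).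
- by move=> e /sub; exact: (dr_vertices d).
- by move=> e f /sub eE /sub; exact: (dr_disjoint d).
Qed.

Section Mirror.
Local Open Scope classical_set_scope.
Local Open Scope ring_scope.
Lemma cont_mirror (f : R -> P) : continuous f -> continuous (fun t : R => (- (f t).1 - 1, (f t).2) : P).
Proof.
move=> cf t; apply: (@continuous_comp _ _ _ f (fun p : P => (- p.1 - 1, p.2) : P)); first exact: cf.
have c1 : (fun p : P => - p.1 - 1) x @[x --> f t] --> - (f t).1 - 1.
  by apply: cvgB; [apply: cvgN; exact: cvg_fst|exact: cvg_cst].
have c2 : (fun p : P => p.2) x @[x --> f t] --> (f t).2 by exact: cvg_snd.
exact: (cvg_pair c1 c2).
Qed.
End Mirror.

Lemma half_plane_arc (T : finType) (E : {set {set T}}) (pos : T -> P) arc v :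
  drawing E pos arc -> pos v = (0, 0) -> (forall u, u != v -> 0 < (pos u).1) ->
  (forall u, 0 <= (pos u).1).
Proof. by move=> d pv pu u; have [->|/pu/ltW//] := eqVneq u v; rewrite pv. Qed.

(* The two drawings are put in opposite half-planes, with [u] and [v] on the boundaries. *)
Lemma planar_join (T : finType) (E1 E2 : {set {set T}}) (A : {set T}) u v :
  (forall e, e \in E1 -> e \subset A) -> (forall e, e \in E2 -> e \subset ~: A) ->
  u \in A -> v \notin A -> planar R E1 -> planar R E2 ->
  planar R ([set u; v] |: (E1 :|: E2)).
Proof.
move=> sub1 sub2 uA vA /(normal_form u) [pos1 [arc1 [d1 p1u p1 a1]]]
  /(normal_form v) [pos2 [arc2 [d2 p2v p2 a2]]].
have q1 := half_plane_arc d1 p1u p1; have q2 := half_plane_arc d2 p2v p2.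
pose uv : {set T} := [set u; v].
have uv1 : uv \notin E1.
  by apply/negP => /sub1 /subsetP/(_ v); rewrite !inE eqxx orbT (negbTE vA) => /(_ isT).
have uv2 : uv \notin E2.
  by apply/negP => /sub2 /subsetP/(_ u); rewrite !inE eqxx uA => /(_ isT).
have neq e : e \in E1 -> e \in E2 -> False.
  move=> e1 e2; have [x [y [ee _ _]]] := dr_ends d1 e1.
  have /subsetP/(_ x) := sub1 _ e1; have /subsetP/(_ x) := sub2 _ e2.
  by rewrite ee !inE eqxx /= => /(_ isT) /negP h /(_ isT).
(* The first drawing is mirrored to abscissas at most -1, so [u] is at [(-1, 0)] and [v] at
   [(0, 0)]; the new arc is the segment between them, in an empty strip. *)
pose pos x : P := if x \in A then (- (pos1 x).1 - 1, (pos1 x).2) else pos2 x.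
pose arc e (t : R) : P := if e == uv then (t - 1, 0)
  else if e \in E1 then (- (arc1 e t).1 - 1, (arc1 e t).2) else arc2 e t.
have posA x : x \in A -> (pos x).1 <= -1 by move=> xA; rewrite /pos xA /=; have := q1 x; lra.
have posN x : x \notin A -> 0 <= (pos x).1 by move=> xA; rewrite /pos (negbTE xA).
have arcU t : arc uv t = (t - 1, 0) by rewrite /arc eqxx.
have arc1E e t : e \in E1 -> arc e t = (- (arc1 e t).1 - 1, (arc1 e t).2).
  by move=> eE; rewrite /arc eE; case: eqVneq => // h; rewrite -h eE in uv1.
have arc2E e t : e \in E2 -> arc e t = arc2 e t.
  move=> eE; rewrite /arc; case: eqVneq => [h|_]; first by rewrite -h eE in uv2.
  by case: ifP => // h; case: (neq e).
have b1 e t : e \in E1 -> 0 < t < 1 -> (arc e t).1 < -1.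
  by move=> eE ht; rewrite arc1E //=; have := a1 e t eE ht; lra.
have b2 e t : e \in E2 -> 0 < t < 1 -> 0 < (arc e t).1 by move=> eE ht; rewrite arc2E // a2.
have bU t : 0 < t < 1 -> -1 < (arc uv t).1 < 0 by move=> ht; rewrite arcU /=; lra.
have mir (p q : P) : (- p.1 - 1, p.2) = (- q.1 - 1, q.2) :> P -> p = q.
  by move=> [h1 h2]; rewrite (surjective_pairing p) (surjective_pairing q); congr pair; lra.
have cases e : e \in uv |: (E1 :|: E2) -> [\/ e = uv, e \in E1 | e \in E2].
  by rewrite !inE => /or3P[/eqP|?|?]; [constructor 1|constructor 2|constructor 3].
apply/planar_drawing; exists pos, arc; split.
- move=> x y e; have [xA|xA] := boolP (x \in A); have [yA|yA] := boolP (y \in A).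
  + by move: e; rewrite /pos xA yA => /mir; exact: (dr_pos_inj d1).
  + by exfalso; have := posA x xA; have := posN y yA; rewrite e; lra.
  + by exfalso; have := posN x xA; have := posA y yA; rewrite e; lra.
  + by move: e; rewrite /pos (negbTE xA) (negbTE yA); exact: (dr_pos_inj d2).
- move=> e /cases[->|eE|eE].
  + rewrite (_ : arc uv = fun t => (t - 1, 0)); last by apply/funext => t; rewrite arcU.
    apply: (@cont_pair R (fun t => t - 1) (fun=> 0)) => t; last exact: cvg_cst.
    by apply: cvgB; [exact: cvg_id|exact: cvg_cst].
  + rewrite (_ : arc e = fun t => (- (arc1 e t).1 - 1, (arc1 e t).2)); last by apply/funext => t; rewrite arc1E.
    exact: cont_mirror (dr_cont d1 eE).
  + rewrite (_ : arc e = arc2 e); last by apply/funext => t; rewrite arc2E.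
    exact: (dr_cont d2 eE).
- move=> e /cases[->|eE|eE] s t hs ht.
  + by rewrite !arcU => -[]; lra.
  + by rewrite !arc1E // => /mir; exact: (dr_inj d1).
  + by rewrite !arc2E //; exact: (dr_inj d2).
- move=> e /cases[->|eE|eE].
  + exists u, v; split=> //; first by rewrite arcU /pos uA p1u /= oppr0.
    by rewrite arcU /pos (negbTE vA) p2v subrr.
  + have [x [y [ee h0 h1]]] := dr_ends d1 eE; exists x, y; split=> //.
      by rewrite arc1E // h0 /pos (subsetP (sub1 _ eE)) // ee !inE eqxx.
    by rewrite arc1E // h1 /pos (subsetP (sub1 _ eE)) // ee !inE eqxx orbT.
  + have [x [y [ee h0 h1]]] := dr_ends d2 eE; exists x, y; split=> //.
      have := subsetP (sub2 _ eE) x; rewrite ee !inE eqxx -ee => /(_ isT) /negbTE xA.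
      by rewrite arc2E // h0 /pos xA.
    have := subsetP (sub2 _ eE) y; rewrite ee !inE eqxx orbT -ee => /(_ isT) /negbTE xA.
    by rewrite arc2E // h1 /pos xA.
- move=> e /cases[->|eE|eE] t ht x ex; have [xA|xA] := boolP (x \in A).
  + by have := bU t ht; have := posA x xA; rewrite ex; lra.
  + by have := bU t ht; have := posN x xA; rewrite ex; lra.
  + by move: ex; rewrite arc1E // /pos xA => /mir; exact: (dr_vertices d1).
  + by have := b1 e t eE ht; have := posN x xA; rewrite ex; lra.
  + by have := b2 e t eE ht; have := posA x xA; rewrite ex; lra.
  + by move: ex; rewrite arc2E // /pos (negbTE xA); exact: (dr_vertices d2).
- move=> e f /cases[->|eE|eE] /cases[->|fE|fE] ef s t hs ht eq.
  + by rewrite eqxx in ef.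
  + by have := bU s hs; have := b1 f t fE ht; rewrite eq; lra.
  + by have := bU s hs; have := b2 f t fE ht; rewrite eq; lra.
  + by have := b1 e s eE hs; have := bU t ht; rewrite eq; lra.
  + by move: eq; rewrite !arc1E // => /mir; exact: (dr_disjoint d1).
  + by have := b1 e s eE hs; have := b2 f t fE ht; rewrite eq; lra.
  + by have := b2 e s eE hs; have := bU t ht; rewrite eq; lra.
  + by have := b1 f t fE ht; have := b2 e s eE hs; rewrite eq; lra.
  + by move: eq; rewrite !arc2E //; exact: (dr_disjoint d2).
Qed.

(** Leaves the points of negative abscissa free for further vertices. *)
Lemma planar_half_plane (T : finType) (E : {set {set T}}) : planar R E ->
  exists (pos : T -> P) (arc : {set T} -> R -> P), [/\ drawing E pos arc,
    forall u, 0 <= (pos u).1 & forall e t, e \in E -> 0 < t < 1 -> 0 <= (arc e t).1].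
Proof.
move=> pE; have [v _|noT] := pickP (@predT T).
  have [pos [arc [d pv pu ha]]] := normal_form v pE; exists pos, arc; split=> //.
    exact: half_plane_arc d pv pu.
  by move=> e t eE ht; exact/ltW/ha.
have /planar_drawing[pos [arc d]] := pE; exists pos, arc; split=> // [u|e t eE]; first by have := noT u.
by have [x _] := dr_ends d eE; have := noT x.
Qed.

Lemma planar_relabel (T T' : finType) (f : T -> T') (E : {set {set T}}) :
  injective f -> planar R E -> planar R [set f @: (e : {set T}) | e in E].
Proof.
move=> finj /planar_half_plane [pos [arc [d p0 a0]]].
pose g (e : {set T'}) : {set T} := f @^-1: e.
have gK (e : {set T}) : g (f @: e) = e.
  by apply/setP => x; rewrite inE mem_imset.
pose pos' y : P := if [pick x | f x == y] is Some x then pos x else (- (enum_rank y).+1%:R, 0).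
have posf x : pos' (f x) = pos x.
  rewrite /pos'; case: pickP => [x' /eqP/finj -> //|/(_ x)]; by rewrite eqxx.
have posn y : (exists x, y = f x) \/ pos' y = (- (enum_rank y).+1%:R, 0).
  by rewrite /pos'; case: pickP => [x /eqP <-|_]; [left; exists x|right].
apply/planar_drawing; exists pos', (fun e => arc (g e)); split.
- have neg (n : nat) : 0 <= - n.+1%:R :> R -> False by rewrite oppr_ge0 leNgt ltr0n.
  move=> y y' e; case: (posn y) => [[x ex]|hy]; case: (posn y') => [[x' ex']|hy']; subst.
  + by move: e; rewrite !posf => /(dr_pos_inj d) ->.
  + by case: (neg (enum_rank y')); rewrite -[X in 0 <= X]/(- (enum_rank y').+1%:R, 0 : R).1 -hy' -e posf.
  + by case: (neg (enum_rank y)); rewrite -[X in 0 <= X]/(- (enum_rank y).+1%:R, 0 : R).1 -hy e posf.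
  + by move: e; rewrite hy hy' => -[] /oppr_inj /eqP; rewrite eqr_nat eqSS => /eqP/val_inj/enum_rank_inj.
- by move=> _ /imsetP[e eE ->]; rewrite gK; exact: (dr_cont d).
- by move=> _ /imsetP[e eE ->]; rewrite gK; exact: (dr_inj d).
- move=> _ /imsetP[e eE ->]; rewrite gK; have [x [y [ee h0 h1]]] := dr_ends d eE.
  by exists (f x), (f y); rewrite !posf ee imsetU1 imset_set1 -ee.
- move=> _ /imsetP[e eE ->] t ht y; rewrite gK; case: (posn y) => [[x ->]|hy].
    by rewrite posf; exact: (dr_vertices d).
  move=> h; have := a0 e t eE ht; rewrite h hy /= oppr_ge0 leNgt ltr0n; by [].
- move=> _ _ /imsetP[e eE ->] /imsetP[e' e'E ->] ne; rewrite !gK.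
  by apply: (dr_disjoint d) => //; apply: contraNneq ne => ->.
Qed.

End PlanarOperations.

Section Suppress.
Local Open Scope ring_scope.
Variables (R : realType) (T : finType).
Notation P := (R * R)%type.

(** The two arcs at [w] are concatenated. The new arc runs through the old place of [w], so [w] is
    moved to [(-1, 0)], outside the half-plane that contains the drawing. *)
Lemma planar_suppress (E : {set {set T}}) (u v w : T) :
  u != v -> [set u; w] \in E -> [set w; v] \in E -> [set u; v] \notin E ->
  (forall e, e \in E -> w \in e -> e = [set u; w] \/ e = [set w; v]) ->
  planar R E -> planar R ([set u; v] |: (E :\ [set u; w] :\ [set w; v])).
Proof.
move=> uv uwE wvE uvE deg2 /planar_half_plane [pos [arc0 [d0 p0 a0]]].
have [arc [d orient sameimg]] := drawing_orient w d0.
pose euw : {set T} := [set u; w]; pose ewv : {set T} := [set w; v]; pose euv : {set T} := [set u; v].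
have other e x y : drawing E pos arc -> e \in E -> e = [set x; y] -> arc e 0 = pos x -> arc e 1 = pos y.
  move=> _ eE exy h0; have [a [b [eab ha hb]]] := dr_ends d eE.
  have ax : a = x by apply: (dr_pos_inj d); rewrite -ha.
  rewrite hb; congr pos; subst a.
  have : b \in [set x; y] by rewrite -exy eab !inE eqxx orbT.
  rewrite !inE => /orP[/eqP bx|/eqP //]; exfalso.
  by apply: (dr_ends_neq d eE); rewrite ha hb bx.
have A0 : arc euw 0 = pos w by apply: orient => //; rewrite !inE eqxx orbT.
have B0 : arc ewv 0 = pos w by apply: orient => //; rewrite !inE eqxx.
have A1 : arc euw 1 = pos u by apply: (other _ w u d uwE) => //; rewrite finset.setUC.
have B1 : arc ewv 1 = pos v by exact: (other _ w v d wvE).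
have uw : u != w by apply: contraTneq uwE => uw; apply/negP => h; apply: (dr_ends_neq d h); rewrite -/euw A0 A1 uw.
have wv : w != v by apply: contraTneq wvE => wv; apply/negP => h; apply: (dr_ends_neq d h); rewrite -/ewv B0 B1 wv.
have nEE : euw != ewv.
  by apply/eqP => /setP/(_ u); rewrite !inE eqxx (negbTE uw) (negbTE uv).
pose F := E :\ euw :\ ewv.
have FE e : e \in F -> [/\ e \in E, e != euw & e != ewv] by rewrite !inE => /and3P[].
have euvF : euv \notin F by apply/negP => /FE[]; rewrite (negbTE uvE).
have wF e : e \in F -> w \notin e.
  by move=> /FE[eE n1 n2]; apply/negP => we; case: (deg2 e eE we) => h; [move: n1|move: n2]; rewrite h eqxx.
(* On each half of [[0, 1]] one of the clamped parameters is 0, where both arcs are at [pos w]; the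
   sum is then the other arc. *)
pose na (t : R) : P := arc euw (clamp (1 - 2 * t)) + (arc ewv (clamp (2 * t - 1)) - pos w).
have nlo (t : R) : 0 <= t <= 2^-1 -> na t = arc euw (1 - 2 * t).
  move=> ht; rewrite /na [clamp (1 - _)]clamp_id; last lra.
  have -> : clamp (2 * t - 1) = 0 by rewrite /clamp (min_idPr _) ?(max_idPl _) //; lra.
  by rewrite B0 subrr addr0.
have nhi t : 2^-1 <= t <= 1 -> na t = arc ewv (2 * t - 1).
  move=> ht; rewrite /na [clamp (2 * t - 1)]clamp_id; last lra.
  have -> : clamp (1 - 2 * t) = 0 by rewrite /clamp (min_idPr _) ?(max_idPl _) //; lra.
  by rewrite A0 addrC subrK.
have half (t : R) : 0 <= t <= 1 -> (0 <= t <= 2^-1) \/ (2^-1 < t <= 1).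
  by move=> ht; case: (leP t 2^-1) => h; [left|right]; lra.
pose pos' x : P := if x == w then (-1, 0) else pos x.
pose arc' (e : {set T}) := if e == euv then na else arc e.
have arcF e : e \in F -> arc' e = arc e.
  by move=> eF; rewrite /arc'; case: eqVneq => // h; rewrite -h eF in euvF.
have nonneg e (t : R) : e \in E -> 0 <= t <= 1 -> 0 <= (arc e t).1.
  move=> eE ht; case: (dr_endpoint d eE ht) => [h|[x _ ->//]].
  have h' : 0 < 1 - t < 1 by lra.
  by case: (sameimg e t) => ->; exact: a0.
have nann (t : R) : 0 <= t <= 1 -> 0 <= (na t).1.
  by move=> ht; case: (half t ht) => h; [rewrite nlo //|rewrite nhi; last lra]; apply: nonneg => //; lra.
have AE (t : R) : 0 < t < 1 -> (exists e s, [/\ e \in E, e = euw \/ e = ewv, 0 < s < 1 & na t = arc e s]) \/ na t = pos w.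
  move=> ht; have [t1|t1] := ltP t 2^-1.
    by left; exists euw, (1 - 2 * t); rewrite nlo; [split; auto; lra|lra].
  have [t2|t2] := eqVneq t 2^-1.
    by right; rewrite nlo; [rewrite t2 -A0; congr (arc _ _); lra|lra].
  have t3 : 2^-1 < t by rewrite lt_def t2.
  by left; exists ewv, (2 * t - 1); rewrite nhi; [split; auto; lra|lra].
have cases e : e \in euv |: F -> e = euv \/ e \in F.
  by rewrite !inE => /orP[/eqP|]; auto.
apply/planar_drawing; exists pos', arc'; split.
- have neg x : pos x <> (-1, 0) by move=> h; have := p0 x; rewrite h /=; lra.
  move=> x y; rewrite /pos'; case: eqVneq => [->|xw]; case: eqVneq => [->|yw] //.
  + by move/esym/neg.
  + by move/neg.
  + exact: (dr_pos_inj d).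
- move=> e /cases[->|eF]; last by rewrite arcF //; case: (FE _ eF) => eE _ _; exact: (dr_cont d).
  rewrite /arc' eqxx; apply: cont_add.
    apply: (@continuous_lip R (arc euw) (fun t => clamp (1 - 2 * t)) 2); last exact: (dr_cont d).
    move=> t s; apply: le_trans (clamp_lip _ _) _.
    have -> : 1 - 2 * t - (1 - 2 * s) = 2 * (s - t) by ring.
    by rewrite normrM ger0_norm ?ler0n // distrC.
  apply: (@cont_add R (fun t => arc ewv (clamp (2 * t - 1))) (fun=> - pos w)).
    apply: (@continuous_lip R (arc ewv) (fun t => clamp (2 * t - 1)) 2); last exact: (dr_cont d).
    move=> t s; apply: le_trans (clamp_lip _ _) _.
    have -> : 2 * t - 1 - (2 * s - 1) = 2 * (t - s) by ring.
    by rewrite normrM ger0_norm ?ler0n.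
  by move=> t; exact: cvg_cst.
- move=> e /cases[->|eF] s t hs ht; last first.
    by rewrite arcF //; case: (FE _ eF) => eE _ _; exact: (dr_inj d).
  rewrite /arc' eqxx; case: (half s hs) => h1; case: (half t ht) => h2.
  + rewrite !nlo // => /(dr_inj d uwE) h.
    have {}h : 1 - 2 * s = 1 - 2 * t by apply: h; clear -h1 h2 hs ht; lra.
    by clear -h; lra.
  + rewrite nlo // nhi; last lra.
    have [s0|s0] := eqVneq s 2^-1.
      have -> : 1 - 2 * s = 0 by clear -s0; lra.
      rewrite A0 -B0 => /(dr_inj d wvE) h.
      have {}h : 0 = 2 * t - 1 by apply: h; clear -h2 ht; lra.
      by clear -h s0; lra.
    have s1 : s < 2^-1 by rewrite lt_def eq_sym s0; case/andP: h1.
    have [t0|t0] := eqVneq t 1.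
      have -> : 2 * t - 1 = 1 by clear -t0; lra.
      rewrite B1 => h; exfalso.
      have [s2|s2] := eqVneq s 0.
        move: h; have -> : 1 - 2 * s = 1 by clear -s2; lra.
        by rewrite A1 => /(dr_pos_inj d)/eqP; rewrite (negbTE uv).
      have s3 : 0 < s by rewrite lt_def s2; case/andP: hs.
      by apply: (dr_vertices d uwE _ h); clear -s1 s3; lra.
    have t1 : t < 1 by rewrite lt_def eq_sym t0; case/andP: ht.
    have [s2|s2] := eqVneq s 0.
      have -> : 1 - 2 * s = 1 by clear -s2; lra.
      by rewrite A1 => /esym h; exfalso; apply: (dr_vertices d wvE _ h); clear -h2 t1; lra.
    have s3 : 0 < s by rewrite lt_def s2; case/andP: hs.
    by move=> h; exfalso; apply: (dr_disjoint d uwE wvE nEE _ _ h); clear -s1 s3 h2 t1; lra.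
  + rewrite nhi; last lra. rewrite nlo //.
    have [s0|s0] := eqVneq t 2^-1.
      have -> : 1 - 2 * t = 0 by clear -s0; lra.
      rewrite A0 -B0 => /(dr_inj d wvE) h.
      have {}h : 2 * s - 1 = 0 by apply: h; clear -h1 hs; lra.
      by clear -h s0; lra.
    have s1 : t < 2^-1 by rewrite lt_def eq_sym s0; case/andP: h2.
    have [t0|t0] := eqVneq s 1.
      have -> : 2 * s - 1 = 1 by clear -t0; lra.
      rewrite B1 => /esym h; exfalso.
      have [s2|s2] := eqVneq t 0.
        move: h; have -> : 1 - 2 * t = 1 by clear -s2; lra.
        by rewrite A1 => /(dr_pos_inj d)/eqP; rewrite (negbTE uv).
      have s3 : 0 < t by rewrite lt_def s2; case/andP: ht.
      by apply: (dr_vertices d uwE _ h); clear -s1 s3; lra.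
    have t1 : s < 1 by rewrite lt_def eq_sym t0; case/andP: hs.
    have [s2|s2] := eqVneq t 0.
      have -> : 1 - 2 * t = 1 by clear -s2; lra.
      by rewrite A1 => h; exfalso; apply: (dr_vertices d wvE _ h); clear -h1 t1; lra.
    have s3 : 0 < t by rewrite lt_def s2; case/andP: ht.
    by move=> /esym h; exfalso; apply: (dr_disjoint d uwE wvE nEE _ _ h); clear -s1 s3 h1 t1; lra.
  + have [h1' h2'] : 2^-1 <= s <= 1 /\ 2^-1 <= t <= 1 by clear -h1 h2 hs ht; lra.
    rewrite !nhi // => /(dr_inj d wvE) h.
    have {}h : 2 * s - 1 = 2 * t - 1 by apply: h; clear -h1' h2'; lra.
    by clear -h; lra.
- move=> e /cases[->|eF].
    have n0 : na 0 = pos u by rewrite nlo; [rewrite -A1; congr (arc _ _); clear; lra|clear; lra].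
    have n1 : na 1 = pos v by rewrite nhi; [rewrite -B1; congr (arc _ _); clear; lra|clear; lra].
    by exists u, v; rewrite /arc' eqxx /pos' (negbTE uw) eq_sym (negbTE wv).
  have [eE _ _] := FE _ eF; have [x [y [ee h0 h1]]] := dr_ends d eE; have := wF _ eF.
  rewrite ee !inE negb_or => /andP[xw yw]; exists x, y.
  by rewrite -ee arcF // h0 h1 /pos' eq_sym (negbTE xw) eq_sym (negbTE yw).
- have npos z : 0 <= z.1 -> forall x, (x != w -> z <> pos x) -> z <> pos' x.
    move=> z0 x hx; rewrite /pos'; case: eqVneq => [_|/hx//] h.
    by move: z0; rewrite h /=; lra.
  move=> e /cases[->|eF] t ht x.
    rewrite /arc' eqxx; apply: npos; first by apply: nann; lra.
    move=> xw; case: (AE t ht) => [[e' [s [e'E _ hs ->]]]|->]; first exact: (dr_vertices d).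
    by move=> /(dr_pos_inj d) h; rewrite h eqxx in xw.
  have [eE _ _] := FE _ eF; rewrite arcF //; apply: npos; first by apply: nonneg => //; lra.
  by move=> _; exact: (dr_vertices d).
- have key e (s t : R) : e \in F -> 0 < s < 1 -> 0 < t < 1 -> arc e s <> na t.
    move=> eF hs ht; have [eE n1 n2] := FE _ eF.
    case: (AE t ht) => [[e' [s' [e'E h hs' ->]]]|->]; last exact: (dr_vertices d).
    by apply: (dr_disjoint d) => //; case: h => ->.
  move=> e f /cases[->|eF] /cases[->|fF] ef s t hs ht.
  + by rewrite eqxx in ef.
  + by rewrite (arcF f) // /arc' eqxx; apply/nesym; exact: key.
  + by rewrite (arcF e) // /arc' eqxx; exact: key.
  + by rewrite !arcF //; apply: (dr_disjoint d) => //; [case: (FE _ eF)|case: (FE _ fF)].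
Qed.

End Suppress.

Section StraightLine.
Local Open Scope ring_scope.
Variables (R : realType) (T : finType).

Lemma planar_straight (E : {set {set T}}) (pos : T -> R * R) (ends : {set T} -> T * T) :
  injective pos ->
  (forall e, e \in E -> e = [set (ends e).1; (ends e).2] /\ (ends e).1 <> (ends e).2) ->
  (forall e t v, e \in E -> 0 < t < 1 -> lerp (pos (ends e).1) (pos (ends e).2) t <> pos v) ->
  (forall e f s t, e \in E -> f \in E -> 0 < s < 1 -> 0 < t < 1 ->
    lerp (pos (ends e).1) (pos (ends e).2) s = lerp (pos (ends f).1) (pos (ends f).2) t ->
    ends e = ends f) ->
  planar R E.
Proof.
move=> pinj hends hv hd; apply/planar_drawing.
exists pos, (fun e => lerp (pos (ends e).1) (pos (ends e).2)); split=> //.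
- move=> e eE; set a := pos _; set b := pos _.
  rewrite (_ : lerp a b = fun t => a + t *: (b.1 - a.1, b.2 - a.2)); last by [].
  exact: cont_affine.
- move=> e eE s t _ _ [h1 h2]; have [_ ne] := hends e eE.
  have [e1|e1] := eqVneq (pos (ends e).2).1 (pos (ends e).1).1; last first.
    by move: h1 => /addrI /mulIf; apply; rewrite subr_eq0.
  have [e2|e2] := eqVneq (pos (ends e).2).2 (pos (ends e).1).2; last first.
    by move: h2 => /addrI /mulIf; apply; rewrite subr_eq0.
  exfalso; apply: ne; apply: pinj; rewrite (surjective_pairing (pos (ends e).1)).
  by rewrite (surjective_pairing (pos (ends e).2)) e1 e2.
- move=> e eE; have [ee _] := hends e eE; exists (ends e).1, (ends e).2.
  by split; [exact: ee|exact: lerp0|exact: lerp1].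
- by move=> e eE t ht v; exact: hv.
- move=> e f eE fE ef s t hs ht h; move/negP: ef; apply; apply/eqP.
  have [ee _] := hends e eE; have [ff _] := hends f fE.
  by rewrite [LHS]ee [RHS]ff (hd e f s t eE fE hs ht h).
Qed.

End StraightLine.

(** * Connected planar graphs with a prescribed number of edges *)

Section DoubleFan.
Local Open Scope nat_scope.
Variable k : nat.
Local Notation T := 'I_k.+3.
Local Notation subsetP := fintype.subsetP.

(** The vertices 0 and 1 are joined to all vertices of the path [2, 3, ..., k + 2]. With the path on
    the vertical axis and 0, 1 on either side, this is drawn with straight edges. *)
Definition fan_pair (p : T * T) : bool :=
  ((p.1 < 2) && (2 <= p.2)) || ((2 <= p.1) && (p.2 == p.1.+1 :> nat)).

Definition double_fan : {set {set T}} := [set [set p.1; p.2] | p in [set p | fan_pair p]].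

Lemma fan_pair_lt p : fan_pair p -> p.1 < p.2.
Proof.
case: p => a b; rewrite /fan_pair /= => /orP[/andP[h1 h2]|/andP[_ /eqP ->]] //.
exact: leq_trans h1 h2.
Qed.

Lemma fan_pair_inj p q : fan_pair p -> fan_pair q -> [set p.1; p.2] = [set q.1; q.2] -> p = q.
Proof.
case: p q => a b [c d] /fan_pair_lt /= ab /fan_pair_lt /= cd /setP e.
have := e a; have := e b; have := e c; have := e d; rewrite !inE !eqxx ?orbT.
move=> /orP[]/eqP h1 /orP[]/eqP h2 /esym/orP[]/eqP h3 /esym/orP[]/eqP h4; subst => //;
  by move: ab cd; rewrite ?ltnn // => h h'; have := ltn_trans h h'; rewrite ltnn.
Qed.

Local Open Scope ring_scope.
Variable R : realType.

Definition fan_pos (i : T) : R * R :=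
  if (i == 0 :> nat)%N then (-1, 0) else if (i == 1 :> nat)%N then (1, 0) else (0, (i : nat)%:R).

Definition fan_ends (e : {set T}) : T * T :=
  odflt (ord0, ord0) [pick p | fan_pair p && (e == [set p.1; p.2])].

Lemma fan_endsP e : e \in double_fan -> fan_pair (fan_ends e) /\ e = [set (fan_ends e).1; (fan_ends e).2].
Proof.
move=> /imsetP[p]; rewrite inE => fp ->; rewrite /fan_ends.
case: pickP => [q /andP[? /eqP //]|/(_ p)]; by rewrite fp eqxx.
Qed.

Lemma fan_lerp p (t : R) : fan_pair p -> lerp (fan_pos p.1) (fan_pos p.2) t =
  if (p.1 == 0 :> nat)%N then (t - 1, t * (p.2 : nat)%:R) else
  if (p.1 == 1 :> nat)%N then (1 - t, t * (p.2 : nat)%:R) else (0, (p.1 : nat)%:R + t).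
Proof.
case: p => a b; rewrite /fan_pair /=; set na := nat_of_ord a; set nb := nat_of_ord b.
rewrite /fan_pos -/na -/nb => /orP[/andP[h1 h2]|/andP[h1 /eqP h2]].
  have -> : (nb == 0)%N = false by case: nb h2 => [|[]].
  have -> : (nb == 1)%N = false by case: nb h2 => [|[]].
  by case: na h1 => [|[|//]] _ /=; rewrite /lerp /=; congr pair; ring.
have -> : (na == 0)%N = false by case: na h1 {h2} => [|[]].
have -> : (na == 1)%N = false by case: na h1 {h2} => [|[]].
rewrite h2; have -> : (na.+1 == 1)%N = false by case: na h1 {h2} => [|[]].
by rewrite /lerp /= -natr1; congr pair; ring.
Qed.

Lemma natr_shift_inj (a b : nat) (s t : R) : 0 < s < 1 -> 0 <= t < 1 -> a%:R + s = b%:R + t -> a = b /\ s = t.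
Proof.
move=> hs ht h; have [ab|ba|ab] := ltngtP a b.
- by move: ab; rewrite -(ler_nat R) -natr1; lra.
- by move: ba; rewrite -(ler_nat R) -natr1; lra.
- by split=> //; rewrite ab in h; lra.
Qed.

Lemma double_fan_planar : planar R double_fan.
Proof.
have pos_ge2 (i : T) : (2 <= i)%N -> fan_pos i = (0, (i : nat)%:R).
  by rewrite /fan_pos; case: (nat_of_ord i) => [|[|]].
apply: (@planar_straight R T double_fan fan_pos fan_ends).
- move=> i j; rewrite /fan_pos; have [i0|i0] := eqVneq (i : nat) 0%N; have [j0|j0] := eqVneq (j : nat) 0%N.
  + by move=> _; apply: val_inj; rewrite /= i0 j0.
  + by case: ifP => _ [h *]; exfalso; clear -h; lra.
  + by case: ifP => _ [h *]; exfalso; clear -h; lra.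
  have [i1|i1] := eqVneq (i : nat) 1%N; have [j1|j1] := eqVneq (j : nat) 1%N.
  + by move=> _; apply: val_inj; rewrite /= i1 j1.
  + by move=> [h *]; exfalso; clear -h; lra.
  + by move=> [h *]; exfalso; clear -h; lra.
  by move=> [] /eqP; rewrite eqr_nat => /eqP/val_inj.
- move=> e eE; have [fp ee] := fan_endsP eE; split=> // h.
  by have := fan_pair_lt fp; rewrite h ltnn.
- move=> e t v eE ht; have [fp _] := fan_endsP eE; rewrite fan_lerp //.
  case: (fan_ends e) fp => a b fp /=; rewrite /fan_pos.
  case: ifP => a0; [|case: ifP => a1]; (case: ifP => v0; [|case: ifP => v1]) => /pair_equal_spec[h1 h]; try (exfalso; lra).
  by have [] := @natr_shift_inj a v t 0 ht; rewrite ?lexx ?ltr01 ?addr0 //; lra.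
- move=> e f s t eE fE hs ht; have [fp ee] := fan_endsP eE; have [fq ef] := fan_endsP fE.
  rewrite !fan_lerp //; move: fp fq; case: (fan_ends e) => a b; case: (fan_ends f) => c d /= fp fq.
  case: ifP => a0; [|case: ifP => a1]; (case: ifP => c0; [|case: ifP => c1]) => /pair_equal_spec[h1 h2]; try (exfalso; lra).
  + have st : s = t by lra.
    have /mulfI : s != 0 by rewrite gt_eqF; lra.
    move: h2; rewrite -st => h2 /(_ _ _ h2)/eqP; rewrite eqr_nat => /eqP/val_inj ->.
    by congr pair; apply: val_inj; rewrite /= (eqP a0) (eqP c0).
  + have st : s = t by lra.
    have /mulfI : s != 0 by rewrite gt_eqF; lra.
    move: h2; rewrite -st => h2 /(_ _ _ h2)/eqP; rewrite eqr_nat => /eqP/val_inj ->.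
    by congr pair; apply: val_inj; rewrite /= (eqP a1) (eqP c1).
  + have [|ac _] := natr_shift_inj hs _ h2; first by case/andP: ht => /ltW -> ->.
    have eac : a = c by apply: val_inj.
    subst c; congr pair; apply: val_inj => /=.
    have lt2 : (a < 2)%N = false by move: a0 a1; case: (nat_of_ord a) => [|[|]].
    by move: fp fq; rewrite /fan_pair /= lt2 /= => /andP[_ /eqP ->] /andP[_ /eqP ->].
Qed.

Local Open Scope nat_scope.

Lemma card_double_fan : 3 * k + 2 <= #|double_fan|.
Proof.
rewrite card_in_imset; last by move=> p q; rewrite !inE; exact: fan_pair_inj.
pose F (s : 'I_k.+1 + ('I_k.+1 + 'I_k)) : T * T :=
  match s with
  | inl i => (inord 0, inord (i + 2))
  | inr (inl i) => (inord 1, inord (i + 2))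
  | inr (inr i) => (inord (i + 2), inord (i + 3))
  end.
have inj : injective F.
  move=> x y /(congr1 (fun p : T * T => (nat_of_ord p.1, nat_of_ord p.2))).
  case: x => [x|[x|x]]; case: y => [y|[y|y]] /=;
    have := ltn_ord x; have := ltn_ord y => hy hx; rewrite !inordK; try lia;
    move=> [] => *; try (exfalso; lia); by repeat congr (_ _); apply: val_inj => /=; lia.
have -> : 3 * k + 2 = #|[set: 'I_k.+1 + ('I_k.+1 + 'I_k)]|.
  by rewrite finset.cardsT !card_sum !card_ord; lia.
rewrite -(card_imset _ inj); apply/subset_leq_card/subsetP => _ /imsetP[x _ ->]; rewrite inE.
by case: x => [x|[x|x]]; have hx := ltn_ord x; rewrite /fan_pair /= !inordK; lia.
Qed.

Definition fan_tree : {set {set T}} :=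
  [set inord 1; inord 2] |: [set [set (ord0 : T); inord (i + 2)] | i : 'I_k.+1].

Lemma fan_tree_sub : fan_tree \subset double_fan.
Proof.
apply/subsetP => e; rewrite !inE => /orP[/eqP->|/imsetP[i _ ->]]; apply/imsetP.
  by exists (inord 1, inord 2) => //; rewrite inE /fan_pair /= !inordK.
exists (ord0, inord (i + 2)) => //; have := ltn_ord i => hi.
by rewrite inE /fan_pair /= inordK; lia.
Qed.

Lemma card_fan_tree : #|fan_tree| <= k.+2.
Proof.
apply: leq_trans (leq_card_setU _ _).1 _; rewrite cards1 add1n ltnS.
by apply: leq_trans (leq_imset_card _ _) _; rewrite card_ord.
Qed.

Lemma fan_tree_connected (E : {set {set T}}) x y : fan_tree \subset E -> connect (edge_rel E) x y.
Proof.
move=> /subsetP sub; have cs := sym_connect_sym (@edge_rel_sym _ E).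
have star (z : T) : 2 <= z -> connect (edge_rel E) z ord0.
  move=> z2; rewrite cs; apply: connect1; rewrite /edge_rel; apply/andP; split.
    by apply: contraTneq z2 => <-.
  apply: sub; rewrite !inE; apply/orP; right; apply/imsetP.
  have hz : z - 2 < k.+1 by have := ltn_ord z; lia.
  exists (Ordinal hz) => //=; congr [set _; _]; apply: val_inj => /=; rewrite inordK //; have := ltn_ord z; lia.
have toz (z : T) : connect (edge_rel E) z ord0.
  case: (leqP 2 z) => [/star //|z2].
  have [z0|z1] := eqVneq z ord0; first by rewrite z0.
  have z1E : z = inord 1.
    apply: val_inj; rewrite /= inordK //; move: z1 z2; rewrite -val_eqE /=; case: (nat_of_ord z) => [|[|]] //.
  apply: (@connect_trans _ _ (inord 2)); last by apply: star; rewrite inordK.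
  apply: connect1; rewrite /edge_rel z1E; apply/andP; split; first by rewrite -val_eqE /= !inordK.
  by apply: sub; rewrite !inE eqxx.
by apply: connect_trans (toz x) _; rewrite cs.
Qed.

End DoubleFan.

Lemma subset_interpolate (T : finType) (A B : {set T}) m : A \subset B -> (#|A| <= m <= #|B|)%N ->
  exists C : {set T}, [/\ A \subset C, C \subset B & #|C| = m].
Proof.
move=> AB; move: {2}(m - #|A|)%N (erefl (m - #|A|)%N) => d; elim: d A AB => [|d IH] A AB dE /andP[Am mB].
  by exists A; split=> //; lia.
have : ~~ (B \subset A) by apply: contraTN mB => /subset_leq_card; rewrite -ltnNge; lia.
move=> /fintype.subsetPn[x xB xA].
have cA : #|x |: A| = #|A|.+1 by rewrite cardsU1 xA.
have [|||C [xC CB cC]] := IH (x |: A).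
- by rewrite finset.subUset finset.sub1set xB.
- by rewrite cA; lia.
- by rewrite cA; lia.
by exists C; split=> //; apply: fintype.subset_trans xC; exact: finset.subsetUr.
Qed.

(** Any edge set between the spanning tree [fan_tree] and [double_fan] is connected and planar. *)
Lemma connected_planar_exists (R : realType) n m : (3 <= n)%N -> (n.-1 <= m <= 3 * n - 7)%N ->
  exists E : {set {set 'I_n}}, [/\ simple_graph E, #|E| = m, planar R E &
    forall x y, connect (edge_rel E) x y].
Proof.
case: n => [|[|[|k]]] // _ /andP[m1 m2].
have [C [tC Cf cC]] : exists C : {set {set 'I_k.+3}}, [/\ fan_tree k \subset C, C \subset double_fan k & #|C| = m].
  apply: subset_interpolate; first exact: fan_tree_sub.
  by have := card_fan_tree k; have := card_double_fan k; move: m1 m2 => /=; lia.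
exists C; split=> //.
- apply/forall_inP => e eC; have /imsetP[p] := fintype.subsetP Cf e eC; rewrite inE => /fan_pair_lt lt ->.
  by rewrite cards2 -val_eqE neq_ltn lt.
- exact: planar_sub Cf (double_fan_planar k R).
- by move=> x y; exact: fan_tree_connected.
Qed.

(** * Connected graphs and components *)

Section DoubleCounting.
Local Open Scope nat_scope.

(* [x] and [i] are recovered from [F x i] and the label [G x i]. *)
Lemma double_counting (U V I J : finType) (X : {set U}) (Y : {set V})
    (M : U -> {set I}) (L : V -> {set J}) (F : U -> I -> V) (G : U -> I -> J) a b :
  (forall x, x \in X -> a <= #|M x|) ->
  (forall y, y \in Y -> #|L y| <= b) ->
  (forall x i, x \in X -> i \in M x -> F x i \in Y /\ G x i \in L (F x i)) ->
  (forall x i x' i', x \in X -> i \in M x -> x' \in X -> i' \in M x' ->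
    F x i = F x' i' -> G x i = G x' i' -> x = x' /\ i = i') ->
  #|X| * a <= #|Y| * b.
Proof.
move=> hM hL hF hinj.
pose S := [set p : U * I | (p.1 \in X) && (p.2 \in M p.1)].
pose S' := [set p : V * J | (p.1 \in Y) && (p.2 \in L p.1)].
have cS : #|S| = \sum_(x in X) #|M x|.
  rewrite -sum1_card (eq_bigl (fun p => (p.1 \in X) && (p.2 \in M p.1))); last by move=> p; rewrite inE.
  by rewrite -(pair_big_dep (mem X) (fun x i => i \in M x) (fun _ _ => 1)) /=; apply: eq_bigr => x _; rewrite sum1_card.
have cS' : #|S'| = \sum_(x in Y) #|L x|.
  rewrite -sum1_card (eq_bigl (fun p => (p.1 \in Y) && (p.2 \in L p.1))); last by move=> p; rewrite inE.
  by rewrite -(pair_big_dep (mem Y) (fun x i => i \in L x) (fun _ _ => 1)) /=; apply: eq_bigr => x _; rewrite sum1_card.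
apply: leq_trans (_ : #|S| <= _); first by rewrite cS -sum_nat_const; apply: leq_sum.
apply: leq_trans (_ : #|S'| <= _); last by rewrite cS' -sum_nat_const; apply: leq_sum.
rewrite -(@card_in_imset _ _ (fun p : U * I => (F p.1 p.2, G p.1 p.2)) (mem S)).
  apply/subset_leq_card/fintype.subsetP => _ /imsetP[[x i] + ->]; rewrite !inE /= => /andP[xX iM].
  by have [-> ->] := hF x i xX iM.
move=> [x i] [x' i']; rewrite !inE /= => /andP[xX iM] /andP[xX' iM'] [h1 h2].
by have [-> ->] := hinj x i x' i' xX iM xX' iM' h1 h2.
Qed.

End DoubleCounting.

Section GraphMaps.
Local Open Scope nat_scope.
Local Notation subsetP := fintype.subsetP.

Definition gmap (T T' : finType) (f : T -> T') (E : {set {set T}}) : {set {set T'}} :=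
  [set f @: (e : {set T}) | e in E].

Lemma simple_graphP (T : finType) (E : {set {set T}}) :
  reflect (forall e, e \in E -> #|e| = 2) (simple_graph E).
Proof. by apply: (iffP forall_inP) => h e eE; apply/eqP; exact: h. Qed.

Lemma simple_edgeE (T : finType) (E : {set {set T}}) x y : simple_graph E ->
  ([set x; y] \in E) = edge_rel E x y.
Proof.
move=> /simple_graphP gE; rewrite /edge_rel; case: eqVneq => [->|//] /=.
by apply/negP => /gE; rewrite cards2 eqxx.
Qed.

Lemma simple_edge_ends (T : finType) (E : {set {set T}}) e : simple_graph E -> e \in E ->
  exists x y, [/\ x != y, e = [set x; y] & edge_rel E x y].
Proof.
move=> sE eE; have /simple_graphP/(_ e eE)/eqP/cards2P[x [y [xy exy]]] := sE.
by exists x, y; rewrite /edge_rel xy -exy.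
Qed.

Lemma simple_sub (T : finType) (E E' : {set {set T}}) : E' \subset E -> simple_graph E -> simple_graph E'.
Proof. by move=> /subsetP sub /simple_graphP h; apply/simple_graphP => e /sub /h. Qed.

Lemma simple_add (T : finType) (E : {set {set T}}) x y : x != y -> simple_graph E ->
  simple_graph ([set x; y] |: E).
Proof.
move=> xy /simple_graphP h; apply/simple_graphP => e; rewrite !inE => /orP[/eqP->|/h//].
by rewrite cards2 xy.
Qed.

Lemma card_edge_pairs (T : finType) (E F : {set {set T}}) : F \subset E ->
  #|[set p : T * T | edge_rel F p.1 p.2]| <= 2 * #|F|.
Proof.
move=> sub; rewrite mulnC; apply: (leq_card_fibers (f := fun p : T * T => [set p.1; p.2])).
  by move=> p; rewrite inE => /andP[].
move=> e eF; have [[a b] /= ab|none] := pickP [pred p : T * T | edge_rel F p.1 p.2 && ([set p.1; p.2] == e)]; last first.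
  rewrite (_ : [set _ in _ | _] = finset.set0) ?finset.cards0 //.
  by apply/setP => p; rewrite !inE; exact: none.
move/andP: ab => [_ /eqP ab]; apply: leq_trans (_ : #|[set (a, b); (b, a)]| <= 2); last by rewrite cards2; case: (_ != _).
apply/subset_leq_card/subsetP => -[c d]; rewrite !inE /= => /andP[/andP[cd _] /eqP]; rewrite -ab => /setP h.
have := h c; have := h d; rewrite !inE !eqxx ?orbT /= => /esym/orP[]/eqP hd /esym/orP[]/eqP hc; subst.
- by rewrite eqxx in cd.
- by rewrite eqxx orbT.
- by rewrite eqxx.
- by rewrite eqxx in cd.
Qed.

Section Injective.
Variables (T T' : finType) (f : T -> T').
Hypothesis finj : injective f.
Implicit Types E : {set {set T}}.

Lemma gmap_inj : injective (gmap f).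
Proof. by apply: imset_inj; exact: imset_inj. Qed.

Lemma card_gmap E : #|gmap f E| = #|E|.
Proof. by apply: card_imset; exact: imset_inj. Qed.

Lemma gmap_edge E x y : edge_rel (gmap f E) (f x) (f y) = edge_rel E x y.
Proof.
rewrite /edge_rel (inj_eq finj); congr (_ && _).
have -> : [set f x; f y] = f @: [set x; y] by rewrite imsetU1 imset_set1.
by rewrite mem_imset //; exact: imset_inj.
Qed.

Lemma simple_gmap E : simple_graph E -> simple_graph (gmap f E).
Proof.
move=> /simple_graphP h; apply/simple_graphP => _ /imsetP[e eE ->].
by rewrite card_imset // h.
Qed.

Lemma gmap_codom E e x : e \in gmap f E -> x \in e -> exists y, x = f y.
Proof. by move=> /imsetP[e' _ ->] /imsetP[y _ ->]; exists y. Qed.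

Lemma gmap_connect E (E' : {set {set T'}}) x y : gmap f E \subset E' -> connect (edge_rel E) x y ->
  connect (edge_rel E') (f x) (f y).
Proof.
move=> sub; move=> /connectP[p pp ->] {y}; elim: p x pp => //= y p IH x /andP[xy /IH].
by apply: connect_trans; apply: connect1; apply: edge_relW sub _; rewrite gmap_edge.
Qed.

End Injective.

Definition emb (T : finType) (x0 : T) (A : {set T}) k (i : 'I_k) : T := nth x0 (enum A) i.

Lemma emb_inj (T : finType) (x0 : T) (A : {set T}) k : #|A| = k -> injective (@emb T x0 A k).
Proof.
move=> cA i j /eqP; rewrite /emb nth_uniq ?enum_uniq -?cardE ?cA ?ltn_ord // => /eqP.
exact: val_inj.
Qed.

Lemma emb_in (T : finType) (x0 : T) (A : {set T}) k (i : 'I_k) : #|A| = k -> emb x0 A i \in A.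
Proof. by move=> cA; rewrite -mem_enum mem_nth // -cardE cA. Qed.

Lemma emb_surj (T : finType) (x0 : T) (A : {set T}) k x : #|A| = k -> x \in A ->
  exists i : 'I_k, x = emb x0 A i.
Proof.
move=> cA; rewrite -mem_enum => xA; have h : index x (enum A) < k by rewrite -cA cardE index_mem.
by exists (Ordinal h); rewrite /emb nth_index.
Qed.

End GraphMaps.

Section PlanarCounts.
Local Open Scope nat_scope.
Variable R : realType.
Local Notation subsetP := fintype.subsetP.

Lemma planar_graphsP n m (E : {set {set 'I_n}}) :
  reflect [/\ simple_graph E, #|E| = m & planar R E] (E \in planar_graphs R n m).
Proof. by rewrite inE; apply: (iffP and3P) => -[? /eqP ? /asboolP ?]; split=> //; apply/asboolP. Qed.

Definition conn (T : finType) (E : {set {set T}}) : bool := [forall x, forall y, connect (edge_rel E) x y].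

Lemma connP (T : finType) (E : {set {set T}}) : reflect (forall x y, connect (edge_rel E) x y) (conn E).
Proof.
apply: (iffP forallP) => [h x y|h x]; first by have /forallP := h x.
by apply/forallP.
Qed.

Definition conn_graphs n m : {set {set {set 'I_n}}} := [set E in planar_graphs R n m | conn E].

Lemma conn_graphsP n m (E : {set {set 'I_n}}) :
  reflect [/\ simple_graph E, #|E| = m, planar R E & forall x y, connect (edge_rel E) x y]
    (E \in conn_graphs n m).
Proof.
apply: (iffP finset.setIdP) => [[/planar_graphsP[? ? ?] /connP ?]|[? ? ? ?]]; first by split.
by split; [exact/planar_graphsP|exact/connP].
Qed.

Lemma planar_K5free n m (E : {set {set 'I_n}}) :
  E \in planar_graphs R n m -> E \in K5free [set: 'I_n].
Proof.
move=> /planar_graphsP[/simple_graphP sE _ pE]; apply/K5freeP; split; last exact: planar_no_K5 pE.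
by apply/graphs_onP => e eE; split; [exact: finset.subsetT|exact: sE].
Qed.

Lemma card_planar_graphs k n m : 131 * 1100 <= k -> #|planar_graphs R n m| <= (2 ^ k * n) ^ n.
Proof.
move=> hk; apply: leq_trans (_ : #|K5free [set: 'I_n]| <= _).
  by apply/subset_leq_card/subsetP => E; exact: planar_K5free.
by apply: leq_trans (card_K5free _ hk) _; rewrite finset.cardsT !card_ord.
Qed.

Lemma planar_edges_le n m (E : {set {set 'I_n}}) : E \in planar_graphs R n m -> m <= 8 * n.
Proof.
move=> EP; have := card_K5free_edges (planar_K5free EP); rewrite finset.cardsT card_ord.
by have /planar_graphsP[_ ->] := EP.
Qed.

(* Join a graph on a set of [n1] vertices to a graph on its complement by one of the
   [n1 * n2] edges between them, which is then a label from which both are recovered. *)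
Lemma conn_superadditive n1 m1 n2 m2 : 0 < n1 -> 0 < n2 ->
  #|conn_graphs n1 m1| * #|conn_graphs n2 m2| * 'C(n1 + n2, n1) * (n1 * n2)
    <= #|conn_graphs (n1 + n2) (m1 + m2).+1| * (2 * (m1 + m2).+1).
Proof.
case: n1 => // n1 _; case: n2 => // n2 _; set n := n1.+1 + n2.+1.
have x0 : 'I_n by exists 0.
pose f (A : {set 'I_n}) := @emb _ x0 A n1.+1.
pose g (A : {set 'I_n}) := @emb _ x0 (~: A) n2.+1.
pose X : {set {set 'I_n} * ({set {set 'I_n1.+1}} * {set {set 'I_n2.+1}})} :=
  finset.setX [set A : {set 'I_n} | #|A| == n1.+1] (finset.setX (conn_graphs n1.+1 m1) (conn_graphs n2.+1 m2)).
have cX : #|X| = #|conn_graphs n1.+1 m1| * #|conn_graphs n2.+1 m2| * 'C(n, n1.+1).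
  by rewrite !finset.cardsX card_draws card_ord mulnC.
rewrite -cX.
pose body (x : {set 'I_n} * ({set {set 'I_n1.+1}} * {set {set 'I_n2.+1}})) := gmap (f x.1) x.2.1 :|: gmap (g x.1) x.2.2.
pose F x (i : 'I_n1.+1 * 'I_n2.+1) := [set f x.1 i.1; g x.1 i.2] |: body x.
pose G (x : {set 'I_n} * ({set {set 'I_n1.+1}} * {set {set 'I_n2.+1}})) (i : 'I_n1.+1 * 'I_n2.+1) := (f x.1 i.1, g x.1 i.2).
have inX x : x \in X -> [/\ #|x.1| = n1.+1, #|~: x.1| = n2.+1, x.2.1 \in conn_graphs n1.+1 m1 & x.2.2 \in conn_graphs n2.+1 m2].
  case: x => A [E1 E2]; rewrite !inE /= => /and3P[/eqP cA h1 h2]; split=> //.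
  by have := finset.cardsC A; rewrite cA card_ord => /addnI.
have fA (A : {set 'I_n}) i : #|A| = n1.+1 -> f A i \in A by exact: emb_in.
have gA (A : {set 'I_n}) i : #|~: A| = n2.+1 -> g A i \notin A by move=> h; have := emb_in x0 i h; rewrite inE.
have sub1 x (e : {set 'I_n}) : x \in X -> e \in gmap (f x.1) x.2.1 -> e \subset x.1.
  move=> /inX[cA _ _ _] eE; apply/subsetP => y ye; have [i ->] := gmap_codom eE ye; exact: fA.
have sub2 x (e : {set 'I_n}) : x \in X -> e \in gmap (g x.1) x.2.2 -> e \subset ~: x.1.
  move=> /inX[_ cA _ _] eE; apply/subsetP => y ye; have [i ->] := gmap_codom eE ye; rewrite inE; exact: gA.
have edge1 x a b : x \in X -> edge_rel (body x) a b -> (a \in x.1) = (b \in x.1).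
  move=> xX /andP[_]; rewrite inE => /orP[/(sub1 _ _ xX)|/(sub2 _ _ xX)] /subsetP h.
    by rewrite !h // !inE eqxx ?orbT.
  by have := h a; have := h b; rewrite !inE !eqxx ?orbT => /(_ isT)/negbTE-> /(_ isT)/negbTE->.
(* This recovers the vertex set of the first graph: it is the component of the first end of the
   label once the joining edge is deleted. *)
have comp x i y : x \in X -> connect (edge_rel (body x)) (f x.1 i) y = (y \in x.1).
  move=> xX; have [cA cA' /conn_graphsP[_ _ _ con] _] := inX x xX.
  apply/idP/idP => [/(closed_connect (fun a b => @edge1 x a b xX)) <-|yA]; first exact: fA.
  have [j ->] := emb_surj x0 cA yA; apply: gmap_connect (con i j); first exact: emb_inj.
  exact: finset.subsetUl.
have uvnot x i : x \in X -> [set f x.1 i.1; g x.1 i.2] \notin body x.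
  move=> xX; have [cA cA' _ _] := inX x xX; rewrite inE negb_or; apply/andP; split.
    apply/negP => /(sub1 _ _ xX)/subsetP/(_ (g x.1 i.2)); rewrite !inE eqxx orbT => /(_ isT).
    by apply/negP; exact: gA.
  apply/negP => /(sub2 _ _ xX)/subsetP/(_ (f x.1 i.1)); rewrite !inE eqxx => /(_ isT).
  by rewrite fA.
apply: (@double_counting _ _ _ _ X _ (fun=> [set: 'I_n1.+1 * 'I_n2.+1])
  (fun E : {set {set 'I_n}} => [set p : 'I_n * 'I_n | edge_rel E p.1 p.2]) F G).
- by move=> x _; rewrite finset.cardsT card_prod !card_ord.
- move=> E /conn_graphsP[_ cE _ _]; rewrite -cE; exact: card_edge_pairs.
- move=> x i xX _; have [cA cA' /conn_graphsP[s1 c1 p1 con1] /conn_graphsP[s2 c2 p2 con2]] := inX x xX.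
  have fi : injective (f x.1) by exact: emb_inj.
  have gi : injective (g x.1) by exact: emb_inj.
  have nfg : f x.1 i.1 != g x.1 i.2.
    by apply: contraTneq (fA _ i.1 cA) => ->; exact: gA.
  split; last by rewrite inE /= /edge_rel nfg !inE eqxx.
  apply/conn_graphsP; split.
  + apply: simple_add nfg _; apply/simple_graphP => e; rewrite inE => /orP[].
      by move: e; apply/simple_graphP/simple_gmap.
    by move: e; apply/simple_graphP/simple_gmap.
  + rewrite cardsU1 uvnot // add1n finset.cardsU !card_gmap // c1 c2.
    rewrite (_ : _ :&: _ = finset.set0) ?finset.cards0 ?subn0 //.
    apply/setP => e; rewrite !inE; apply/negP => /andP[eE /(sub2 _ _ xX)/subsetP h2].
    have /subsetP h1 := sub1 _ _ xX eE; have := simple_gmap fi s1 => /simple_graphP/(_ e eE).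
    by move=> /eqP/cards2P[a [b [_ ee]]]; have := h1 a; have := h2 a; rewrite ee !inE eqxx /= => /(_ isT)/negP h /(_ isT).
  + apply: (@planar_join R _ _ _ x.1); last 2 first.
    * exact: planar_relabel.
    * exact: planar_relabel.
    * by move=> e; exact: sub1.
    * by move=> e; exact: sub2.
    * exact: fA.
    * exact: gA.
  + have cs := sym_connect_sym (@edge_rel_sym _ (F x i)).
    have h1 (y : 'I_n) : y \in x.1 -> connect (edge_rel (F x i)) (f x.1 i.1) y.
      move=> yA; have [j ->] := emb_surj x0 cA yA; apply: gmap_connect (con1 _ j) => //.
      by apply: fintype.subset_trans (finset.subsetUr _ _); exact: finset.subsetUl.
    have h2 (y : 'I_n) : y \notin x.1 -> connect (edge_rel (F x i)) (g x.1 i.2) y.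
      move=> yA; have [j ->] : exists j, y = g x.1 j by apply: emb_surj => //; rewrite inE.
      apply: gmap_connect (con2 _ j) => //.
      by apply: fintype.subset_trans (finset.subsetUr _ _); exact: finset.subsetUr.
    have h3 : connect (edge_rel (F x i)) (f x.1 i.1) (g x.1 i.2).
      by apply: connect1; rewrite /edge_rel nfg !inE eqxx.
    have h y : connect (edge_rel (F x i)) (f x.1 i.1) y.
      by have [/h1//|/h2] := boolP (y \in x.1); apply: connect_trans.
    by move=> a b; apply: connect_trans (h b); rewrite cs.
- move=> x i x' i' xX _ xX' _ hF [h1 h2].
  have bE : body x = body x'.
    have := congr1 (fun E : {set {set 'I_n}} => E :\ [set f x.1 i.1; g x.1 i.2]) hF; rewrite /F.
    by rewrite [in X in _ = X]h1 [in X in _ = X]h2 !setU1K ?uvnot.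
  have AE : x.1 = x'.1.
    apply/setP => y; rewrite -(comp x i.1 y xX) -(comp x' i'.1 y xX') bE h1; by [].
  have [cA cA' _ _] := inX x xX.
  move: hF h1 h2 bE; case: x xX AE cA cA' => A [E1 E2] xX /= AE cA cA'.
  case: x' xX' AE => A' [E1' E2'] xX' /= AE; subst A' => _ h1 h2 bE.
  have fi : injective (f A) by exact: emb_inj.
  have gi : injective (g A) by exact: emb_inj.
  have part1 (E : {set {set 'I_n1.+1}}) (E' : {set {set 'I_n2.+1}}) : (A, (E, E')) \in X -> gmap (f A) E = [set e in body (A, (E, E')) | e \subset A].
    move=> hX; apply/setP => e; rewrite !inE /=; apply/idP/andP => [h|[/orP[//|h] h']].
      by split; [rewrite h|exact: (sub1 _ _ hX)].
    have /subsetP h'' := sub2 _ _ hX h; have [_ _ _ /conn_graphsP[s2 _ _ _]] := inX _ hX.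
    have := simple_gmap gi s2 => /simple_graphP/(_ e h)/eqP/cards2P[a [b [_ ee]]].
    by have := h'' a; have /subsetP/(_ a) := h'; rewrite ee !inE eqxx /= => /(_ isT) -> /(_ isT).
  have part2 (E : {set {set 'I_n1.+1}}) (E' : {set {set 'I_n2.+1}}) : (A, (E, E')) \in X -> gmap (g A) E' = [set e in body (A, (E, E')) | e \subset ~: A].
    move=> hX; apply/setP => e; rewrite !inE /=; apply/idP/andP => [h|[/orP[h|//] h']].
      by split; [rewrite h orbT|exact: (sub2 _ _ hX)].
    have /subsetP h'' := sub1 _ _ hX h; have [_ _ /conn_graphsP[s2 _ _ _] _] := inX _ hX.
    have := simple_gmap fi s2 => /simple_graphP/(_ e h)/eqP/cards2P[a [b [_ ee]]].
    by have := h'' a; have /subsetP/(_ a) := h'; rewrite ee !inE eqxx /= => /(_ isT)/negP nn /(_ isT).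
  have e1 : E1 = E1' by apply: (gmap_inj fi); rewrite (part1 _ _ xX) (part1 _ _ xX') bE.
  have e2 : E2 = E2' by apply: (gmap_inj gi); rewrite (part2 _ _ xX) (part2 _ _ xX') bE.
  rewrite e1 e2; split=> //; case: i i' h1 h2 => i j [i' j'] /= /fi -> /gi ->; by [].
Qed.

End PlanarCounts.

(** * Counting graphs by their number of components *)

Section Components.
Local Open Scope nat_scope.
Local Notation subsetP := fintype.subsetP.
Variable T : finType.
Implicit Types (E : {set {set T}}).

Definition comp_of E x : {set T} := [set y | connect (edge_rel E) x y].
Definition ncomp E : nat := #|[set comp_of E x | x : T]|.

Lemma conn_sym E : connect_sym (edge_rel E).
Proof. exact: sym_connect_sym (@edge_rel_sym _ E). Qed.

Lemma comp_of_refl E x : x \in comp_of E x.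
Proof. by rewrite inE connect0. Qed.

Lemma comp_ofP E x y : reflect (comp_of E x = comp_of E y) (connect (edge_rel E) x y).
Proof.
apply: (iffP idP) => [xy|e]; last by have := comp_of_refl E y; rewrite -e inE.
by apply/setP => z; rewrite !inE; exact: (same_connect (@conn_sym E) xy).
Qed.

(** Each vertex is unconnected to at least one vertex of every other component. *)
Lemma unconnected_pairs E :
  #|T| * (ncomp E).-1 <= #|[set p : T * T | ~~ connect (edge_rel E) p.1 p.2]|.
Proof.
rewrite -sum_nat_const.
apply: (@leq_trans (\sum_x #|[set y | ~~ connect (edge_rel E) x y]|)).
  apply: leq_sum => x _.
  have -> : (ncomp E).-1 = #|[set comp_of E x | x : T] :\ comp_of E x|.
    by rewrite /ncomp (cardsD1 (comp_of E x)) imset_f.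
  apply: leq_trans (leq_imset_card (comp_of E) _); apply/subset_leq_card/subsetP => C.
  rewrite !inE => /andP[nC /imsetP[y _ Cy]]; subst C; apply: imset_f; rewrite inE.
  by apply: contraNN nC => /comp_ofP ->.
apply: eq_leq; rewrite -sum1_card (eq_bigl (fun p => predT p.1 && ~~ connect (edge_rel E) p.1 p.2)).
  rewrite -(pair_big_dep predT (fun x y => ~~ connect (edge_rel E) x y) (fun _ _ => 1)) /=.
  by apply: eq_bigr => x _; rewrite -sum1_card; apply: eq_bigl => y; rewrite inE.
by move=> p; rewrite inE.
Qed.

Section AddEdge.
Variables (E : {set {set T}}) (x y : T).
Hypothesis nxy : ~~ connect (edge_rel E) x y.
Let E' := [set x; y] |: E.
Let U := comp_of E x :|: comp_of E y.

Lemma neq_unconnected : x != y.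
Proof. by apply: contraNneq nxy => ->; rewrite connect0. Qed.

Let connE a b : connect (edge_rel E) a b -> connect (edge_rel E') a b.
Proof.
apply: connect_sub => u v uv; apply: connect1; apply: edge_relW uv; exact: finset.subsetUr.
Qed.

Let xy' : connect (edge_rel E') x y.
Proof. by apply: connect1; rewrite /edge_rel neq_unconnected !inE eqxx. Qed.

Let U_closed a b : edge_rel E' a b -> (a \in U) = (b \in U).
Proof.
move=> /andP[ab]; rewrite finset.in_setU1 => /orP[/eqP e|abE].
  have hU z : z \in [set x; y] -> z \in U.
    by rewrite !inE => /orP[]/eqP->; rewrite connect0 ?orbT.
  by rewrite !hU // -e !inE eqxx ?orbT.
have ab' : connect (edge_rel E) a b by apply: connect1; rewrite /edge_rel ab.
by rewrite !inE; congr (_ || _); rewrite !(conn_sym E _ a) !(conn_sym E _ b); exact: (same_connect (@conn_sym E) ab').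
Qed.

Let comp_in a : a \in U -> comp_of E' a = U.
Proof.
move=> aU; apply/setP => b; rewrite inE; apply/idP/idP => [/(closed_connect U_closed) <- //|bU].
have toX z : z \in U -> connect (edge_rel E') x z.
  rewrite !inE => /orP[/connE //|/connE]; exact: connect_trans xy'.
by apply: connect_trans (toX b bU); rewrite conn_sym; exact: toX.
Qed.

Let comp_out a : a \notin U -> comp_of E' a = comp_of E a.
Proof.
move=> aU; apply/setP => b; rewrite !inE; apply/idP/idP; last exact: connE.
move=> /connectP[p pp ->]; elim: p a aU pp => [|c p IH] a aU /=; first by rewrite connect0.
move=> /andP[ac pp]; have cU : c \notin U by rewrite -(U_closed ac).
apply: connect_trans (IH c cU pp); apply: connect1.
move: ac => /andP[nac]; rewrite finset.in_setU1 => /orP[/eqP h|acE]; last by rewrite /edge_rel nac.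
have : a \in [set x; y] by rewrite -h !inE eqxx.
by move: aU; rewrite !inE negb_or => /andP[n1 n2] /orP[]/eqP ax; move: n1 n2; rewrite ax connect0.
Qed.

Lemma ncomp_add_edge : (ncomp E').+1 = ncomp E.
Proof.
pose S := [set comp_of E z | z : T].
have nC : comp_of E x != comp_of E y by apply: contraNneq nxy => /comp_ofP.
have -> : ncomp E = #|S :\ comp_of E x :\ comp_of E y|.+2.
  rewrite /ncomp -/S (cardsD1 (comp_of E x)) imset_f // (cardsD1 (comp_of E y) (S :\ _)).
  by rewrite !inE eq_sym nC imset_f.
congr _.+1; rewrite /ncomp.
have -> : [set comp_of E' z | z : T] = U |: (S :\ comp_of E x :\ comp_of E y).
  apply/setP => C; rewrite !inE; apply/imsetP/orP => [[z _ ->]|[/eqP->|/and3P[n1 n2 /imsetP[z _ Cz]]]].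
  - have [zU|zU] := boolP (z \in U); [left; by rewrite comp_in|right].
    rewrite comp_out // imset_f // andbT; move: zU; rewrite !inE negb_or => /andP[zx zy].
    by apply/andP; split; [apply: contraNneq zy|apply: contraNneq zx] => /comp_ofP; rewrite conn_sym.
  - by exists x => //; rewrite comp_in // !inE connect0.
  - exists z => //; rewrite comp_out //; subst C; rewrite !inE negb_or.
    by apply/andP; split; [apply: contraNN n2|apply: contraNN n1] => /comp_ofP ->.
rewrite cardsU1 (_ : U \notin _) ?add1n //.
apply/negP; rewrite !inE => /and3P[n1 n2 /imsetP[z _ Uz]].
have : x \in comp_of E z by rewrite -Uz !inE connect0.
rewrite inE => /comp_ofP zx; move/eqP: n2; apply; by rewrite Uz.
Qed.

End AddEdge.

Lemma ncomp_conn E : 0 < #|T| -> (ncomp E == 1) = conn E.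
Proof.
move=> /card_gt0P[x0 _]; apply/idP/connP => [/cards1P[C hC] x y|con].
  apply/comp_ofP; have h z : comp_of E z = C by apply/set1P; rewrite -hC imset_f.
  by rewrite !h.
apply/cards1P; exists (comp_of E x0); apply/setP => C; rewrite !inE; apply/imsetP/eqP => [[z _ ->]|->].
  by apply/comp_ofP.
by exists x0.
Qed.

Lemma ncomp_gt0 E : 0 < #|T| -> 0 < ncomp E.
Proof. by move=> /card_gt0P[x0 _]; apply/card_gt0P; exists (comp_of E x0); exact: imset_f. Qed.

Lemma ncomp_le E : ncomp E <= #|T|.
Proof. exact: leq_imset_card. Qed.

(** [planar_join] applies to the edges inside the component of [x] and those outside it. *)
Lemma planar_add_edge (R : realType) E x y : simple_graph E -> planar R E ->
  ~~ connect (edge_rel E) x y -> planar R ([set x; y] |: E).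
Proof.
move=> sE pE nxy; pose A := comp_of E x.
have split : E = [set e in E | e \subset A] :|: [set e in E | e \subset ~: A].
  apply/setP => e; rewrite !inE -andb_orr; case: (boolP (e \in E)) => //= eE; apply/esym.
  have [a [b [_ ee ab]]] := simple_edge_ends sE eE.
  have h : (a \in A) = (b \in A).
    by rewrite !inE !(conn_sym E x); exact: (same_connect (@conn_sym E) (connect1 ab)).
  by rewrite ee !finset.subUset !finset.sub1set !finset.in_setC h; case: (b \in A).
rewrite {1}split; apply: (@planar_join R _ _ _ A).
- by move=> e; rewrite inE => /andP[].
- by move=> e; rewrite inE => /andP[].
- exact: comp_of_refl.
- by rewrite inE.
- by apply: planar_sub pE; apply/subsetP => e; rewrite inE => /andP[].
- by apply: planar_sub pE; apply/subsetP => e; rewrite inE => /andP[].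
Qed.

End Components.

Section ComponentCounts.
Local Open Scope nat_scope.
Variable R : realType.

Definition comp_graphs k n m : {set {set {set 'I_n}}} :=
  [set E in planar_graphs R n m | ncomp E == k].

(** An edge is added between two components; the ordered pair of its ends is the label that undoes
    this. *)
Lemma comp_graphs_step k n m :
  #|comp_graphs k.+2 n m| * (n * k.+1) <= #|comp_graphs k.+1 n m.+1| * (2 * m.+1).
Proof.
apply: (@double_counting _ _ _ _ _ _
  (fun E : {set {set 'I_n}} => [set p : 'I_n * 'I_n | ~~ connect (edge_rel E) p.1 p.2])
  (fun E : {set {set 'I_n}} => [set p : 'I_n * 'I_n | edge_rel E p.1 p.2])
  (fun E p => [set p.1; p.2] |: E) (fun E p => p)).
- move=> E; rewrite inE => /andP[_ /eqP kE].
  by have := unconnected_pairs E; rewrite kE card_ord.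
- move=> E; rewrite inE => /andP[/planar_graphsP[_ cE _] _]; rewrite -cE; exact: card_edge_pairs.
- move=> E p /finset.setIdP[/planar_graphsP[sE cE pE] /eqP kE]; rewrite inE => np.
  have neq := neq_unconnected np.
  split; last by rewrite inE /edge_rel neq !inE eqxx.
  apply/finset.setIdP; split; last by have := ncomp_add_edge np; rewrite kE => -[->].
  apply/planar_graphsP; split; [exact: simple_add| |exact: planar_add_edge].
  rewrite cardsU1 cE (_ : [set p.1; p.2] \notin E) //.
  by apply: contraNN np => h; apply: connect1; rewrite /edge_rel neq.
- move=> E p E' p' _ + _ + h pp; subst p'; rewrite !inE => np np'; split=> //.
  have nin F : ~~ connect (edge_rel F) p.1 p.2 -> [set p.1; p.2] \notin F.
    by move=> nF; apply: contraNN (nF) => hF; apply: connect1; rewrite /edge_rel (neq_unconnected nF).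
  by rewrite -(setU1K (nin _ np)) -(setU1K (nin _ np')) h.
Qed.

Lemma comp_graphs1 n m : 0 < n -> comp_graphs 1 n m = conn_graphs R n m.
Proof.
by move=> n0; apply/setP => E; rewrite !inE ncomp_conn // card_ord.
Qed.

End ComponentCounts.

(** * Leaves and switchings *)

Section Pendants.
Local Open Scope nat_scope.
Local Notation subsetP := fintype.subsetP.

Lemma degree1P (T : finType) (E : {set {set T}}) f x : f \in E -> x \in f ->
  reflect (forall g, g \in E -> x \in g -> g = f) (degree E x == 1).
Proof.
move=> fE xf; apply: (iffP cards1P) => [[h hE] g gE xg|h].
  have /set1P-> : g \in [set h] by rewrite -hE inE gE.
  by have /set1P-> : f \in [set h] by rewrite -hE inE fE.
exists f; apply/setP => g; rewrite !inE; apply/andP/eqP => [[gE xg]|->] //.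
exact: h.
Qed.

Lemma pendantP (T : finType) (E : {set {set T}}) f :
  reflect (exists x, [/\ f \in E, x \in f & forall g, g \in E -> x \in g -> g = f]) (f \in pendant_edges E).
Proof.
rewrite inE; apply: (iffP andP) => [[fE /existsP[x /andP[xf d1]]]|[x [fE xf h]]].
  by exists x; split=> //; apply/(degree1P fE xf).
by split=> //; apply/existsP; exists x; rewrite xf /=; apply/(degree1P fE xf).
Qed.

Variable R : realType.

Definition few_pendants p n m : {set {set {set 'I_n}}} :=
  [set E in planar_graphs R n m | #|pendant_edges E| <= p].

Lemma few_pendantsP p n m (E : {set {set 'I_n}}) :
  reflect [/\ simple_graph E, #|E| = m, planar R E & #|pendant_edges E| <= p] (E \in few_pendants p n m).
Proof.
apply: (iffP finset.setIdP) => [[/planar_graphsP[? ? ?] ?]|[? ? ? ?]]; first by split.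
by split=> //; apply/planar_graphsP.
Qed.

(* The new leaf and its neighbour are a label of the construction, and there are at most
   [2 * p.+1] such ordered pairs. *)
Lemma attach_pendant p n m :
  #|few_pendants p n m| * (n.+1 * n) <= #|few_pendants p.+1 n.+1 m.+1| * (2 * p.+1).
Proof.
pose F (E : {set {set 'I_n}}) (i : 'I_n.+1 * 'I_n) : {set {set 'I_n.+1}} := [set i.1; lift i.1 i.2] |: gmap (lift i.1) E.
have nin (E : {set {set 'I_n}}) (a : 'I_n.+1) (e : {set 'I_n.+1}) : e \in gmap (lift a) E -> a \notin e.
  by move=> h; apply/negP => ae; have [y /eqP] := gmap_codom h ae; rewrite eq_liftF.
have nab (E : {set {set 'I_n}}) (i : 'I_n.+1 * 'I_n) : [set i.1; lift i.1 i.2] \notin gmap (lift i.1) E.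
  by apply/negP => /nin; rewrite !inE eqxx.
apply: (@double_counting _ _ _ _ _ _ (fun=> [set: 'I_n.+1 * 'I_n])
  (fun E : {set {set 'I_n.+1}} => [set q : 'I_n.+1 * 'I_n.+1 | edge_rel (pendant_edges E) q.1 q.2])
  F (fun _ i => (i.1, lift i.1 i.2))).
- by move=> E _; rewrite finset.cardsT card_prod !card_ord.
- move=> E /few_pendantsP[_ _ _ pE].
  apply: leq_trans (card_edge_pairs (E := pendant_edges E) (fintype.subxx _)) _.
  by rewrite leq_mul2l pE.
- move=> E [a z] /few_pendantsP[sE cE pE fE] _; rewrite /F /=.
  have anz : a != lift a z by rewrite neq_lift.
  have pend_ab : [set a; lift a z] \in pendant_edges (F E (a, z)).
    apply/pendantP; exists a; split; rewrite ?inE ?eqxx //.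
    by move=> g; rewrite finset.in_setU1 => /orP[/eqP//|/nin/negP].
  split; last by rewrite inE /edge_rel anz.
  apply/few_pendantsP; split.
  + by apply: simple_add anz _; apply: simple_gmap sE; exact: lift_inj.
  + by rewrite cardsU1 (nab _ (a, z)) card_gmap ?cE //; exact: lift_inj.
  + have pg : planar R (gmap (lift a) E) by apply: planar_relabel pE; exact: lift_inj.
    rewrite -(finset.set0U (gmap _ _)); apply: (@planar_join R _ _ _ [set a]).
    * by move=> e; rewrite inE.
    * move=> e eE; apply/subsetP => x xe; rewrite !inE; apply: contraNneq (nin _ _ _ eE) => <-; exact: xe.
    * by rewrite inE.
    * by rewrite inE eq_sym.
    * by apply: planar_sub pg; exact: finset.sub0set.
    * exact: pg.
  + apply: leq_trans (_ : #|[set a; lift a z] |: gmap (lift a) (pendant_edges E)| <= _); last first.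
      rewrite cardsU1 card_gmap; last exact: lift_inj.
      by rewrite -[p.+1]add1n leq_add // leq_b1.
    apply/subset_leq_card/subsetP => f /pendantP[x [+ xf h]].
    rewrite !finset.in_setU1 => /orP[->//|fE']; apply/orP; right.
    move: (fE') => /imsetP[f0 f0E ff]; apply/imsetP; exists f0 => //; apply/pendantP.
    move: xf; rewrite ff => /imsetP[x0 x0f xx]; exists x0; split=> // g gE x0g.
    apply: (imset_inj (@lift_inj _ a)); rewrite -ff; apply: h; last by rewrite xx imset_f.
    by rewrite finset.in_setU1; apply/orP; right; exact: imset_f.
- move=> E [a z] E' [a' z'] _ _ _ _; rewrite /F /= => h /pair_equal_spec[aa zz]; subst a'; move/lift_inj: zz => zz; subst z'.
  split=> //; apply: (gmap_inj (@lift_inj _ a)).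
  by rewrite -(finset.setU1K (nab E (a, z))) -(finset.setU1K (nab E' (a, z))) h.
Qed.

Definition isolated n (E : {set {set 'I_n}}) : {set 'I_n} := [set w | degree E w == 0].

Lemma isolatedP n (E : {set {set 'I_n}}) w : reflect (forall e, e \in E -> w \notin e) (w \in isolated E).
Proof.
rewrite inE cards_eq0; apply: (iffP eqP) => [/setP h e eE|h].
  by have := h e; rewrite !inE eE /= => ->.
by apply/setP => e; rewrite !inE; case: (boolP (e \in E)) => //= /h/negbTE.
Qed.

(* Hang an isolated vertex on another vertex and delete an edge. *)
Lemma switch_isolated p n m c :
  #|[set E in few_pendants p n.+1 m | c <= #|isolated E|]| * (c * m * n)
    <= #|few_pendants p.+3 n.+1 m| * (2 * p.+3 * 'C(n.+1, 2)).
Proof.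
pose F (E : {set {set 'I_n.+1}}) (i : 'I_n.+1 * {set 'I_n.+1} * 'I_n) : {set {set 'I_n.+1}} :=
  [set i.1.1; lift i.1.1 i.2] |: (E :\ i.1.2).
apply: (@double_counting _ _ _ _ _ _
  (fun E : {set {set 'I_n.+1}} => finset.setX (finset.setX (isolated E) E) [set: 'I_n])
  (fun E : {set {set 'I_n.+1}} => finset.setX [set q : 'I_n.+1 * 'I_n.+1 | edge_rel (pendant_edges E) q.1 q.2]
     [set e : {set 'I_n.+1} | #|e| == 2])
  F (fun _ i => ((i.1.1, lift i.1.1 i.2), i.1.2))).
- move=> E /finset.setIdP[/few_pendantsP[_ cE _ _] cI].
  by rewrite !finset.cardsX finset.cardsT card_ord cE !leq_mul.
- move=> E /few_pendantsP[_ _ _ pE]; rewrite finset.cardsX card_draws card_ord leq_mul2r.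
  apply/orP; right; apply: leq_trans (card_edge_pairs (E := pendant_edges E) (fintype.subxx _)) _.
  by rewrite leq_mul2l pE.
- move=> E [[w e] z] /finset.setIdP[/few_pendantsP[sE cE pE fE] _]; rewrite !finset.in_setX /= => /andP[/andP[/isolatedP wE eE] _].
  rewrite /F /=.
  have wz : w != lift w z by rewrite neq_lift.
  have nwz : [set w; lift w z] \notin E.
    by apply/negP => /wE; rewrite !inE eqxx.
  have pend_wz : [set w; lift w z] \in pendant_edges ([set w; lift w z] |: (E :\ e)).
    apply/pendantP; exists w; split; rewrite ?inE ?eqxx //.
    by move=> g; rewrite !inE => /orP[/eqP//|/andP[_ /wE/negP]].
  split; last first.
    rewrite /= inE /edge_rel wz pend_wz inE.
    by have /simple_graphP-> := sE.
  apply/few_pendantsP; split.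
  + by apply: simple_add wz _; apply: simple_sub sE; exact: finset.subsetDl.
  + rewrite cardsU1 !inE (negbTE nwz) andbF /= add1n -cE (cardsD1 e E) eE add1n; by [].
  + apply: planar_add_edge.
    * by apply: simple_sub sE; exact: finset.subsetDl.
    * by apply: planar_sub pE; exact: finset.subsetDl.
    * apply/negP => /connectP[[|y q] /=]; first by move=> _ /eqP; rewrite eq_sym (negbTE wz).
      by move=> /andP[/andP[_ +] _] _; rewrite !inE => /andP[_ /wE]; rewrite !inE eqxx.
  + have [x [y [_ exy _]]] := simple_edge_ends sE eE.
    pose E' : {set {set 'I_n.+1}} := [set w; lift w z] |: (E :\ e).
    rewrite -/E'.
    (* Deleting [e] can turn each of its two ends into a leaf. Together with the new edge at [w]
       this gives at most 3 new pendant edges. *)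
    pose pe (v : 'I_n.+1) : {set {set 'I_n.+1}} := [set f : {set 'I_n.+1} in E' | (v \in f) && (degree E' v == 1)].
    have cpe (v : 'I_n.+1) : #|pe v| <= 1.
      have [d1|d1] := eqVneq (degree E' v) 1; last first.
        by rewrite (_ : pe v = finset.set0) ?finset.cards0 //; apply/setP => f; rewrite !inE (negbTE d1) !andbF.
      by rewrite -d1; apply/subset_leq_card/subsetP => f; rewrite !inE => /and3P[-> -> _].
    apply: leq_trans (_ : #|[set w; lift w z] |: (pendant_edges E :|: (pe x :|: pe y))| <= _).
      apply/subset_leq_card/subsetP => f /pendantP[v [fE' vf h]].
      rewrite finset.in_setU1; have [//|fwz] := eqVneq f [set w; lift w z] => /=.
      have fE0 : f \in E.
        by move: (fE'); rewrite finset.in_setU1 (negbTE fwz) /= inE => /andP[].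
      have [ve|ve] := boolP (v \in e).
        rewrite !finset.in_setU; apply/orP; right.
        have vpe : f \in pe v by rewrite inE fE' vf /=; apply/(degree1P fE' vf).
        have /orP[/eqP vx|/eqP vy] : (v == x) || (v == y) by move: ve; rewrite exy !inE.
          by apply/orP; left; rewrite -vx.
        by apply/orP; right; rewrite -vy.
      rewrite finset.in_setU; apply/orP; left; apply/pendantP; exists v; split=> // g gE vg.
      apply: h => //; rewrite finset.in_setU1 !inE gE andbT; apply/orP; right.
      by apply: contraNneq ve => <-.
    apply: leq_trans (_ : 1 + (p + (1 + 1)) <= _); last by lia.
    apply: leq_trans (leq_card_setU _ _).1 _; rewrite cards1 leq_add2l.
    apply: leq_trans (leq_card_setU _ _).1 _; apply: leq_add => //.
    by apply: leq_trans (leq_card_setU _ _).1 _; apply: leq_add.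
- move=> E [[w e] z] E' [[w' e'] z'] /finset.setIdP[_ _]; rewrite !finset.in_setX /= => /andP[/andP[/isolatedP wE eE] _].
  move=> /finset.setIdP[_ _] /andP[/andP[/isolatedP wE' eE'] _].
  rewrite /F /= => h /pair_equal_spec[/pair_equal_spec[ww zz] ee]; subst w' e'; move/lift_inj: zz => zz; subst z'; split=> //.
  have n1 (D : {set {set 'I_n.+1}}) : (forall e, e \in D -> w \notin e) -> [set w; lift w z] \notin D :\ e.
    by move=> wD; apply/negP; rewrite !inE => /andP[_ /wD]; rewrite !inE eqxx.
  by rewrite -(finset.setD1K eE) -(finset.setD1K eE') -(finset.setU1K (n1 _ wE)) -(finset.setU1K (n1 _ wE')) h.
Qed.

(* The condition for [w] to be suppressible by [planar_suppress]. *)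
Definition good_corner n (E : {set {set 'I_n}}) w (q : 'I_n * 'I_n) : bool :=
  [&& q.1 != q.2, [set q.1; w] \in E, [set w; q.2] \in E, [set q.1; q.2] \notin E & degree E w == 2].

Definition good_vertices n (E : {set {set 'I_n}}) : {set 'I_n} := [set w | [exists q, good_corner E w q]].

Definition corner n (E : {set {set 'I_n}}) w : 'I_n * 'I_n := odflt (w, w) [pick q | good_corner E w q].

Lemma cornerP n (E : {set {set 'I_n}}) w : w \in good_vertices E -> good_corner E w (corner E w).
Proof. by rewrite inE => /existsP[q hq]; rewrite /corner; case: pickP => // /(_ q); rewrite hq. Qed.

Lemma degree2_edges n (E : {set {set 'I_n}}) w (e1 e2 : {set 'I_n}) : e1 \in E -> e2 \in E -> e1 != e2 -> w \in e1 -> w \in e2 ->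
  degree E w == 2 -> forall e, e \in E -> w \in e -> e = e1 \/ e = e2.
Proof.
move=> e1E e2E ne we1 we2 /eqP d2 e eE we.
have sub : [set e1; e2] \subset [set e in E | w \in e].
  by rewrite finset.subUset !finset.sub1set !inE e1E e2E we1 we2.
have /eqP eq : [set e1; e2] == [set e in E | w \in e].
  by rewrite eqEcard sub cards2 ne -[#|[set e in E | _]|]/(degree E w) d2.
have : e \in [set e1; e2] by rewrite eq inE eE.
by rewrite !inE => /orP[]/eqP; auto.
Qed.

(* Suppress a vertex of degree 2 and hang it on another vertex. *)
Lemma switch_degree2 p n m c :
  #|[set E in few_pendants p n.+1 m | c <= #|good_vertices E|]| * (c * n)
    <= #|few_pendants p.+3 n.+1 m| * (2 * p.+3 * m).
Proof.
pose uv (E : {set {set 'I_n.+1}}) w : {set 'I_n.+1} := [set (corner E w).1; (corner E w).2].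
pose core (E : {set {set 'I_n.+1}}) w := E :\ [set (corner E w).1; w] :\ [set w; (corner E w).2].
pose F (E : {set {set 'I_n.+1}}) (i : 'I_n.+1 * 'I_n) : {set {set 'I_n.+1}} :=
  [set i.1; lift i.1 i.2] |: (uv E i.1 |: core E i.1).
have basic (E : {set {set 'I_n.+1}}) w : simple_graph E -> w \in good_vertices E ->
    let u := (corner E w).1 in let v := (corner E w).2 in
    [/\ [&& u != v, u != w & w != v], [set u; w] \in E, [set w; v] \in E, uv E w \notin E &
      forall e, e \in E -> w \in e -> e = [set u; w] \/ e = [set w; v]].
  move=> sE /cornerP /and5P[n1 e1 e2 n2 d2] u v.
  have uw : u != w by move: e1; rewrite simple_edgeE // => /andP[].
  have wv : w != v by move: e2; rewrite simple_edgeE // => /andP[].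
  split=> //; first by rewrite n1 uw wv.
  apply: degree2_edges => //; rewrite ?inE ?eqxx ?orbT //.
  apply/eqP => /setP/(_ u); rewrite !inE eqxx; move/negbTE: n1; rewrite -/u -/v => ->.
  by rewrite (negbTE uw).
have coreW (E : {set {set 'I_n.+1}}) w e : simple_graph E -> w \in good_vertices E ->
    e \in core E w -> e \in E /\ w \notin e.
  move=> sE wg; have [_ _ _ _ d2] := basic E w sE wg; rewrite !inE => /and3P[n1 n2 eE]; split=> //.
  by apply/negP => we; case: (d2 e eE we) => h; [move: n2|move: n1]; rewrite h eqxx.
have uvW (E : {set {set 'I_n.+1}}) w : simple_graph E -> w \in good_vertices E -> w \notin uv E w.
  move=> sE wg; have [/and3P[_ uw wv] _ _ _ _] := basic E w sE wg.
  by rewrite !inE negb_or wv eq_sym uw.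
have n1 (E : {set {set 'I_n.+1}}) w z : simple_graph E -> w \in good_vertices E ->
    [set w; lift w z] \notin uv E w |: core E w.
  move=> sE wg; rewrite finset.in_setU1 negb_or; apply/andP; split.
    by apply: contraNneq (uvW E w sE wg) => <-; rewrite !inE eqxx.
  by apply/negP => /(coreW E w _ sE wg)[_]; rewrite !inE eqxx.
have n2 (E : {set {set 'I_n.+1}}) w : simple_graph E -> w \in good_vertices E -> uv E w \notin core E w.
  by move=> sE wg; apply/negP => /(coreW E w _ sE wg)[h _]; have [_ _ _ /negP] := basic E w sE wg.
apply: (@double_counting _ _ _ _ _ _
  (fun E : {set {set 'I_n.+1}} => finset.setX (good_vertices E) [set: 'I_n])
  (fun E : {set {set 'I_n.+1}} => finset.setX [set q : 'I_n.+1 * 'I_n.+1 | edge_rel (pendant_edges E) q.1 q.2] E)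
  F (fun E i => ((i.1, lift i.1 i.2), uv E i.1))).
- move=> E /finset.setIdP[_ cI].
  by rewrite !finset.cardsX finset.cardsT card_ord leq_mul.
- move=> E /few_pendantsP[_ cE _ pE]; rewrite finset.cardsX cE leq_mul2r.
  apply/orP; right; apply: leq_trans (card_edge_pairs (E := pendant_edges E) (fintype.subxx _)) _.
  by rewrite leq_mul2l pE.
- move=> E [w z] /finset.setIdP[/few_pendantsP[sE cE pE fE] _]; rewrite !finset.in_setX /= => /andP[wg _].
  have [/and3P[uv_n uw wv] e1 e2 e3 d2] := basic E w sE wg.
  have wz : w != lift w z by rewrite neq_lift.
  have sE' : simple_graph (uv E w |: core E w).
    by apply: simple_add uv_n _; apply: (simple_sub _ sE); apply/subsetP => e /(coreW E w _ sE wg)[].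
  have pend_wz : [set w; lift w z] \in pendant_edges (F E (w, z)).
    apply/pendantP; exists w; split; rewrite ?inE ?eqxx //.
    move=> g; rewrite !finset.in_setU1 => /or3P[/eqP//|/eqP->|/(coreW E w _ sE wg)[_ /negP]//].
    by move/negP: (uvW E w sE wg).
  split; last first.
    by rewrite /= inE /edge_rel wz pend_wz /= !inE eqxx orbT.
  apply/few_pendantsP; split.
  + exact: simple_add.
  + rewrite cardsU1 n1 // cardsU1 n2 // !add1n -cE (cardsD1 [set (corner E w).1; w] E) e1.
    rewrite (cardsD1 [set w; (corner E w).2] (E :\ _)) !inE e2 andbT.
    rewrite (_ : [set w; (corner E w).2] != _) //; apply/eqP => /setP/(_ (corner E w).2).
    by rewrite !inE eqxx orbT eq_sym (negbTE uv_n) eq_sym (negbTE wv).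
  + apply: planar_add_edge => //; first exact: planar_suppress.
    apply/negP => /connectP[[|y q] /=]; first by move=> _ /eqP; rewrite eq_sym (negbTE wz).
    move=> /andP[/andP[_ +] _] _; rewrite finset.in_setU1 => /orP[/eqP h|/(coreW E w _ sE wg)[_]].
      by move/negP: (uvW E w sE wg); apply; rewrite -h !inE eqxx.
    by rewrite !inE eqxx.
  + apply: leq_trans (_ : #|[set w; lift w z] |: (uv E w |: pendant_edges E)| <= _); last first.
      rewrite !cardsU1; apply: leq_trans (leq_add (leq_b1 _) (leq_add (leq_b1 _) fE)) _.
      by clear; lia.
    apply/subset_leq_card/subsetP => f /pendantP[x [fF xf h]].
    rewrite !finset.in_setU1; move: (fF); rewrite !finset.in_setU1 => /or3P[->//|->|fc]; first by rewrite orbT.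
    have [fE0 wf] := coreW E w f sE wg fc.
    have xw : x != w by apply: contraNneq wf => <-.
    (* The ends of [uv E w] lie on that new edge, so no old edge is pendant there. *)
    have uvx : x \in uv E w -> False.
      move=> xuv; have uf : uv E w = f by apply: h => //; rewrite !finset.in_setU1 eqxx orbT.
      by move: e3; rewrite uf fE0.
    apply/orP; right; apply/orP; right; apply/pendantP; exists x; split=> // g gE xg.
    have [wg'|wg'] := boolP (w \in g).
      exfalso; apply: uvx; case: (d2 g gE wg') xg => ->; rewrite !inE (negbTE xw) ?orbF /= => ->; by rewrite ?orbT.
    apply: h => //; rewrite !finset.in_setU1; apply/orP; right; apply/orP; right.
    by rewrite !inE gE andbT; apply/andP; split; apply: contraNneq wg' => ->; rewrite !inE eqxx ?orbT.
- move=> E [w z] E' [w' z'] /finset.setIdP[/few_pendantsP[sE _ _ _] _]; rewrite !finset.in_setX /= => /andP[wg _].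
  move=> /finset.setIdP[/few_pendantsP[sE' _ _ _] _] /andP[wg' _].
  rewrite /F /= => h /pair_equal_spec[/pair_equal_spec[ww zz] ee]; subst w'; move/lift_inj: zz => zz; subst z'; split=> //.
  (* The label contains [uv], and with [w] this determines the two deleted edges. *)
  have rec (D : {set {set 'I_n.+1}}) : simple_graph D -> w \in good_vertices D ->
      D = [set [set w; x] | x in uv D w] :|: core D w.
    move=> sD wD; have [_ e1 e2 e3 d2] := basic D w sD wD.
    rewrite /uv imsetU1 imset_set1; apply/setP => e; rewrite !inE (finset.setUC [set (corner D w).1]).
    have [->|ne1] := eqVneq e [set w; (corner D w).1]; first by rewrite finset.setUC e1.
    have [->|ne2] := eqVneq e [set w; (corner D w).2]; first by rewrite e2.
    by [].
  have cE : core E w = core E' w.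
    rewrite -(finset.setU1K (n2 E w sE wg)) -(finset.setU1K (n2 E' w sE' wg')) ee.
    by rewrite -ee -(finset.setU1K (n1 E w z sE wg)) h ee (setU1K (n1 E' w z sE' wg')).
  by rewrite (rec E) // (rec E') // cE ee.
Qed.

End Pendants.

(** * Vertices of small degree *)

Section Structure.
Local Open Scope nat_scope.
Local Notation subsetP := fintype.subsetP.

Lemma sum_degree (T : finType) (E : {set {set T}}) : simple_graph E -> \sum_w degree E w = 2 * #|E|.
Proof.
move=> /simple_graphP sE; rewrite mulnC -sum_nat_const.
transitivity (\sum_w \sum_(e in E) (w \in e : nat)).
  apply: eq_bigr => w _; rewrite /degree -sum1_card big_mkcond [RHS]big_mkcond /=.
  by apply: eq_bigr => e _; rewrite inE; case: (e \in E); case: (w \in e).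
rewrite exchange_big /=; apply: eq_bigr => e /sE <-; rewrite -sum1_card [RHS]big_mkcond.
by apply: eq_bigr => w _; case: (w \in e).
Qed.

Lemma card_degree1 (T : finType) (E : {set {set T}}) : simple_graph E ->
  #|[set w | degree E w == 1]| <= 2 * #|pendant_edges E|.
Proof.
move=> /simple_graphP sE; rewrite mulnC -sum_nat_const.
have sub : [set w | degree E w == 1] \subset \bigcup_(e in pendant_edges E) e.
  apply/subsetP => w; rewrite inE => /[dup] d1 /cards1P[e he].
  have : e \in [set e] by rewrite inE.
  rewrite -he inE => /andP[eE we]; apply/bigcupP; exists e => //.
  by rewrite inE eE; apply/existsP; exists w; rewrite we.
apply: leq_trans (subset_leq_card sub) _; apply: leq_trans (leq_card_bigcup _ _) _.
by apply: leq_sum => e; rewrite inE => /andP[/sE-> _].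
Qed.

Lemma pair_inj (T : finType) (a : T) : injective (fun x => [set a; x]).
Proof.
move=> x y /setP h; have := h x; have := h y; rewrite !inE !eqxx !orbT.
by case: (eqVneq y a) => [->|_] /=; case: (eqVneq x a) => [->|_] //= /eqP.
Qed.

Lemma neighbours_degree2 n (E : {set {set 'I_n}}) (a b c : 'I_n) : b != c ->
  [set a; b] \in E -> [set a; c] \in E -> degree E a < 3 ->
  forall z, edge_rel E a z -> z = b \/ z = c.
Proof.
move=> bc abE acE da z /andP[az azE].
have ne : [set a; b] != [set a; c] by rewrite (inj_eq (@pair_inj _ a)).
have sub : [set [set a; b]; [set a; c]] \subset [set e in E | a \in e].
  by rewrite finset.subUset !finset.sub1set !inE abE acE !eqxx.
have d2 : degree E a == 2.
  rewrite eqn_leq -ltnS da; apply: leq_trans (subset_leq_card sub).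
  by rewrite cards2 ne.
have aab : a \in [set a; b] by exact: set21.
have aac : a \in [set a; c] by exact: set21.
have aaz : a \in [set a; z] by exact: set21.
by have [h|h] := degree2_edges abE acE ne aab aac d2 azE aaz; [left|right]; exact: pair_inj h.
Qed.

(* In the last case the component of [w] is a triangle. *)
Lemma degree2_cases n (E : {set {set 'I_n}}) w : simple_graph E -> degree E w = 2 ->
  [\/ w \in good_vertices E, exists2 v, 3 <= degree E v & edge_rel E v w | #|comp_of E w| <= 3].
Proof.
move=> sE d2.
have /eqP/cards2P[e1 [e2 [e12 he]]] := d2.
have /andP[e1E we1] : (e1 \in E) && (w \in e1).
  by have := set21 e1 e2; rewrite -he inE.
have /andP[e2E we2] : (e2 \in E) && (w \in e2).
  by have := set22 e1 e2; rewrite -he inE.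
have other e : e \in E -> w \in e -> exists u, e = [set u; w].
  move=> eE we; have [x [y [_ exy _]]] := simple_edge_ends sE eE.
  move: we; rewrite exy !inE => /orP[]/eqP->; last by exists x.
  by exists y; rewrite finset.setUC.
have [u eu] := other _ e1E we1; have [v ev] := other _ e2E we2.
have uv : u != v by apply: contraNneq e12 => h; rewrite eu ev h.
have [wg|wg] := boolP (w \in good_vertices E); first by constructor 1.
have uvE : [set u; v] \in E.
  apply: contraNT wg => nuv; rewrite inE; apply/existsP; exists (u, v).
  by rewrite /good_corner /= uv -eu e1E finset.setUC -ev e2E nuv d2.
have uw : u != w by move: e1E; rewrite eu simple_edgeE // => /andP[].
have vw : v != w by move: e2E; rewrite ev simple_edgeE // => /andP[].
have euw : edge_rel E u w by rewrite /edge_rel uw -eu.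
have evw : edge_rel E v w by rewrite /edge_rel vw -ev.
have [du|du] := leqP 3 (degree E u); first by constructor 2; exists u.
have [dv|dv] := leqP 3 (degree E v); first by constructor 2; exists v.
constructor 3.
have sub : comp_of E w \subset [set w; u; v].
  apply/subsetP => x; rewrite inE => /connectP[q pq ->].
  have key a : path (edge_rel E) a q -> a \in [set w; u; v] -> last a q \in [set w; u; v].
    elim: {pq} q a => //= y q IH a /andP[ay pq] aS; apply: IH pq _.
    have wuE : [set w; u] \in E by rewrite finset.setUC -eu.
    have wvE : [set w; v] \in E by rewrite finset.setUC -ev.
    have uwE : [set u; w] \in E by rewrite -eu.
    have vwE : [set v; w] \in E by rewrite -ev.
    have vuE : [set v; u] \in E by rewrite finset.setUC.
    have dw : degree E w < 3 by rewrite d2.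
    have [aw|[au|av]] : a = w \/ a = u \/ a = v.
      by move: aS; rewrite !inE => /orP[/orP[]|]/eqP; auto.
    - rewrite aw in ay; rewrite !inE.
      by have [->|->] := neighbours_degree2 uv wuE wvE dw ay; rewrite eqxx ?orbT.
    - rewrite au in ay; rewrite !inE.
      have wv : w != v by rewrite eq_sym.
      by have [->|->] := neighbours_degree2 wv uwE uvE du ay; rewrite eqxx ?orbT.
    - rewrite av in ay; rewrite !inE.
      have wu : w != u by rewrite eq_sym.
      by have [->|->] := neighbours_degree2 wu vwE vuE dv ay; rewrite eqxx ?orbT.
  by apply: key pq _; rewrite !inE eqxx.
apply: leq_trans (subset_leq_card sub) _.
by rewrite -finset.setUA; apply: leq_trans (leq_card_setU _ _).1 _; rewrite cards1 cards2; case: (_ != _).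
Qed.

(** A vertex of degree 2 that is not good is charged to a neighbour of degree at least 3, which
    receives no more charges than its degree, or to its component, which has at most 3 vertices. *)
Lemma card_degree2 n (E : {set {set 'I_n}}) : simple_graph E ->
  #|[set w | degree E w == 2]| <=
    #|good_vertices E| + \sum_(v | 3 <= degree E v) degree E v + 3 * ncomp E.
Proof.
move=> sE.
pose N (v : 'I_n) : {set 'I_n} := [set w | edge_rel E v w].
pose T3 : {set 'I_n} := [set w | #|comp_of E w| <= 3].
apply: leq_trans (_ : #|good_vertices E :|: \bigcup_(v | 3 <= degree E v) N v :|: T3| <= _).
  apply/subset_leq_card/subsetP => w; rewrite inE => /eqP /(degree2_cases sE)[h|[v dv vw]|h].
  - by rewrite !finset.in_setU h.
  - rewrite !finset.in_setU; apply/orP; left; apply/orP; right.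
    by apply/bigcupP; exists v => //; rewrite inE.
  - by rewrite finset.in_setU; apply/orP; right; rewrite inE.
apply: leq_trans (leq_card_setU _ _).1 _; apply: leq_add.
  apply: leq_trans (leq_card_setU _ _).1 _; rewrite leq_add2l.
  apply: leq_trans (leq_card_bigcup _ _) _; apply: leq_sum => v _.
  have inj : {in N v &, injective (fun w => [set v; w])}.
    move=> x y; rewrite !inE => /andP[vx _] _ /setP/(_ x).
    by rewrite !inE eqxx orbT eq_sym (negbTE vx) => /esym/eqP.
  rewrite -(card_in_imset inj); apply/subset_leq_card/subsetP => e /imsetP[w].
  by rewrite inE => /andP[_ vwE] ->; rewrite inE vwE !inE eqxx.
rewrite mulnC; apply: (leq_card_fibers (f := comp_of E)) => [w _|C /imsetP[w _ ->]].
  exact: imset_f.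
have [w0 w0T|no] := pickP (fun x => (x \in T3) && (comp_of E x == comp_of E w)); last first.
  rewrite (_ : [set x in T3 | _] = finset.set0) ?cards0 //.
  by apply/setP => x; rewrite inE no inE.
case/andP: w0T => w0T /eqP <-; move: w0T; rewrite inE; apply: leq_trans.
by apply/subset_leq_card/subsetP => x; rewrite inE => /andP[_ /eqP <-]; exact: comp_of_refl.
Qed.

(** With [a] isolated vertices, [b] of degree 1 and [m] edges, the degree sum and [3 h <= S] give
    [S <= 6 (m - n) + 6 a + 3 b]. This is inserted into [card_degree2], with [h <= S / 3] and [b] at
    most twice the number of pendant edges. *)
Lemma good_vertices_many n (E : {set {set 'I_n}}) : simple_graph E ->
  9 * n <= #|good_vertices E| + 3 * ncomp E + 9 * #|isolated E| + 10 * #|pendant_edges E| + 8 * #|E|.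
Proof.
move=> sE.
set S := \sum_(v | 3 <= degree E v) degree E v.
pose h := \sum_(v | 3 <= degree E v) 1.
have c2 := card_degree2 sE; rewrite -/S in c2.
have c1 := card_degree1 sE.
have hS : 3 * h <= S by rewrite /h big_distrr /=; apply: leq_sum => v; rewrite muln1.
have ind k : #|[set w | degree E w == k]| = \sum_w (degree E w == k : nat).
  by rewrite -sum1_card big_mkcond; apply: eq_bigr => w _; rewrite inE; case: (_ == _).
have cn : n = #|isolated E| + #|[set w | degree E w == 1]| + #|[set w | degree E w == 2]| + h.
  rewrite /isolated !ind /h [X in _ + X]big_mkcond -!big_split /= -[LHS]card_ord -sum1_card.
  by apply: eq_bigr => w _; case: (degree E w) => [|[|[|]]].
have cm : 2 * #|E| = #|[set w | degree E w == 1]| + 2 * #|[set w | degree E w == 2]| + S.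
  rewrite -sum_degree // !ind /S [X in _ + X]big_mkcond big_distrr -!big_split /=.
  by apply: eq_bigr => w _; case: (degree E w) => [|[|[|]]].
move: c2 c1 hS cn cm; move: (#|isolated E|) (#|[set w | degree E w == 1]|) (#|[set w | degree E w == 2]|).
move: (#|good_vertices E|) (ncomp E) (#|pendant_edges E|) (#|E|) => g k p m a b c; lia.
Qed.

End Structure.

Section Counts.
Local Open Scope nat_scope.
Local Notation subsetP := fintype.subsetP.
Variable R : realType.

(** Iteration of [comp_graphs_step]: a graph with [m.+1] edges exists only if [m.+1 <= 8 * n], so
    each step costs at most [2 * 8], and the factors [k.+1] make up the factorial. *)
Lemma card_comp_graphs k n m : 0 < n ->
  #|comp_graphs R k.+1 n m| * k`! <= 16 ^ k * #|conn_graphs R n (m + k)|.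
Proof.
move=> n0; elim: k m => [|k IH] m; first by rewrite comp_graphs1 // addn0 muln1 mul1n.
have h : #|comp_graphs R k.+2 n m| * k.+1 <= 16 * #|comp_graphs R k.+1 n m.+1|.
  have st := comp_graphs_step R k n m.
  have [Y0|/card_gt0P[E]] := posnP #|comp_graphs R k.+1 n m.+1|.
    move: st; rewrite Y0 mul0n muln0 leqn0 !muln_eq0 /= orbF (gtn_eqF n0) orbF => /eqP->.
    by rewrite mul0n.
  move=> /finset.setIdP[/planar_edges_le mn _]; rewrite -(leq_pmul2l n0).
  apply: leq_trans (_ : #|comp_graphs R k.+1 n m.+1| * (2 * m.+1) <= _).
    by rewrite mulnCA.
  by move: mn; clear; move: #|_| => Y mn; nia.
rewrite factS mulnA; apply: leq_trans (leq_mul h (leqnn _)) _.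
rewrite -mulnA expnS -mulnA leq_mul2l /=; have := IH m.+1; by rewrite addSnnS.
Qed.

Lemma planar_graphs_comps n m : 0 < n ->
  #|planar_graphs R n m| <= \sum_(k < n) #|comp_graphs R k.+1 n m|.
Proof.
move=> n0; apply: leq_trans (leq_card_bigcup _ _); apply/subset_leq_card/subsetP => E EP.
have c0 : 0 < ncomp E by apply: ncomp_gt0; rewrite card_ord.
have cn := ncomp_le E; rewrite card_ord in cn.
have h : (ncomp E).-1 < n by rewrite prednK.
apply/bigcupP; exists (Ordinal h) => //; apply/finset.setIdP; split=> //=.
by rewrite prednK.
Qed.

Lemma planar_graphs_mono n n' m : n <= n' -> #|planar_graphs R n m| <= #|planar_graphs R n' m|.
Proof.
move=> le; have fi : injective (widen_ord le) by move=> x y /(congr1 val) /= /val_inj.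
rewrite -(card_imset _ (gmap_inj fi)); apply/subset_leq_card/subsetP => _ /imsetP[E /planar_graphsP[sE cE pE] ->].
apply/planar_graphsP; split; [exact: simple_gmap|by rewrite card_gmap|exact: planar_relabel].
Qed.

Lemma conn_le_planar n n' m : n <= n' -> #|conn_graphs R n m| <= #|planar_graphs R n' m|.
Proof.
move=> le; apply: leq_trans (planar_graphs_mono m le).
by apply/subset_leq_card/subsetP => E /finset.setIdP[].
Qed.

(** Iteration of [attach_pendant]: of its factors [(n + i).+1 * (n + i)] the first ones build up
    [(n + k)! / n!], the second ones are bounded below by [n]. *)
Lemma attach_pendants p n m k :
  #|few_pendants R p n m| * ((n + k)`! * n ^ k) <=
    #|few_pendants R (p + k) (n + k) (m + k)| * (n`! * (2 * (p + k)) ^ k).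
Proof.
elim: k => [|k IH]; first by rewrite !addn0 !expn0.
have st := attach_pendant R (p + k) (n + k) (m + k).
rewrite !addnS factS !expnS.
move: IH st; set A := #|few_pendants R p n m|; set B := #|few_pendants R _ (n + k) _|.
set C := #|few_pendants R _ (n + k).+1 _| => IH st.
have -> : A * ((n + k).+1 * (n + k)`! * (n * n ^ k)) = A * ((n + k)`! * n ^ k) * ((n + k).+1 * n) by nia.
apply: leq_trans (leq_mul IH (leqnn _)) _.
apply: leq_trans (_ : B * ((n + k).+1 * (n + k)) * (n`! * (2 * (p + k)) ^ k) <= _).
  rewrite mulnAC leq_mul2r leq_mul2l leq_mul2l leq_addr !orbT //.
apply: leq_trans (leq_mul st (leqnn _)) _.
have : (2 * (p + k)) ^ k <= (2 * (p + k).+1) ^ k.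
  by case: (k) => // i; rewrite leq_exp2r // leq_mul2l leqnSn.
rewrite mulnA -(mulnA C) (mulnC _ n`!) -!mulnA !leq_mul2l => ->; by rewrite !orbT.
Qed.

Lemma isolated_pendant_bound n (E : {set {set 'I_n}}) : simple_graph E ->
  n <= #|E| + #|isolated E| + #|pendant_edges E|.
Proof.
move=> sE; have c1 := card_degree1 sE; have sd := sum_degree sE.
have : \sum_(w : 'I_n) 2 <= \sum_w (degree E w + ((degree E w == 0) + (degree E w == 0)) + (degree E w == 1)).
  by apply: leq_sum => w _; case: (degree E w) => [|[|k]].
have ind k : #|[set w | degree E w == k]| = \sum_w (degree E w == k : nat).
  by rewrite -sum1_card big_mkcond; apply: eq_bigr => w _; rewrite inE; case: (_ == _).
rewrite sum_nat_const card_ord !big_split /= -!ind sd -/(isolated E).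
move: c1; move: (#|isolated E|) (#|pendant_edges E|) (#|E|) (#|[set w | degree E w == 1]|) => a b c d; lia.
Qed.

End Counts.

(** * Growth of the number of connected planar graphs *)

Section Weights.
Local Open Scope ring_scope.
Local Notation subsetP := fintype.subsetP.
Variable R : realType.

Lemma expR_geXn (x : R) n : 0 <= x -> x ^+ n / n`!%:R <= expR x.
Proof.
case: n => [|n] x0; first by rewrite expr0 fact0 divr1 -expR0 ler_expR.
by apply: le_trans (expR_ge1Dxn n x0); rewrite lerDr.
Qed.

Lemma factr_gt0 n : (0 : R) < n`!%:R.
Proof. by rewrite ltr0n fact_gt0. Qed.

(* [m] is the number of edges plus one, to account for the joining edge in [cw_super]. *)
Definition cw n m : R := #|conn_graphs R n m.-1|%:R / n`!%:R.

Lemma cw_ge0 n m : 0 <= cw n m.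
Proof. by rewrite divr_ge0. Qed.

(** In [conn_superadditive] the factor [n1 * n2] must outweigh twice the number of edges, which is
    at most [16 n1 + 16 n2 + 2]. It does if [(n1 - 16) (n2 - 16) >= 258], hence the bound 33. *)
Lemma cw_super n1 m1 n2 m2 : (33 <= n1)%N -> (33 <= n2)%N -> (0 < m1)%N -> (0 < m2)%N ->
  cw n1 m1 * cw n2 m2 <= cw (n1 + n2) (m1 + m2).
Proof.
case: m1 => // m1; case: m2 => // m2 h1 h2 _ _; rewrite /cw /= addnS /=.
have key : (#|conn_graphs R n1 m1| * #|conn_graphs R n2 m2| * 'C(n1 + n2, n1)
    <= #|conn_graphs R (n1 + n2) (m1.+1 + m2)|)%N.
  have st := conn_superadditive R m1 m2 (leq_trans (isT : 0 < 33)%N h1) (leq_trans (isT : 0 < 33)%N h2).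
  have [->//|/card_gt0P[E1 /finset.setIdP[/planar_edges_le l1 _]]] := posnP #|conn_graphs R n1 m1|.
  have [->|/card_gt0P[E2 /finset.setIdP[/planar_edges_le l2 _]]] := posnP #|conn_graphs R n2 m2|.
    by rewrite muln0.
  have n12 : (0 < n1 * n2)%N by nia.
  rewrite -(leq_pmul2r n12); apply: leq_trans st _.
  rewrite addSn leq_mul2l; apply/orP; right; clear -h1 h2 l1 l2; nia.
have f : (n1 + n2)`!%:R = 'C(n1 + n2, n1)%:R * n1`!%:R * n2`!%:R :> R.
  by rewrite -(bin_fact (leq_addr n2 n1)) addKn !natrM mulrA.
have b0 : (0 : R) < 'C(n1 + n2, n1)%:R by rewrite ltr0n bin_gt0 leq_addr.
have f1 := factr_gt0 n1; have f2 := factr_gt0 n2.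
rewrite f ler_pdivlMr ?mulr_gt0 //; move: key; rewrite -(ler_nat R) !natrM; apply: le_trans.
set c1 := #|_|%:R; set c2 := #|_|%:R; rewrite le_eqVlt; apply/orP; left; apply/eqP.
by move: f1 f2; set x := n1`!%:R; set y := n2`!%:R => x0 y0; field; rewrite !gt_eqF.
Qed.

Lemma cw_ub : exists2 C : R, 1 <= C & forall n m, cw n m <= C ^+ n.
Proof.
have [K hK] : exists K : nat, forall n m, (#|planar_graphs R n m| <= (K.+1 * n) ^ n)%N.
  (* Taken from an existential, [k] is abstract, so [2 ^ k] is never evaluated. *)
  have [k hk] : exists k, (131 * 1100 <= k)%N by exists (131 * 1100)%N.
  exists (2 ^ k).-1 => n m; rewrite prednK ?expn_gt0 //; exact: card_planar_graphs.
exists (K.+1%:R * expR 1).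
  by rewrite -[X in X <= _]mulr1; apply: ler_pM => //; rewrite ?ler1n // -expR0 ler_expR.
move=> n m; rewrite /cw exprMn -expRM_natl mulr1 ler_pdivrMr ?factr_gt0 //.
apply: le_trans (_ : (#|planar_graphs R n m.-1|%:R : R) <= _).
  by rewrite ler_nat; apply: conn_le_planar.
apply: le_trans (_ : ((K.+1 * n) ^ n)%:R <= _); first by rewrite ler_nat hK.
rewrite expnMn natrM natrX -mulrA ler_wpM2l // natrX -ler_pdivrMr ?factr_gt0 //.
exact: expR_geXn.
Qed.

(** Blocks of [s] vertices are split off by [cw_super] until fewer than [2 * s] vertices are left,
    where one connected graph gives a weight of at least [1 / (2 s)!]. *)
Lemma cw_lb s : (33 <= s)%N -> exists2 c : R, 0 < c <= 1 &
  forall n m, (s <= n)%N -> (n <= m)%N -> (s * m <= (3 * s - 6) * n)%N -> c ^+ n <= cw n m.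
Proof.
move=> s33; pose c : R := (2 * s)`!%:R^-1.
have c0 : 0 < c by rewrite invr_gt0 factr_gt0.
have c1 : c <= 1 by rewrite invf_le1 ?factr_gt0 // ler1n fact_gt0.
exists c; first by rewrite c0 c1.
have base n m : (s <= n < 2 * s)%N -> (n <= m)%N -> (m <= 3 * n - 6)%N -> c <= cw n m.
  move=> /andP[sn ns] nm m3.
  have [||E [sE cE pE conE]] := @connected_planar_exists R n m.-1; [lia|lia|].
  have h1 : (1 : R) <= #|conn_graphs R n m.-1|%:R.
    by rewrite ler1n; apply/card_gt0P; exists E; apply/conn_graphsP.
  rewrite /cw; apply: le_trans (_ : n`!%:R^-1 <= _); last first.
    by rewrite ler_peMl // invr_ge0 ltW // factr_gt0.
  by rewrite lef_pV2 ?posrE ?factr_gt0 // ler_nat leq_fact // ltnW.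
elim/ltn_ind => n IH m sn nm sm.
have [ns|ns] := ltnP n (2 * s).
  apply: le_trans (base n m _ nm _); last 2 first.
  - by rewrite sn.
  - clear -sm s33 sn; nia.
  rewrite -[X in _ <= X]expr1; apply: ler_wiXn2l => //; [exact: ltW|lia].
(* The block takes as much as it can hold but leaves at least [n - s] to the rest; so both slope
   conditions persist. *)
pose m1 := minn (3 * s - 6) (m - (n - s)).
have h1 : (s <= m1)%N by rewrite /m1; lia.
have h2 : (m1 <= 3 * s - 6)%N by rewrite /m1; lia.
have h3 : (n - s <= m - m1)%N by rewrite /m1; lia.
have h4 : (s * (m - m1) <= (3 * s - 6) * (n - s))%N.
  have [/minn_idPl e|/ltnW/minn_idPr e] := leqP (3 * s - 6) (m - (n - s)).
    rewrite /m1 e; clear -sm s33 ns; nia.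
  rewrite /m1 e (_ : m - (m - (n - s)) = n - s)%N; last by lia.
  clear -s33 ns; nia.
have b := base s m1 (ltac:(lia)) h1 h2.
have i := IH (n - s)%N (ltac:(lia)) (m - m1)%N (ltac:(lia)) h3 h4.
have e1 : (s + (n - s) = n)%N by lia.
have e2 : (m1 + (m - m1) = m)%N by lia.
have := @cw_super s m1 (n - s) (m - m1) s33 (ltac:(lia)) (ltac:(lia)) (ltac:(lia)).
rewrite e1 e2; apply: le_trans; apply: le_trans (_ : c * c ^+ (n - s) <= _).
  by rewrite -exprS; apply: ler_wiXn2l => //; [exact: ltW|lia].
by apply: ler_pM => //; [exact: ltW|apply: exprn_ge0; exact: ltW].
Qed.

End Weights.

(** * Fekete's lemma in quantitative form *)

Section Fekete.
Local Open Scope ring_scope.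
Variable R : realType.

Lemma sup_rate (a : nat -> R) (C : R) : (forall t, (0 < t)%N -> `|a t| <= C * t%:R) ->
  forall e : R, 0 < e -> exists L t0, [/\ `|L| <= C, (0 < t0)%N, (L - e) * t0%:R <= a t0 &
    forall t, (0 < t)%N -> a t <= L * t%:R].
Proof.
move=> hC e e0; pose S := [set a t.+1 / t.+1%:R | t in [set: nat]]%classic.
have inv t : (0 : R) < t.+1%:R by rewrite ltr0n.
have hS : has_sup S.
  split; first by exists (a 1%N / 1%:R); exists 0%N.
  exists C => _ [t _ <-]; rewrite ler_pdivrMr //.
  by apply: le_trans (hC t.+1 isT); exact: ler_norm.
have ub t : (0 < t)%N -> a t <= sup S * t%:R.
  case: t => // t _; rewrite -ler_pdivrMr //; apply: (sup_upper_bound hS); by exists t.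
have [_ [t0 _ <-] lt0] := sup_adherent e0 hS.
exists (sup S), t0.+1; split => //; last by rewrite -ler_pdivlMr // ltW.
have := hC 1%N isT; have := ub 1%N isT; rewrite !mulr1 !ler_norml => h1 /andP[h2 _].
rewrite (le_trans h2 h1) /=; apply: ge_sup; first by exact: hS.1.
move=> _ [t _ <-]; rewrite ler_pdivrMr //.
by apply: le_trans (hC t.+1 isT); exact: ler_norm.
Qed.

Lemma superadditive_muln (a : nat -> R) (t q r : nat) :
  (forall s t, (0 < s)%N -> (0 < t)%N -> a s + a t <= a (s + t)%N) ->
  (0 < t)%N -> (0 < r)%N -> q%:R * a t + a r <= a (q * t + r)%N.
Proof.
move=> sa t0 r0; elim: q => [|q IH]; first by rewrite mul0r add0r.
rewrite mulSn -addnA; apply: le_trans (sa t (q * t + r)%N t0 (ltn_addl _ r0)).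
by rewrite -natr1 mulrDl mul1r addrAC addrC lerD2l.
Qed.

(** A form without limits: for large [t] the rate [a t / t] is within [e] of the supremum of all
    rates, and thus at least the rate of any [s] minus [e]. *)
Lemma fekete (a : nat -> R) (C : R) :
  (forall s t, (0 < s)%N -> (0 < t)%N -> a s + a t <= a (s + t)%N) ->
  (forall t, (0 < t)%N -> `|a t| <= C * t%:R) -> forall e : R, 0 < e ->
  exists T, forall t s, (T <= t)%N -> (0 < s)%N -> a s * t%:R <= (a t + e * t%:R) * s%:R.
Proof.
move=> sa hC e e0.
have [L [t0 [LC t00 hL ub]]] := sup_rate hC (divr_gt0 e0 (ltr0n R 2)).
(* Half of [e] is spent on the choice of [t0]; the remainder modulo [t0] costs at most [2 * C * t0],
   which is at most [e * t / 2] from [T] on. *)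
pose T := (Num.truncn (4 * C * t0%:R / e)).+1.
have C0 : 0 <= C by apply: le_trans LC.
exists T => t s Tt s0.
have t1 : (0 < t)%N by apply: leq_trans Tt.
have bigt : 4 * C * t0%:R <= e * t%:R.
  by rewrite [leRHS]mulrC -ler_pdivrMr //; apply: le_trans (ltW (truncnS_gt _)) _; rewrite ler_nat.
(* Shifted by one so that [1 <= r <= t0]: superadditivity is assumed for positive arguments only. *)
set q := (t.-1 %/ t0)%N; set r := (t.-1 %% t0).+1%N.
have tqr : t = (q * t0 + r)%N by rewrite /r addnS -divn_eq prednK.
have rt0 : (r <= t0)%N by rewrite ltn_mod.
have h1 := superadditive_muln q sa t00 (ltn0Sn _ : (0 < r)%N); rewrite -tqr in h1.
have := hC r isT; rewrite ler_norml => /andP[h2 _].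
have h3 : C * r%:R <= C * t0%:R by rewrite ler_wpM2l // ler_nat.
have h4 : q%:R * ((L - e / 2) * t0%:R) <= q%:R * a t0 by rewrite ler_wpM2l.
have h5 : t%:R = q%:R * t0%:R + r%:R :> R by rewrite [in LHS]tqr natrD natrM.
have h6 : L * r%:R <= C * r%:R.
  by rewrite ler_wpM2r //; apply: le_trans LC; exact: ler_norm.
have r0 : 0 <= e * r%:R by rewrite mulr_ge0 // ltW.
have key : L * t%:R <= a t + e * t%:R.
  have e1 : q%:R * ((L - e / 2) * t0%:R) = (L - e / 2) * (t%:R - r%:R) by rewrite h5; ring.
  rewrite e1 in h4; have h7 : (L - e / 2) * (t%:R - r%:R) = L * t%:R - L * r%:R - e * t%:R / 2 + e * r%:R / 2.
    by field.
  rewrite h7 in h4; lra.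
apply: le_trans (_ : L * s%:R * t%:R <= _); first by rewrite ler_wpM2r // ub.
by rewrite mulrAC ler_wpM2r.
Qed.

Lemma uniform_threshold (P : nat -> nat -> Prop) M :
  (forall p T T', (T <= T')%N -> P p T -> P p T') ->
  (forall p, (p < M)%N -> exists T, P p T) -> exists T, forall p, (p < M)%N -> P p T.
Proof.
move=> mono; elim: M => [|M IH] h; first by exists 0%N.
have [|T hT] := IH; first by move=> p pM; apply: h; exact: ltnW.
have [T' hT'] := h M (ltnSn M).
exists (maxn T T') => p; rewrite ltnS leq_eqVlt => /orP[/eqP->|pM].
  by apply: mono hT'; exact: leq_maxr.
by apply: mono (hT p pM); exact: leq_maxl.
Qed.

Lemma cw_bounds s : (33 <= s)%N -> exists2 C : R, 0 < C & (forall n m, cw R n m <= expR (C * n%:R)) /\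
  forall n m, (s <= n)%N -> (n <= m)%N -> (s * m <= (3 * s - 6) * n)%N -> expR (- (C * n%:R)) <= cw R n m.
Proof.
move=> s33; have [A A1 hA] := cw_ub R; have [c /andP[c0 c1] hc] := cw_lb R s33.
have A0 : 0 < A by apply: lt_le_trans A1.
have lA : 0 <= ln A by rewrite ln_ge0.
have lc : ln c <= 0 by rewrite ln_le0.
exists (1 + ln A - ln c); first by lra.
split=> [n m|n m h1 h2 h3].
  apply: le_trans (hA n m) _; rewrite -{1}(lnK A0) -expRM_natr ler_expR ler_wpM2r //; lra.
apply: le_trans (hc n m h1 h2 h3); rewrite -{2}(lnK c0) -expRM_natr -mulNr ler_expR ler_wpM2r //; lra.
Qed.

Lemma cw_fekete s r p : (33 <= s)%N -> (s <= r)%N -> (r <= p)%N -> (s * p <= (3 * s - 6) * r)%N ->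
  forall e : R, 0 < e -> exists T, forall t u, (T <= t)%N -> (0 < u)%N ->
    ln (cw R (r * u) (p * u)) * t%:R <= (ln (cw R (r * t) (p * t)) + e * t%:R) * u%:R.
Proof.
move=> s33 sr rp sp e e0; have [C C0 [ub lb]] := cw_bounds s33.
have lb' t : (0 < t)%N -> expR (- (C * (r * t)%:R)) <= cw R (r * t) (p * t).
  move=> t0; apply: lb; [|by rewrite leq_mul2r rp orbT|by rewrite !mulnA leq_mul2r sp orbT].
  by apply: leq_trans sr _; rewrite leq_pmulr.
have pos t : (0 < t)%N -> 0 < cw R (r * t) (p * t).
  by move=> /lb'; apply: lt_le_trans; exact: expR_gt0.
apply: (@fekete (fun t => ln (cw R (r * t) (p * t))) (C * r%:R)) => // [t1 t2 h1 h2|t t0].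
  rewrite -lnM ?posrE ?pos // ler_ln; last 2 first.
  - by rewrite posrE; exact: mulr_gt0 (pos _ h1) (pos _ h2).
  - by rewrite posrE pos // addn_gt0 h1.
  rewrite !mulnDr; apply: cw_super; rewrite ?muln_gt0 ?h1 ?h2 ?andbT; try lia.
  - by apply: leq_trans s33 (leq_trans sr _); rewrite leq_pmulr.
  - by apply: leq_trans s33 (leq_trans sr _); rewrite leq_pmulr.
rewrite ler_norml -mulrA -natrM /=; apply/andP; split.
  by rewrite -[X in X <= _]expRK ler_ln ?posrE ?expR_gt0 ?pos ?lb'.
by rewrite -[X in _ <= X]expRK ler_ln ?posrE ?expR_gt0 ?pos ?ub.
Qed.

End Fekete.

Section Growth.
Local Open Scope ring_scope.
Variable R : realType.

(** The fillers [(n1, m1)] and [(n2, m2)] have size of order [th n]. The perturbations [k], [j] are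
    at most [d n], and rounding [mu r] to [p] costs at most [t] or [u], hence at most [2 d n]. As
    [th n = 8 d n / g], the ratio [m / n] of a filler differs little enough from [mu] to stay
    between 1 and [B + g]. *)
Lemma filler_bounds (n mu k j t u p r d th g e B : R) :
  0 < n -> 1 + e <= mu -> mu <= B -> B <= 3 -> p <= mu * r -> mu * r <= p + 1 -> 0 <= t -> 0 <= u ->
  r * t <= (1 - th) * n -> (1 - th) * n <= r * t + r ->
  (1 + th) * n <= r * u -> r * u <= (1 + th) * n + r ->
  0 <= k -> k <= d * n -> 0 <= j -> j <= d * n ->
  g * th = 8 * d -> 0 < g -> g <= 1 -> g <= e -> 0 <= th -> th <= 2^-1 ->
  0 < d -> d <= 4^-1 -> 1 <= d * r -> 3 * r <= d * n ->
  let n1 := n - r * t in let m1 := mu * n - p * t in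
  let n2 := r * u - n - k in let m2 := p * u - mu * n - k - j in
  [/\ [/\ th * n <= n1, n1 <= 2 * (th * n), n1 <= m1 & m1 <= (B + g) * n1],
      [/\ d * n <= n2, n2 <= 2 * (th * n), n2 <= m2 & m2 <= (B + g) * n2] &
      r * (u - t) <= 3 * (th * n) /\ d * u <= d * n].
Proof.
move=> n0 mul muB B3 pl pu t0 u0 tl tu ul uu k0 kd j0 jd gth g0 g1 ge th0 th1 d0 d1 dr rd.
have dn0 : 0 < d * n by exact: mulr_gt0.
have thn : 8 * (d * n) <= th * n.
  by rewrite mulrA ler_pM2r // -gth -[leRHS]mul1r ler_wpM2r.
have thn1 : th * n <= 2^-1 * n by rewrite ler_pM2r.
have dn1 : d * n <= 4^-1 * n by rewrite ler_pM2r.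
have e1 : (1 + th) * n = n + th * n by ring.
have e2 : (1 - th) * n = n - th * n by ring.
rewrite e1 in ul uu; rewrite e2 in tl tu.
have tdn : t <= d * n.
  apply: le_trans (_ : d * r * t <= _); first by rewrite ler_peMl.
  by rewrite -mulrA ler_wpM2l ?ltW //; lra.
have udn : u <= 2 * (d * n).
  apply: le_trans (_ : d * r * u <= _); first by rewrite ler_peMl.
  by rewrite -mulrA (mulrCA 2) ler_pM2l //; lra.
move=> n1 m1 n2 m2; split.
- have h1 : p * t <= mu * r * t by rewrite ler_wpM2r.
  have h2 : mu * r * t <= (p + 1) * t by rewrite ler_wpM2r.
  have n1l : th * n <= n1 by rewrite /n1; lra.
  have n1' : 0 <= n1 by apply: le_trans n1l; rewrite mulr_ge0 // ltW.
  have e3 : mu * n1 = mu * n - mu * r * t by rewrite /n1; ring.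
  have e4 : (p + 1) * t = p * t + t by ring.
  have h3 : mu * n1 <= B * n1 by rewrite ler_wpM2r.
  have h4 : 1 * n1 <= mu * n1 by rewrite ler_wpM2r //; lra.
  have h5 : g * (th * n) <= g * n1 by rewrite ler_wpM2l // ltW.
  have e5 : g * (th * n) = 8 * (d * n) by rewrite mulrA gth; ring.
  have e6 : (B + g) * n1 = B * n1 + g * n1 by ring.
  rewrite e6 /m1; split => //; first by rewrite /n1; lra.
    by lra.
  by lra.
- have h1 : p * u <= mu * r * u by rewrite ler_wpM2r.
  have h2 : mu * r * u <= (p + 1) * u by rewrite ler_wpM2r.
  have a1 : 7 * (d * n) <= n2 by rewrite /n2; lra.
  have a0 : 0 <= n2 by lra.
  have e3 : mu * n2 = mu * r * u - mu * n - mu * k by rewrite /n2; ring.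
  have e4 : (p + 1) * u = p * u + u by ring.
  have mk : mu * k <= 3 * k by rewrite ler_wpM2r //; lra.
  have mk' : 1 * k <= mu * k by rewrite ler_wpM2r //; lra.
  have h3 : mu * n2 <= B * n2 by rewrite ler_wpM2r.
  have h4 : (1 + e) * n2 <= mu * n2 by rewrite ler_wpM2r.
  have h4' : (1 + e) * n2 = n2 + e * n2 by ring.
  have h5 : g * (th * n - d * n) <= g * n2 by rewrite ler_wpM2l ?(ltW g0) // /n2; lra.
  have e5 : g * (th * n - d * n) = 8 * (d * n) - g * (d * n) by rewrite mulrBr (mulrA g th) gth -mulrA.
  have gd : g * (d * n) <= 1 * (d * n) by rewrite ler_wpM2r // ltW.
  have h6 : g * n2 <= e * n2 by rewrite ler_wpM2r.
  have e6 : (B + g) * n2 = B * n2 + g * n2 by ring.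
  rewrite e6; split; first by lra.
  + by rewrite /n2; lra.
  + by rewrite /m2; lra.
  + by rewrite /m2; lra.
- split; first by rewrite mulrBr; lra.
  by rewrite ler_wpM2l ?(ltW d0) //; lra.
Qed.

Lemma exponent_bound (au at_ C r t u e : R) : 0 < t -> t <= u -> 0 <= e -> at_ <= C * r * t ->
  au * t <= (at_ + e * t) * u -> au <= at_ + C * (r * (u - t)) + e * u.
Proof.
move=> t0 tu e0 h1 h2; rewrite -(ler_pM2r t0); apply: le_trans h2 _.
have : at_ * (u - t) <= C * r * t * (u - t) by rewrite ler_wpM2r // subr_ge0.
have -> : (at_ + e * t) * u = at_ * t + at_ * (u - t) + e * t * u by ring.
have -> : (at_ + C * (r * (u - t)) + e * u) * t = at_ * t + C * r * t * (u - t) + e * t * u by ring.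
by move=> h; rewrite !lerD2r lerD2l.
Qed.

(** The condition on [s] says that [(3 + B) / 2 <= 3 - 6 / s]. *)
Lemma slope_bound (s n m : nat) (b B : R) : (6 <= s)%N -> 0 < B -> 12 <= s%:R * (3 - B) -> b <= (3 + B) / 2 ->
  m%:R <= b * n%:R -> (s * m <= (3 * s - 6) * n)%N.
Proof.
move=> s6 B0 sB bB mb; rewrite -(ler_nat R) !natrM natrB; last by lia.
rewrite natrM; apply: le_trans (_ : s%:R * (b * n%:R) <= _); first by rewrite ler_wpM2l.
rewrite mulrA ler_wpM2r //; apply: le_trans (_ : s%:R * ((3 + B) / 2) <= _); first by rewrite ler_wpM2l.
have -> : s%:R * ((3 + B) / 2) = 3 * s%:R - s%:R * (3 - B) / 2 :> R by field.
by lra.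
Qed.

(* Both points are completed to multiples of a block [(r, p)] with [p / r] close to
   [m / n], and [cw_fekete] compares these multiples. The completions have size
   [O(d n)], so [C1] does not depend on [d]. *)
Lemma cw_growth (e B : R) : 0 < e -> e <= 1 -> 0 < B -> B < 3 -> exists C1 d0 : R,
  [/\ 0 <= C1, 0 < d0 & forall d, 0 < d -> d <= d0 -> exists n0 : nat, forall n m k j : nat, (n0 <= n)%N ->
     (1 + e) * n%:R <= m%:R -> m%:R <= B * n%:R -> k%:R <= d * n%:R -> j%:R <= d * n%:R ->
     cw R (n + k) (m + k + j) <= expR (C1 * (d * n%:R)) * cw R n m].
Proof.
move=> e0 e1 B0 B3; pose g := Num.min e ((3 - B) / 2).
have g0 : 0 < g by rewrite lt_min e0 /=; lra.
have ge : g <= e by rewrite ge_min lexx.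
have g1 : g <= 1 by apply: le_trans ge e1.
have gB : g <= (3 - B) / 2 by rewrite ge_min lexx orbT.
have Bg : B + g <= (3 + B) / 2 by clear -gB; lra.
pose s := maxn 33 (Num.truncn (12 / (3 - B))).+1.
have s33 : (33 <= s)%N by exact: leq_maxl.
have sB : 12 <= s%:R * (3 - B).
  rewrite -ler_pdivrMr; last by clear -B3; lra.
  by apply: le_trans (ltW (truncnS_gt _)) _; rewrite ler_nat leq_maxr.
have slope (n m : nat) : m%:R <= (B + g) * n%:R -> (s * m <= (3 * s - 6) * n)%N.
  by apply: (@slope_bound s n m (B + g) B) => //; apply: leq_trans s33.
have [C C0 [ub lb]] := cw_bounds R s33.
(* In units of [C * th * n] the distance between the two multiples costs 3 and each filler 2, with
   [th = 8 * d / g]; the summand 1 is the error in [cw_fekete]. The bound [g / 16] on [d] gives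
   [th <= 1 / 2]. *)
pose C1 := 7 * C * (8 / g) + 1; exists C1, (g / 16); split.
- by rewrite addr_ge0 // !mulr_ge0 ?invr_ge0 ?ltW.
- by rewrite divr_gt0.
move=> d d0 dg; pose th := 8 / g * d.
have gth : g * th = 8 * d by rewrite /th; field; rewrite gt_eqF.
have th0 : 0 <= th by rewrite !mulr_ge0 ?invr_ge0 ?ltW.
have th1 : th <= 2^-1 by rewrite -(ler_pM2l g0) gth; clear -dg; lra.
have d1 : d <= 4^-1 by clear -dg g1; lra.
pose r := maxn s (Num.truncn (1 / d)).+1.
have sr : (s <= r)%N by exact: leq_maxl.
have r33 : (33 <= r)%N by apply: leq_trans sr.
have r0 : 0 < r%:R :> R by rewrite ltr0n; apply: leq_trans r33.
have dr : 1 <= d * r%:R.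
  rewrite mulrC -ler_pdivrMr //; apply: le_trans (ltW (truncnS_gt _)) _.
  by rewrite ler_nat leq_maxr.
pose P p T := (r <= p)%N -> (s * p <= (3 * s - 6) * r)%N -> forall t u, (T <= t)%N -> (0 < u)%N ->
    ln (cw R (r * u) (p * u)) * t%:R <= (ln (cw R (r * t) (p * t)) + d * t%:R) * u%:R.
(* [p] will depend on [n] and [m], but takes finitely many values, so one threshold serves all. *)
have [T hT] : exists T, forall p, (p < (3 * r).+1)%N -> P p T.
  apply: uniform_threshold => [p T T' TT' h rp sp t u Tt|p _].
    exact: (h rp sp t u (leq_trans TT' Tt)).
  have [rp|rp] := boolP (r <= p)%N; last by exists 0%N => rp'; rewrite rp' in rp.
  have [sp|sp] := boolP (s * p <= (3 * s - 6) * r)%N; last by exists 0%N => _ sp'; rewrite sp' in sp.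
  by have [T hT] := cw_fekete s33 sr rp sp d0; exists T => _ _.
exists (maxn (Num.truncn ((3 * r + s)%:R / d)).+1 (2 * r * (T + 2))) => n m k j.
rewrite geq_max => /andP[nd nT] ml mu kd jd.
have n0 : 0 < n%:R :> R by rewrite ltr0n; apply: leq_trans nd.
have rd' : (3 * r + s)%:R <= d * n%:R.
  rewrite [leRHS]mulrC -ler_pdivrMr //; apply: le_trans (ltW (truncnS_gt _)) _.
  by rewrite ler_nat.
have rd : 3 * r%:R <= d * n%:R by apply: le_trans rd'; rewrite natrD natrM lerDl.
have sd : s%:R <= d * n%:R by apply: le_trans rd'; rewrite ler_nat leq_addl.
pose t := Num.truncn ((1 - th) * n%:R / r%:R); pose u := (Num.truncn ((1 + th) * n%:R / r%:R)).+1.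
pose p := (m * r %/ n)%N; pose x : R := m%:R / n%:R.
have xn : x * n%:R = m%:R by rewrite /x mulfVK // gt_eqF.
have tth : 0 <= (1 - th) * n%:R by rewrite mulr_ge0 // ?ltW //; clear -th1; lra.
have tl : r%:R * t%:R <= (1 - th) * n%:R.
  by rewrite mulrC -ler_pdivlMr //; rewrite truncn_le divr_ge0 // ltW.
have tu : (1 - th) * n%:R <= r%:R * t%:R + r%:R.
  have -> : r%:R * t%:R + r%:R = r%:R * t.+1%:R :> R by rewrite -natr1 mulrDr mulr1.
  by rewrite [leRHS]mulrC -ler_pdivrMr //; exact: ltW (truncnS_gt _).
have ul : (1 + th) * n%:R <= r%:R * u%:R.
  by rewrite [leRHS]mulrC -ler_pdivrMr //; exact: ltW (truncnS_gt _).
have uu : r%:R * u%:R <= (1 + th) * n%:R + r%:R.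
  rewrite /u -natr1 mulrDr mulr1 lerD2r mulrC -ler_pdivlMr //; rewrite truncn_le.
  by rewrite divr_ge0 ?mulr_ge0 ?addr_ge0 // ltW.
have pl : p%:R <= x * r%:R.
  by rewrite /x mulrAC ler_pdivlMr // -!natrM ler_nat leq_trunc_div.
have pu : x * r%:R <= p%:R + 1.
  rewrite /x mulrAC ler_pdivrMr // natr1 -!natrM ler_nat; apply: ltnW; rewrite ltn_ceil //.
  by rewrite -(ltr0n R).
have xl : 1 + e <= x by rewrite /x ler_pdivlMr.
have xB : x <= B by rewrite /x ler_pdivrMr.
have [] := filler_bounds n0 xl xB (ltW B3) pl pu (ler0n _ t) (ler0n _ u) tl tu ul uu
  (ler0n _ k) kd (ler0n _ j) jd gth g0 g1 ge th0 th1 d0 d1 dr rd.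
rewrite xn => -[a1 a2 a3 a4] [b1 b2 b3 b4] [c1 c2].
have thn0 : 0 <= th * n%:R by rewrite mulr_ge0 // ltW.
have n1_0 := le_trans thn0 a1; have m1_0 := le_trans n1_0 a3.
have dn0 : 0 <= d * n%:R by rewrite mulr_ge0 // ltW.
have n2_0 := le_trans dn0 b1; have m2_0 := le_trans n2_0 b3.
have rtn : (r * t <= n)%N by rewrite -(ler_nat R) natrM -subr_ge0.
have ptm : (p * t <= m)%N by rewrite -(ler_nat R) natrM -subr_ge0.
have nru : (n + k <= r * u)%N by rewrite -(ler_nat R) natrM natrD -subr_ge0 opprD addrA.
have mpu : (m + k + j <= p * u)%N by rewrite -(ler_nat R) natrM !natrD -subr_ge0 !opprD !addrA.
have n1E : (n - r * t)%:R = n%:R - r%:R * t%:R :> R by rewrite natrB // natrM.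
have m1E : (m - p * t)%:R = m%:R - p%:R * t%:R :> R by rewrite natrB // natrM.
have n2E : (r * u - (n + k))%:R = r%:R * u%:R - n%:R - k%:R :> R.
  by rewrite natrB // natrM natrD opprD addrA.
have m2E : (p * u - (m + k + j))%:R = p%:R * u%:R - m%:R - k%:R - j%:R :> R.
  by rewrite natrB // natrM !natrD !opprD !addrA.
rewrite -n1E in a1 a2 a3 a4 n1_0; rewrite -m1E in a3 a4 m1_0.
rewrite -n2E in b1 b2 b3 b4 n2_0; rewrite -m2E in b3 b4 m2_0.
have sn1 : (s <= n - r * t)%N.
  rewrite -(ler_nat R); apply: le_trans sd (le_trans _ a1).
  rewrite ler_pM2r // -(ler_pM2l g0) gth; clear -d0 g1 g0; nra.
have sn2 : (s <= r * u - (n + k))%N by rewrite -(ler_nat R); exact: le_trans sd b1.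
have nm1 : (n - r * t <= m - p * t)%N by rewrite -(ler_nat R).
have nm2 : (r * u - (n + k) <= p * u - (m + k + j))%N by rewrite -(ler_nat R).
have lb1 := lb _ _ sn1 nm1 (slope _ _ a4).
have lb2 := lb _ _ sn2 nm2 (slope _ _ b4).
have n0N : (0 < n)%N by rewrite -(ltr0n R).
have nm : (n <= m)%N.
  by rewrite -(ler_nat R); apply: le_trans ml; rewrite mulrDl mul1r lerDl mulr_ge0 // ltW.
have rp : (r <= p)%N.
  by rewrite /p leq_divRL // mulnC leq_mul2r nm orbT.
have pB : p%:R <= B * r%:R by apply: le_trans pl _; rewrite ler_wpM2r // ltW.
have p3 : (p < (3 * r).+1)%N.
  by rewrite ltnS -(ler_nat R) natrM; apply: le_trans pB _; rewrite ler_wpM2r ?ltW.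
have sp : (s * p <= (3 * s - 6) * r)%N.
  by apply: slope; apply: le_trans pB _; rewrite ler_wpM2r ?ltW // ltrDl.
have Tt : (T < t)%N.
  have : (2 * r * (T + 2))%:R <= 2 * (r%:R * t%:R + r%:R) :> R.
    apply: le_trans (_ : n%:R <= _); first by rewrite ler_nat.
    apply: le_trans (_ : 2 * ((1 - th) * n%:R) <= _); last by rewrite ler_pM2l.
    by rewrite mulrA ler_peMl ?(ltW n0) //; clear -th1; lra.
  rewrite -natrM -natrD -natrM ler_nat -mulnA leq_pmul2l // (addnC (r * t)%N) -mulnS leq_pmul2l; last by rewrite -(ltr0n R).
  by rewrite addn2 ltnS.
have tu' : (t <= u)%N.
  rewrite /t /u; apply/ltnW; rewrite ltnS; apply: le_truncn.
  rewrite ler_pM2r ?invr_gt0 // ler_pM2r //; clear -th0; lra.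
have t0 : 0 < t%:R :> R by rewrite ltr0n; apply: leq_trans Tt.
have pos i : (0 < i)%N -> 0 < cw R (r * i) (p * i).
  move=> i0; apply: lt_le_trans (expR_gt0 _) (lb _ _ _ _ _).
  - by apply: leq_trans sr _; rewrite leq_pmulr.
  - by rewrite leq_mul2r rp orbT.
  - by rewrite !mulnA leq_mul2r sp orbT.
have post : 0 < cw R (r * t) (p * t) by apply: pos; rewrite -(ltr0n R).
have posu : 0 < cw R (r * u) (p * u) by apply: pos.
have at_ub : ln (cw R (r * t) (p * t)) <= C * r%:R * t%:R.
  by rewrite -[leRHS]expRK ler_ln ?posrE ?expR_gt0 // -mulrA -natrM.
have tuR : t%:R <= u%:R :> R by rewrite ler_nat.
have fek := exponent_bound t0 tuR (ltW d0) at_ub (hT p p3 rp sp t u (ltnW Tt) isT).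
have t1 : (0 < t)%N by apply: leq_ltn_trans Tt.
have n33 : (33 <= n)%N.
  by apply: leq_trans nT; rewrite mulnAC -[33%N]mul1n leq_mul // muln_gt0 addn_gt0 orbT.
have s1 : (0 < s)%N by apply: leq_trans s33.
(* The larger point plus a filler is the upper multiple; in [fill1] the lower multiple plus a filler
   is [(n, m)]. *)
have fill2 : cw R (n + k) (m + k + j) * expR (- (C * (r * u - (n + k))%:R)) <= cw R (r * u) (p * u).
  apply: le_trans (_ : cw R (n + k) (m + k + j) * cw R (r * u - (n + k)) (p * u - (m + k + j)) <= _).
    by rewrite ler_wpM2l // cw_ge0.
  apply: le_trans (cw_super _ _ _ _ _) _; last by rewrite !subnKC.
  - exact: leq_trans n33 (leq_addr _ _).
  - exact: leq_trans s33 sn2.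
  - by rewrite !addn_gt0 (leq_trans n0N nm).
  - exact: leq_trans s1 (leq_trans sn2 nm2).
have fill1 : cw R (r * t) (p * t) * expR (- (C * (n - r * t)%:R)) <= cw R n m.
  apply: le_trans (_ : cw R (r * t) (p * t) * cw R (n - r * t) (m - p * t) <= _).
    by rewrite ler_wpM2l // cw_ge0.
  apply: le_trans (cw_super _ _ _ _ _) _; last by rewrite !subnKC.
  - by apply: leq_trans r33 _; rewrite leq_pmulr.
  - exact: leq_trans s33 sn1.
  - by rewrite muln_gt0 t1 andbT; apply: leq_trans rp; apply: leq_trans r33.
  - exact: leq_trans s1 (leq_trans sn1 nm1).
rewrite -[in X in _ <= X](lnK posu) expRN ler_pdivrMr ?expR_gt0 // -expRD in fill2.
rewrite -[in X in X <= _](lnK post) -expRD in fill1.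
apply: le_trans fill2 _.
have -> : C1 * (d * n%:R) = 7 * C * (th * n%:R) + d * n%:R.
  by rewrite /C1 /th; ring.
set W := ln (cw R (r * t) (p * t)) in fek fill1 *.
apply: le_trans (_ : expR (7 * C * (th * n%:R) + d * n%:R) * expR (W + - (C * (n - r * t)%:R)) <= _); last first.
  by rewrite ler_pM2l ?expR_gt0.
rewrite -expRD ler_expR.
have h1 : C * (r%:R * (u%:R - t%:R)) <= C * (3 * (th * n%:R)) by rewrite ler_pM2l.
have h2 : C * (r * u - (n + k))%:R <= C * (2 * (th * n%:R)) by rewrite ler_pM2l.
have h3 : C * (n - r * t)%:R <= C * (2 * (th * n%:R)) by rewrite ler_pM2l.
move: fek h1 h2 h3 c2; clear.
set x1 := C * (n - r * t)%:R; set x2 := C * (r * u - (n + k))%:R; set x3 := C * (_ * (_ - _)).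
set x4 := ln _; set x5 := d * u%:R; set x6 := d * n%:R.
have -> : C * (3 * (th * n%:R)) = 3 * (C * (th * n%:R)) by ring.
have -> : C * (2 * (th * n%:R)) = 2 * (C * (th * n%:R)) by ring.
have -> : 7 * C * (th * n%:R) = 7 * (C * (th * n%:R)) by ring.
move: x1 x2 x3 x4 x5 x6 (C * (th * n%:R)) => x1 x2 x3 x4 x5 x6 x7 *; lra.
Qed.

End Growth.

(** * The dense and the sparse case *)

Section Dense.
Local Open Scope ring_scope.
Variable R : realType.

Lemma planar_weight_le n m (X : R) : (0 < n)%N ->
  (forall k, (k < n)%N -> 16 ^+ k / k`!%:R * cw R n (m + k).+1 <= X) ->
  #|planar_graphs R n m|%:R <= n%:R * n`!%:R * X.
Proof.
move=> n0 h; apply: le_trans (_ : (\sum_(k < n) #|comp_graphs R k.+1 n m|)%:R <= _).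
  by rewrite ler_nat planar_graphs_comps.
rewrite natr_sum; apply: le_trans (_ : \sum_(k < n) n`!%:R * X <= _); last first.
  by rewrite sumr_const card_ord -[leLHS]mulr_natl mulrA.
apply: ler_sum => k _; have := card_comp_graphs R k m n0.
rewrite -(ler_nat R) !natrM -ler_pdivlMr ?factr_gt0 // => le; apply: le_trans le _.
apply: le_trans (_ : n`!%:R * (16 ^+ k / k`!%:R * cw R n (m + k).+1) <= _); last first.
  by rewrite ler_wpM2l // h.
rewrite /cw /= natrX le_eqVlt; apply/orP; left; apply/eqP.
by field; rewrite !gt_eqF ?factr_gt0.
Qed.

(** One term of the exponential series of [16 * expR L]. *)
Lemma geo_fact_le (L : R) k : 16 ^+ k / k`!%:R <= expR (16 * expR L - L * k%:R).
Proof.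
rewrite expRD expRN ler_pdivlMr ?expR_gt0 // expRM_natr mulrAC -exprMn.
by apply: expR_geXn; rewrite mulr_ge0 ?expR_ge0.
Qed.

Lemma linear_le_expR (c d : R) : 0 <= c -> 0 < d ->
  exists n0 : nat, forall n : nat, (n0 <= n)%N -> c * n%:R <= expR (d * n%:R).
Proof.
move=> c0 d0; exists (Num.truncn (2 * c / d ^+ 2)).+1 => n hn.
have n0 : 0 < n%:R :> R by rewrite ltr0n; apply: leq_trans hn.
have h : 2 * c <= n%:R * d ^+ 2.
  rewrite -ler_pdivrMr ?exprn_gt0 //; apply: le_trans (ltW (truncnS_gt _)) _; by rewrite ler_nat.
apply: le_trans (expR_geXn 2 _); last by rewrite mulr_ge0 // ltW.
rewrite ler_pdivlMr ?factr_gt0 // exprMn; have -> : 2`! = 2%N by [].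
have -> : c * n%:R * 2 = 2 * c * n%:R by ring.
have -> : d ^+ 2 * n%:R ^+ 2 = n%:R * d ^+ 2 * n%:R by ring.
by rewrite ler_pM2r.
Qed.

Lemma few_pendants_dense (e B : R) : 0 < e -> e <= 1 -> 0 < B -> B < 3 ->
  exists2 a : R, 0 < a & exists n0 : nat, forall n m p : nat, (n0 <= n)%N ->
    (1 + e) * n%:R <= m%:R -> m%:R <= B * n%:R -> p%:R <= a * n%:R ->
    #|few_pendants R p n m|%:R <= expR (- (2 * a * n%:R)) * #|planar_graphs R n m|%:R.
Proof.
(* [B'] leaves room for replacing [m] by [m.+1], the index of graphs with [m] edges in [cw]. *)
move=> e0 e1 B0 B3; pose B' := (B + 3) / 2.
have B'0 : 0 < B' by rewrite /B'; lra.
have B'3 : B' < 3 by rewrite /B'; lra.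
have [C1 [d0 [C10 d00 hC1]]] := cw_growth e0 e1 B'0 B'3.
pose s := maxn 33 (Num.truncn (12 / (3 - B'))).+1.
have s33 : (33 <= s)%N by exact: leq_maxl.
have sB : 12 <= s%:R * (3 - B').
  rewrite -ler_pdivrMr; last by clear -B'3; lra.
  by apply: le_trans (ltW (truncnS_gt _)) _; rewrite ler_nat leq_maxr.
clearbody s; have [C C0 [ub lb]] := cw_bounds R s33.
(* With [k] about [d * n], the gain [(4 * d) ^ k] beats the growth [expR (C1 * d * n)] by a factor
   [expR (- 3 * d * n)], up to a constant; a third of this exponent absorbs the constants and the
   factor [n + k]. *)
pose d := Num.min (Num.min d0 1) (expR (- (C1 + 3)) / 4).
have dpos : 0 < d by rewrite !lt_min d00 divr_gt0 ?expR_gt0 //= ltr01.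
have dd0 : d <= d0 by rewrite /d !ge_min lexx.
have d1 : d <= 1 by rewrite /d !ge_min lexx orbT.
have d4 : 4 * d <= expR (- (C1 + 3)).
  rewrite mulrC -ler_pdivlMr // /d ge_min lexx orbT //.
have [n1 hn1] := hC1 d dpos dd0.
pose L := 3 * C / d; pose Q := 16 * expR L.
have L0 : 0 <= L by rewrite !mulr_ge0 ?invr_ge0 ?ltW.
have Q16 : 16 <= Q by rewrite /Q ler_peMr // -expR0 ler_expR.
have [n2 hn2] := @linear_le_expR (2 * expR (Q + C1 + 3)) d (ltac:(by rewrite mulr_ge0 ?expR_ge0)) dpos.
exists d => //; exists (maxn (maxn n1 n2) (maxn s (Num.truncn (2 / (3 - B))).+1)) => n m p.
rewrite !geq_max => /andP[/andP[nn1 nn2] /andP[ns nB]] ml mB pd.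
have n0 : (0 < n)%N by apply: leq_trans nB.
have n0R : 0 < n%:R :> R by rewrite ltr0n.
have dn0 : 0 <= d * n%:R by rewrite mulr_ge0 // ltW.
have m1l : (1 + e) * n%:R <= m.+1%:R.
  by apply: le_trans ml _; rewrite ler_nat.
have m1B : m.+1%:R <= B' * n%:R.
  have : 2 <= (3 - B) * n%:R.
    rewrite mulrC -ler_pdivrMr; last by clear -B3; lra.
    by apply: le_trans (ltW (truncnS_gt _)) _; rewrite ler_nat.
  rewrite -natr1 /B'; move: mB; set x := n%:R; set y := m%:R.
  have -> : (3 - B) * x = 3 * x - B * x by ring.
  have -> : (B + 3) / 2 * x = (B * x + 3 * x) / 2 by ring.
  by move: (B * x) => z; clear; lra.
have nm : (n <= m.+1)%N.
  by rewrite -(ler_nat R); apply: le_trans m1l; rewrite mulrDl mul1r lerDl mulr_ge0 // ltW.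
pose k := Num.truncn (d * n%:R).
have kd : k%:R <= d * n%:R by rewrite truncn_le.
have dk : d * n%:R <= k%:R + 1 by rewrite natr1; exact: ltW (truncnS_gt _).
have kn : (k <= n)%N by rewrite -(ler_nat R); apply: le_trans kd _; rewrite ler_piMl.
have lbn : expR (- (C * n%:R)) <= cw R n m.+1.
  apply: lb => //; apply: (@slope_bound R s n m.+1 B' B') => //; last by rewrite /B'; clear -B3; lra.
  by apply: leq_trans s33.
have nk0 : (0 < n + k)%N by rewrite addn_gt0 n0.
have hX := @planar_weight_le (n + k) (m + k) (expR (Q + C1 * (d * n%:R)) * cw R n m.+1) nk0.
have {hX} N' : #|planar_graphs R (n + k) (m + k)|%:R <=
    (n + k)%:R * (n + k)`!%:R * (expR (Q + C1 * (d * n%:R)) * cw R n m.+1).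
  apply: hX => j _; have [jd|jd] := leP j%:R (d * n%:R).
    rewrite expRD -[leRHS]mulrA; apply: ler_pM; rewrite ?cw_ge0 ?divr_ge0 ?exprn_ge0 //.
      by apply: le_trans (@expR_geXn R 16 j (ler0n R 16)) _; rewrite ler_expR.
    have -> : (m + k + j).+1 = (m.+1 + k + j)%N by rewrite !addSn.
    exact: hn1.
  apply: le_trans (_ : expR (Q - L * j%:R) * expR (C * (n + k)%:R) <= _).
    by apply: ler_pM; rewrite ?cw_ge0 ?divr_ge0 ?exprn_ge0 ?geo_fact_le.
  apply: le_trans (_ : expR (Q + C1 * (d * n%:R)) * expR (- (C * n%:R)) <= _); last first.
    by rewrite ler_pM2l ?expR_gt0.
  rewrite -!expRD ler_expR.
  have h1 : L * (d * n%:R) <= L * j%:R by rewrite ler_wpM2l // ltW.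
  have h2 : L * (d * n%:R) = 3 * (C * n%:R) by rewrite /L; field; rewrite gt_eqF.
  have h3 : C * (n + k)%:R <= 2 * (C * n%:R).
    by rewrite (mulrCA 2) ler_pM2l // -natrM ler_nat mul2n -addnn leq_add2l.
  have h4 : 0 <= C1 * (d * n%:R) by rewrite mulr_ge0.
  rewrite h2 in h1; move: h1 h3 h4; move: (L * j%:R) (C * (n + k)%:R) (C1 * (d * n%:R)) => x1 x2 x3.
  move: (C * n%:R) => x4; clear; lra.
have att := attach_pendants R p n m k.
have F0 : 0 < (n + k)`!%:R * n%:R ^+ k :> R by rewrite mulr_gt0 ?factr_gt0 ?exprn_gt0.
have pk : (2 * (p + k))%:R <= 4 * d * n%:R :> R.
  rewrite natrM natrD -mulrA; move: (d * n%:R) pd kd => z; clear; lra.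
rewrite -(ler_pM2r F0).
have att' : #|few_pendants R p n m|%:R * ((n + k)`!%:R * n%:R ^+ k) <=
   #|planar_graphs R (n + k) (m + k)|%:R * (n`!%:R * (4 * d * n%:R) ^+ k) :> R.
  apply: le_trans (_ : (#|few_pendants R (p + k) (n + k) (m + k)| * (n`! * (2 * (p + k)) ^ k))%:R <= _).
    by rewrite -natrX -!natrM ler_nat.
  rewrite !natrM; apply: ler_pM => //.
    by rewrite ler_nat; apply/subset_leq_card/fintype.subsetP => E /finset.setIdP[].
  by rewrite ler_wpM2l // natrX; apply: lerXn2r; rewrite ?nnegrE ?ler0n // !mulr_ge0 // ltW.
apply: le_trans att' _.
have cN : n`!%:R * cw R n m.+1 <= #|planar_graphs R n m|%:R.
  by rewrite /cw /= mulrC mulfVK ?gt_eqF ?factr_gt0 // ler_nat conn_le_planar.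
have key : (n + k)%:R * expR (Q + C1 * (d * n%:R)) * (4 * d) ^+ k <= expR (- (2 * d * n%:R)).
  have h1 : (4 * d) ^+ k <= expR (- ((C1 + 3) * k%:R)).
    rewrite -mulNr expRM_natr; apply: lerXn2r => //; rewrite nnegrE ?expR_ge0 //.
    by rewrite mulr_ge0 // ltW.
  have h2 : (n + k)%:R * expR (Q + C1 + 3) <= expR (d * n%:R).
    apply: le_trans (hn2 n nn2); rewrite mulrAC ler_wpM2r ?expR_ge0 //.
    by rewrite -natrM ler_nat mul2n -addnn leq_add2l.
  apply: le_trans (_ : (n + k)%:R * expR (Q + C1 * (d * n%:R)) * expR (- ((C1 + 3) * k%:R)) <= _).
    by rewrite ler_wpM2l // mulr_ge0 ?expR_ge0.
  apply: le_trans (_ : (n + k)%:R * expR (Q + C1 + 3) * expR (- (3 * (d * n%:R))) <= _).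
    rewrite -!mulrA -!expRD ler_wpM2l // ler_expR.
    have h3 : (C1 + 3) * (d * n%:R) <= (C1 + 3) * (k%:R + 1) by rewrite ler_wpM2l // addr_ge0.
    have h4 : (C1 + 3) * (d * n%:R) = C1 * (d * n%:R) + 3 * (d * n%:R) by ring.
    have h5 : (C1 + 3) * (k%:R + 1) = (C1 + 3) * k%:R + C1 + 3 by ring.
    rewrite h4 h5 in h3; move: h3.
    move: (C1 * (d * n%:R)) (3 * (d * n%:R)) ((C1 + 3) * k%:R) => x1 x2 x3; clear; lra.
  apply: le_trans (_ : expR (d * n%:R) * expR (- (3 * (d * n%:R))) <= _).
    by rewrite ler_wpM2r ?expR_ge0.
  rewrite -expRD ler_expR -mulrA; move: (d * n%:R) => x; clear; lra.
apply: le_trans (_ : (n + k)%:R * (n + k)`!%:R * (expR (Q + C1 * (d * n%:R)) * cw R n m.+1) *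
    (n`!%:R * (4 * d * n%:R) ^+ k) <= _).
  by rewrite ler_wpM2r // mulr_ge0 // exprn_ge0 // !mulr_ge0 // ltW.
have -> : (n + k)%:R * (n + k)`!%:R * (expR (Q + C1 * (d * n%:R)) * cw R n m.+1) *
    (n`!%:R * (4 * d * n%:R) ^+ k) = (n + k)%:R * expR (Q + C1 * (d * n%:R)) * (4 * d) ^+ k *
    (n`!%:R * cw R n m.+1) * ((n + k)`!%:R * n%:R ^+ k).
  rewrite [(4 * d * n%:R) ^+ k]exprMn; move: (cw R n m.+1) => w.
  move: ((n + k)%:R) ((n + k)`!%:R) (expR _) (n`!%:R) ((4 * d) ^+ k) (n%:R ^+ k) => *; ring.
rewrite ler_pM2r //; apply: ler_pM => //.
  by rewrite !mulr_ge0 ?expR_ge0 // exprn_ge0 // !mulr_ge0 // ltW.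
by rewrite mulr_ge0 ?cw_ge0.
Qed.

End Dense.

(** * Graphs with few edges *)

Section Sparse.
Local Open Scope ring_scope.
Local Notation subsetP := fintype.subsetP.
Variable R : realType.

Lemma fact_le_expn (m i n : nat) : (m + i <= n)%N -> ((m + i)`! <= m`! * n ^ i)%N.
Proof.
elim: i => [|i IH] h; first by rewrite addn0 expn0 muln1.
rewrite addnS factS expnS mulnCA mulnC [X in (_ <= X)%N]mulnC; apply: leq_mul; last by rewrite -addnS.
by apply: IH; apply: leq_trans h; rewrite leq_add2l.
Qed.

Lemma fact_ge_expR q : q%:R ^+ q <= expR q%:R * q`!%:R :> R.
Proof. by rewrite -ler_pdivrMr ?factr_gt0 //; exact: expR_geXn. Qed.

Definition many_components n m : {set {set {set 'I_n}}} :=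
  [set E in planar_graphs R n m | (n < 24 * ncomp E)%N].

Lemma many_components_ub (C : R) n m : (0 < n)%N -> (forall n m, cw R n m <= expR (C * n%:R)) ->
  #|many_components n m|%:R <= n%:R * (n`!%:R * (16 ^+ n / (n %/ 24)`!%:R * expR (C * n%:R))).
Proof.
move=> n0 ub.
have sub : many_components n m \subset \bigcup_(k : 'I_n | (n %/ 24 <= k)%N) comp_graphs R k.+1 n m.
  apply/subsetP => E /finset.setIdP[EP nE].
  have c0 : (0 < ncomp E)%N by apply: ncomp_gt0; rewrite card_ord.
  have cn := ncomp_le E; rewrite card_ord in cn.
  have h : ((ncomp E).-1 < n)%N by rewrite prednK.
  apply/bigcupP; exists (Ordinal h) => /=; last by apply/finset.setIdP; rewrite prednK.
  by rewrite -ltnS prednK // ltn_divLR // mulnC.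
apply: le_trans (_ : (\sum_(k < n | (n %/ 24 <= k)%N) #|comp_graphs R k.+1 n m|)%:R <= _).
  by rewrite ler_nat; apply: leq_trans (subset_leq_card sub) _; exact: leq_card_bigcup.
set X := n`!%:R * _; have X0 : 0 <= X by rewrite !mulr_ge0 ?invr_ge0 ?expR_ge0 ?exprn_ge0.
rewrite natr_sum; apply: le_trans (_ : \sum_(k < n) X <= _); last first.
  by rewrite sumr_const card_ord -[leLHS]mulr_natl.
rewrite big_mkcond; apply: ler_sum => k _; case: ifP => // qk.
have := card_comp_graphs R k m n0; rewrite -(ler_nat R) !natrM -ler_pdivlMr ?factr_gt0 // => le.
apply: le_trans le _.
have cE : #|conn_graphs R n (m + k)|%:R = n`!%:R * cw R n (m + k).+1 :> R.
  by rewrite /cw /= mulrC mulfVK // gt_eqF ?factr_gt0.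
have f16 : 16 ^+ k <= 16 ^+ n :> R.
  by apply: ler_weXn2l; rewrite ?ler1n // ltnW.
have fq : k`!%:R^-1 <= (n %/ 24)`!%:R^-1 :> R by rewrite lef_pV2 ?posrE ?factr_gt0 // ler_nat leq_fact.
rewrite cE natrX; have -> : 16 ^+ k * (n`!%:R * cw R n (m + k).+1) / k`!%:R =
    n`!%:R * (16 ^+ k / k`!%:R * cw R n (m + k).+1) :> R by ring.
rewrite ler_wpM2l //; apply: ler_pM; rewrite ?cw_ge0 ?divr_ge0 ?exprn_ge0 //.
by apply: ler_pM; rewrite ?invr_ge0 ?exprn_ge0.
Qed.

(** There may be too few edges for a connected graph on [n] vertices. So [m'] vertices carry a
    connected graph and the at most [n / 80] others are isolated, which costs [n! / m'!]. *)
Lemma planar_graphs_lb (C : R) n m : (forall n m, (33 <= n)%N -> (n <= m)%N -> (33 * m <= (3 * 33 - 6) * n)%N ->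
    expR (- (C * n%:R)) <= cw R n m) -> 0 <= C ->
  (80 <= n)%N -> (79 * n <= 80 * m)%N -> (64 * m <= 65 * n)%N ->
  n`!%:R * expR (- (C * n%:R)) <= #|planar_graphs R n m|%:R * n%:R ^+ (n %/ 80).
Proof.
move=> lb C0 n80 ml mu; pose m' := minn n m.+1.
have m'n : (m' <= n)%N by exact: geq_minl.
have h1 : (33 <= m')%N by rewrite /m'; lia.
have h2 : (m' <= m.+1)%N by exact: geq_minr.
have h3 : (33 * m.+1 <= (3 * 33 - 6) * m')%N by rewrite /m'; lia.
have h4 : (n - m' <= n %/ 80)%N by rewrite /m'; lia.
have l := lb m' m.+1 h1 h2 h3.
have cE : m'`!%:R * cw R m' m.+1 <= #|planar_graphs R n m|%:R.
  by rewrite /cw /= mulrC mulfVK ?gt_eqF ?factr_gt0 // ler_nat conn_le_planar.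
have f : n`!%:R <= m'`!%:R * n%:R ^+ (n %/ 80) :> R.
  rewrite -natrX -natrM ler_nat; apply: leq_trans (_ : m'`! * n ^ (n - m') <= _)%N.
    by have := @fact_le_expn m' (n - m') n; rewrite subnKC // leqnn => ->.
  by rewrite leq_mul2l leq_pexp2l ?orbT //; apply: leq_trans n80.
apply: le_trans (_ : m'`!%:R * n%:R ^+ (n %/ 80) * expR (- (C * m'%:R)) <= _).
  apply: ler_pM; rewrite ?expR_ge0 // ler_expR lerN2 ler_wpM2l // ler_nat //.
rewrite mulrAC ler_wpM2r ?exprn_ge0 //; apply: le_trans cE.
by rewrite ler_wpM2l.
Qed.

(** The factorial of [n / 24] in the upper bound outgrows [n ^ (n / 80)] in the lower bound together
    with all exponentials. *)
Lemma many_components_small : exists n0 : nat, forall n m : nat, (n0 <= n)%N ->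
  (79 * n <= 80 * m)%N -> (64 * m <= 65 * n)%N ->
  #|many_components n m|%:R <= expR (- n%:R) * #|planar_graphs R n m|%:R :> R.
Proof.
have [C C0 [ub lb]] := cw_bounds R (isT : (33 <= 33)%N).
(* The exponential factors and the target [expR (- n)] amount to [(17 + 2 * C) * n] with
   [n <= 25 * q]; a further [25 * q] comes from [big] and from comparing [q!] with [q ^ q]. *)
pose M := 450 + 50 * C; pose q0 := maxn 24 (Num.truncn (expR (2 * M))).+1.
exists (24 * q0)%N => n m hn ml mu.
pose q := (n %/ 24)%N; pose j := (n %/ 80)%N.
have q0q : (q0 <= q)%N by rewrite /q leq_divRL // mulnC.
have q24 : (24 <= q)%N by apply: leq_trans q0q; exact: leq_maxl.
have qM : expR (2 * M) <= q%:R.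
  by apply: le_trans (ltW (truncnS_gt _)) _; rewrite ler_nat; apply: leq_trans q0q; exact: leq_maxr.
have n25 : (n <= 25 * q)%N by clear -q24; rewrite /q in q24 *; lia.
have j2 : (2 * j <= q)%N by clear -q24; rewrite /q /j in q24 *; lia.
have n80 : (80 <= n)%N by clear -q24; rewrite /q in q24 *; lia.
have n0 : (0 < n)%N by apply: leq_trans n80.
have low := planar_graphs_lb lb (ltW C0) n80 ml mu; rewrite -/j in low.
apply: le_trans (many_components_ub m n0 ub) _; rewrite -/q.
have q0' : 0 < q%:R :> R by rewrite ltr0n; apply: leq_trans q24.
have nj : 0 < n%:R ^+ j :> R by rewrite exprn_gt0 // ltr0n.
have qq : 0 < q%:R ^+ q :> R by rewrite exprn_gt0.
have M0 : 0 <= M by rewrite /M; lra.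
(* [q ^ (q - j)] beats every exponential, since [q] is large and [2 j <= q]. *)
have big : expR (M * q%:R) * n%:R ^+ j <= expR (24 * q%:R) * q%:R ^+ q.
  have e1 : q%:R ^+ q = q%:R ^+ j * q%:R ^+ (q - j) :> R by rewrite -exprD subnKC //; clear -j2; lia.
  have h25 : n%:R ^+ j <= 25 ^+ j * q%:R ^+ j :> R.
    by rewrite -exprMn -natrM; apply: lerXn2r; rewrite ?nnegrE // ler_nat.
  have h25' : 25 ^+ j <= expR (24 * q%:R) :> R.
    apply: le_trans (_ : expR 24 ^+ j <= _).
      apply: lerXn2r; rewrite ?nnegrE ?expR_ge0 //; apply: le_trans (expR_ge1Dx _); lra.
    rewrite -expRM_natr ler_expR ler_wpM2l // ler_nat; clear -j2; lia.
  have hM : expR (M * q%:R) <= q%:R ^+ (q - j).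
    apply: le_trans (_ : expR (2 * M) ^+ (q - j) <= _); last first.
      by apply: lerXn2r; rewrite ?nnegrE ?expR_ge0.
    rewrite -expRM_natr ler_expR (mulrC 2) -mulrA ler_wpM2l // -natrM ler_nat; clear -j2; lia.
  apply: le_trans (_ : q%:R ^+ (q - j) * (25 ^+ j * q%:R ^+ j) <= _).
    by apply: ler_pM; rewrite ?exprn_ge0 ?expR_ge0.
  rewrite e1 [_ ^+ j * _ ^+ (q - j)]mulrC [leRHS]mulrCA.
  by rewrite ler_wpM2l ?exprn_ge0 // ler_wpM2r ?exprn_ge0.
have hq : q`!%:R^-1 <= expR (25 * q%:R - M * q%:R) / n%:R ^+ j.
  rewrite ler_pdivlMr // mulrC ler_pdivrMr ?factr_gt0 //.
  rewrite -(ler_pM2l (expR_gt0 (M * q%:R))); apply: le_trans big _.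
  apply: le_trans (_ : expR (24 * q%:R) * (expR q%:R * q`!%:R) <= _).
    by rewrite ler_wpM2l ?expR_ge0 ?fact_ge_expR.
  rewrite !mulrA -!expRD ler_wpM2r // ler_expR; move: (M * q%:R) => x; clear; lra.
have hne : n%:R <= expR n%:R :> R by apply: le_trans (expR_ge1Dx _); rewrite lerDr.
have h16 : 16 ^+ n <= expR (15 * n%:R) :> R.
  rewrite expRM_natr; apply: lerXn2r; rewrite ?nnegrE ?expR_ge0 //.
  by apply: le_trans (expR_ge1Dx _); clear; lra.
have low' : n`!%:R <= #|planar_graphs R n m|%:R * n%:R ^+ j * expR (C * n%:R).
  by move: low; rewrite expRN ler_pdivrMr ?expR_gt0.
set N := #|planar_graphs R n m|%:R in low' *; have N0 : 0 <= N by [].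
apply: le_trans (_ : expR n%:R * (N * n%:R ^+ j * expR (C * n%:R) *
   (expR (15 * n%:R) * (expR (25 * q%:R - M * q%:R) / n%:R ^+ j) * expR (C * n%:R))) <= _).
  have r0 : 0 <= 16 ^+ n / q`!%:R :> R by rewrite divr_ge0 ?exprn_ge0.
  apply: ler_pM; rewrite ?mulr_ge0 ?expR_ge0 //.
  apply: ler_pM; rewrite ?mulr_ge0 ?expR_ge0 //.
  apply: ler_pM; rewrite ?expR_ge0 //.
  by apply: ler_pM; rewrite ?exprn_ge0 ?invr_ge0.
have -> : expR n%:R * (N * n%:R ^+ j * expR (C * n%:R) *
   (expR (15 * n%:R) * (expR (25 * q%:R - M * q%:R) / n%:R ^+ j) * expR (C * n%:R))) =
   expR n%:R * expR (C * n%:R) * expR (15 * n%:R) * expR (25 * q%:R - M * q%:R) * expR (C * n%:R) * N.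
  move: nj; set y := n%:R ^+ j; set x1 := expR n%:R; set x2 := expR (C * _).
  set x3 := expR (15 * _); set x4 := expR (25 * _ - _) => y0.
  by field; rewrite gt_eqF.
rewrite -!expRD ler_wpM2r // ler_expR.
have hx : (17 + 2 * C) * n%:R <= (17 + 2 * C) * (25 * q%:R).
  by rewrite ler_wpM2l -?natrM ?ler_nat //; clear -C0; lra.
have e1 : (17 + 2 * C) * n%:R = 17 * n%:R + 2 * (C * n%:R) by ring.
have e2 : (17 + 2 * C) * (25 * q%:R) = 425 * q%:R + 50 * (C * q%:R) by ring.
have e3 : M * q%:R = 450 * q%:R + 50 * (C * q%:R) by rewrite /M; ring.
rewrite e1 e2 in hx; rewrite e3; move: hx; move: (C * n%:R) (C * q%:R) => x y; clear; lra.
Qed.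

End Sparse.

Section SparseSwitch.
Local Open Scope ring_scope.
Local Notation subsetP := fintype.subsetP.
Variable R : realType.

(** With at most [n / 100] isolated vertices and [n / 400] pendant edges, [isolated_pendant_bound]
    gives [80 m >= 79 n]. If moreover at most [n / 2] vertices are good, [good_vertices_many] leaves
    more than [n / 8] for three times the number of components. The comparison in the third term is
    used as 0 or 1. *)
Lemma few_pendants_cover p n m : (0 < n)%N -> (64 * m <= 65 * n)%N -> (400 * p <= n)%N ->
  (#|few_pendants R p n m| <=
    #|[set E in few_pendants R p n m | (n %/ 100).+1 <= #|isolated E|]| +
    #|[set E in few_pendants R p n m | n./2.+1 <= #|good_vertices E|]| +
    (79 * n <= 80 * m) * #|many_components R n m|)%N.
Proof.
move=> n0 mu pn; set A := [set E in _ | _]; set G := [set E in _ | _].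
pose K : {set {set {set 'I_n}}} := [set E in many_components R n m | (79 * n <= 80 * m)%N].
have cK : (#|K| <= (79 * n <= 80 * m) * #|many_components R n m|)%N.
  have [h|h] := boolP (79 * n <= 80 * m)%N; rewrite ?mul1n ?mul0n.
    by apply/subset_leq_card/subsetP => E /finset.setIdP[].
  by rewrite (_ : K = finset.set0) ?finset.cards0 //; apply/setP => E; rewrite !inE (negbTE h) andbF.
apply: leq_trans (_ : (#|A :|: G :|: K| <= _)%N); last first.
  apply: leq_trans (leq_card_setU _ _).1 _; apply: leq_add => //.
  exact: (leq_card_setU _ _).1.
apply/subset_leq_card/subsetP => E EF; have /few_pendantsP[sE cE pE fE] := EF.
have g := good_vertices_many sE; have i := isolated_pendant_bound sE.
have [hA|hA] := leqP (n %/ 100).+1 #|isolated E|.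
  by rewrite !finset.in_setU; apply/orP; left; apply/orP; left; apply/finset.setIdP.
have [hG|hG] := leqP n./2.+1 #|good_vertices E|.
  by rewrite !finset.in_setU; apply/orP; left; apply/orP; right; apply/finset.setIdP.
rewrite finset.in_setU; apply/orP; right.
rewrite cE in g i; move: g i hA hG fE.
move: (#|good_vertices E|) (#|isolated E|) (#|pendant_edges E|) => x y z g i hA hG fE.
apply/finset.setIdP; split; last by clear -hA i fE pn; lia.
apply/finset.setIdP; split; first by apply/planar_graphsP.
clear -g hA hG fE pn mu n0; lia.
Qed.

Lemma switch_isolated_bound p n m : (1 < n)%N ->
  (#|[set E in few_pendants R p n m | (n %/ 100).+1 <= #|isolated E|]| * m <=
    100 * (p + 3) * #|few_pendants R (p + 3) n m|)%N.
Proof.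
case: n => // n n0; have := switch_isolated R p n m (n.+1 %/ 100).+1; rewrite addn3.
have := bin2 n.+1; have : (n.+1 < 100 * (n.+1 %/ 100).+1)%N by lia.
rewrite /=; move: (n.+1 %/ 100).+1 ('C(n.+1, 2)) => c d h1 h2.
set x := #|[set E in _ | _]|; set y := #|few_pendants _ _ _ _|; move: x y => x y.
have h3 : (2 * d <= n.+1 * n)%N by rewrite h2; lia.
move=> h4; rewrite -(@leq_pmul2r (n.+1 * n)); last by lia.
apply: leq_trans (_ : 100 * (x * (c * m * n)) <= _)%N.
  have : (n.+1 <= 100 * c)%N by exact: ltnW.
  clear; move=> h; have -> : (x * m * (n.+1 * n) = n.+1 * (x * m * n))%N by nia.
  have -> : (100 * (x * (c * m * n)) = 100 * c * (x * m * n))%N by nia.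
  by rewrite leq_mul2r h orbT.
apply: leq_trans (_ : 100 * (y * (2 * p.+3 * d)) <= _)%N; first by rewrite leq_mul2l.
have -> : (100 * (y * (2 * p.+3 * d)) = 100 * p.+3 * y * (2 * d))%N by nia.
by rewrite leq_mul2l h3 orbT.
Qed.

Lemma switch_degree2_bound p n m : (1 < n)%N -> (64 * m <= 65 * n)%N ->
  (#|[set E in few_pendants R p n m | n./2.+1 <= #|good_vertices E|]| * n <=
    16 * (p + 3) * #|few_pendants R (p + 3) n m|)%N.
Proof.
case: n => // n n0 mu; have := switch_degree2 R p n m (n.+1./2).+1; rewrite addn3.
have : (n.+1 <= 2 * (n.+1./2).+1)%N by lia.
move: (n.+1./2).+1 => c h1; set x := #|[set E in _ | _]|; set y := #|few_pendants _ _ _ _|.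
move: x y => x y h4.
have h2 : (m <= 2 * n.+1)%N by lia.
have h5 : (n.+1 <= 2 * n)%N by lia.
rewrite -(@leq_pmul2r n.+1) //.
apply: leq_trans (_ : 4 * (x * (c * n)) <= _)%N.
  apply: leq_trans (_ : x * (2 * c) * (2 * n) <= _)%N; last by clear; nia.
  by apply: leq_mul => //; rewrite leq_mul2l h1 orbT.
apply: leq_trans (_ : 4 * (y * (2 * p.+3 * m)) <= _)%N; first by rewrite leq_mul2l.
apply: leq_trans (_ : 4 * (y * (2 * p.+3 * (2 * n.+1))) <= _)%N; last by clear; nia.
by rewrite !leq_mul2l h2 !orbT.
Qed.

Lemma few_pendants_sparse_step (b X : R) p n m : 0 < b -> b <= 1 -> (1 < n)%N -> b * n%:R <= m%:R ->
  (64 * m <= 65 * n)%N -> (400 * p <= n)%N -> 464 * (p + 3)%:R <= b * n%:R -> 0 <= X ->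
  ((79 * n <= 80 * m)%N -> #|many_components R n m|%:R <= X) ->
  #|few_pendants R p n m|%:R <= #|few_pendants R (p + 3) n m|%:R / 4 + X.
Proof.
move=> b0 b1 n1 bm mu pn pb X0 hX.
have cov := few_pendants_cover (ltnW n1) mu pn.
have {hX} hX : ((79 * n <= 80 * m) * #|many_components R n m|)%:R <= X.
  by case: (79 * n <= 80 * m)%N hX => hX; rewrite ?mul1n ?mul0n //; exact: hX.
move: (_ * #|many_components R n m|)%N cov hX => K cov hX.
have hA := switch_isolated_bound p m n1; have hG := switch_degree2_bound p n1 mu.
move: cov hA hG; set A := #|[set E in _ | _]|; set G := #|[set E in _ | _]|.
set F := #|few_pendants R (p + 3) n m|; rewrite -!(ler_nat R) !natrD !natrM => cov hA hG.
have n0 : 0 < b * n%:R by rewrite mulr_gt0 // ltr0n ltnW.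
have hA' : A%:R * (b * n%:R) <= 100 * (p + 3)%:R * F%:R.
  by apply: le_trans hA; rewrite ler_wpM2l.
have hG' : G%:R * (b * n%:R) <= 16 * (p + 3)%:R * F%:R.
  by apply: le_trans hG; rewrite mulrCA ler_piMl // mulr_ge0.
(* The constant 464 of the hypothesis is [4 * (100 + 16)]. *)
have hAG : A%:R + G%:R <= F%:R / 4 :> R.
  rewrite -(ler_pM2r n0) mulrDl.
  apply: le_trans (_ : 464 * (p + 3)%:R * (F%:R / 4) <= _); last first.
    by rewrite mulrC ler_wpM2l // divr_ge0.
  have -> : 464 * (p + 3)%:R * (F%:R / 4) = 116 * (p + 3)%:R * F%:R :> R by field.
  have -> : 116 * (p + 3)%:R * F%:R = 100 * (p + 3)%:R * F%:R + 16 * (p + 3)%:R * F%:R :> R by ring.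
  exact: lerD.
by apply: le_trans cov _; exact: lerD.
Qed.

Lemma few_pendants_sparse (b : R) : 0 < b -> b <= 1 ->
  exists2 a : R, 0 < a & exists n0 : nat, forall n m p : nat, (n0 <= n)%N ->
    b * n%:R <= m%:R -> (64 * m <= 65 * n)%N -> p%:R <= a * n%:R ->
    #|few_pendants R p n m|%:R <= expR (- (2 * a * n%:R)) * #|planar_graphs R n m|%:R.
Proof.
move=> b0 b1; have [n1 hn1] := many_components_small R.
(* [p] grows from at most [be * n / 20] by at most [be * n / 2], which keeps [464 * p] below
   [b * n]. The [i] steps gain about [expR (- be * n / 6)]; of this [3 * a * n] is needed, one part
   of it for constants. *)
pose be := b / 500; pose a := be / 20.
have be0 : 0 < be by apply: divr_gt0 b0 _; rewrite ltr0n.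
have a0 : 0 < a by rewrite divr_gt0.
have [n2 hn2] := @linear_le_expR R (expR 1 + 2) a (ltac:(by rewrite addr_ge0 ?expR_ge0)) a0.
exists a => //; exists (maxn (maxn n1 n2) (maxn 2 (Num.truncn (100 * 500 / b)).+1)) => n m p.
rewrite !geq_max => /andP[/andP[nn1 nn2] /andP[n2' nb]] bm mu pa.
have n0 : 0 < n%:R :> R by rewrite ltr0n ltnW.
have nbR : 100 * 500 <= b * n%:R.
  rewrite [leRHS]mulrC -ler_pdivrMr //; apply: le_trans (ltW (truncnS_gt _)) _. by rewrite ler_nat.
pose N : R := #|planar_graphs R n m|%:R; pose X := expR (- n%:R) * N.
have N0 : 0 <= N by []. have X0 : 0 <= X by rewrite mulr_ge0 ?expR_ge0.
(* The errors [X] form a geometric series of ratio [1 / 4], bounded generously by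
   [2 - 2 * 4^-1 ^+ i]. *)
have iter i : (464 * (p + 3 * i)%:R <= b * n%:R) ->
    #|few_pendants R p n m|%:R <= #|few_pendants R (p + 3 * i) n m|%:R / 4 ^+ i + (2 - 2 * 4^-1 ^+ i) * X.
  elim: i => [|i IH] hi; first by rewrite muln0 addn0 !expr0 divr1 mulr1 subrr mul0r addr0.
  have hi' : 464 * (p + 3 * i + 3)%:R <= b * n%:R by rewrite -addnA -mulnSr.
  have hi2 : 464 * (p + 3 * i)%:R <= b * n%:R.
    by apply: le_trans hi'; rewrite ler_wpM2l ?ler0n // ler_nat leq_addr.
  have h400 : (400 * (p + 3 * i) <= n)%N.
    rewrite -(ler_nat R) natrM; apply: le_trans (_ : b * n%:R <= _); last by rewrite ler_piMl // ltW.
    by apply: le_trans hi2; rewrite ler_wpM2r // ler_nat.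
  have st := few_pendants_sparse_step b0 b1 n2' bm mu h400 hi' X0 (fun h => hn1 n m nn1 h mu).
  apply: le_trans (IH hi2) _; rewrite mulnSr addnA.
  have q0 : 0 <= 4^-1 ^+ i :> R by rewrite exprn_ge0 // invr_ge0.
  have e4 : 4 ^- i = 4^-1 ^+ i :> R by rewrite exprVn.
  have -> : 4 ^- i.+1 = 4^-1 * 4^-1 ^+ i :> R by rewrite -exprVn exprS.
  rewrite e4 exprS; move: st; set f := #|_|%:R; set f' := #|_|%:R => st.
  have st' : f * 4^-1 ^+ i <= (f' / 4 + X) * 4^-1 ^+ i by rewrite ler_wpM2r.
  have e5 : (f' / 4 + X) * 4^-1 ^+ i = f' * (4^-1 * 4^-1 ^+ i) + X * 4^-1 ^+ i by ring.
  have e6 : (2 - 2 * (4^-1 * 4^-1 ^+ i)) * X - (2 - 2 * 4^-1 ^+ i) * X = 3 / 2 * (X * 4^-1 ^+ i) by field.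
  have q1 : 0 <= X * 4^-1 ^+ i by rewrite mulr_ge0.
  rewrite e5 in st'; move: st' e6 q1.
  move: (f * _) (f' * _) (X * _) (_ * X) (_ * X) => x1 x2 x3 x4 x5; clear; lra.
pose i := Num.truncn (be * n%:R / 6).
have be1 : be * n%:R = b * n%:R / 500 by rewrite /be; ring.
have i1 : be * n%:R / 6 <= i%:R + 1 by rewrite natr1; exact: ltW (truncnS_gt _).
have i2 : i%:R <= be * n%:R / 6 by rewrite truncn_le divr_ge0 // mulr_ge0 // ltW.
have a1 : a * n%:R = be * n%:R / 20 by rewrite /a; ring.
have hi : 464 * (p + 3 * i)%:R <= b * n%:R.
  rewrite natrD natrM; rewrite a1 be1 in pa; rewrite be1 in i2; move: pa i2 nbR.
  by move: (b * n%:R) (p%:R) (i%:R) => x y z; clear; lra.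
apply: le_trans (iter i hi) _.
have e1 : #|few_pendants R (p + 3 * i) n m|%:R <= N.
  by rewrite ler_nat; apply/subset_leq_card/subsetP => E /finset.setIdP[].
have q0 : 0 <= 4^-1 ^+ i :> R by rewrite exprn_ge0 // invr_ge0.
have q1 : 4^-1 ^+ i <= expR (- i%:R) :> R.
  rewrite -[i%:R]mul1r -mulNr expRM_natr; apply: lerXn2r; rewrite ?nnegrE ?invr_ge0 ?expR_ge0 //.
  have h : 1 / 2 <= expR (- (1 / 2)) :> R by apply: le_trans (expR_ge1Dx _); clear; lra.
  have -> : expR (- 1) = expR (- (1 / 2)) * expR (- (1 / 2)) :> R by rewrite -expRD; congr expR; field.
  by apply: le_trans (_ : 1 / 2 * (1 / 2) <= _); [clear; lra|apply: ler_pM => //; clear; lra].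
have be_n0 : 0 <= be * n%:R by rewrite mulr_ge0 // ltW.
have ben : be * n%:R <= n%:R by rewrite ler_piMl // /be; clear -b1 b0; lra.
apply: le_trans (_ : (expR 1 + 2) * expR (- (be * n%:R / 6)) * N <= _).
  apply: le_trans (_ : N * expR (- i%:R) + 2 * X <= _).
    rewrite -exprVn; apply: lerD; first by apply: ler_pM.
    by rewrite ler_wpM2r // lerBlDr lerDl mulr_ge0.
  have -> : (expR 1 + 2) * expR (- (be * n%:R / 6)) * N =
      N * (expR 1 * expR (- (be * n%:R / 6))) + 2 * (expR (- (be * n%:R / 6)) * N) by ring.
  apply: lerD.
    by rewrite ler_wpM2l // -expRD ler_expR; move: i1; move: (be * n%:R) (i%:R) => x y; clear; lra.
  rewrite ler_wpM2l // ler_wpM2r // ler_expR; move: ben be_n0; move: (be * n%:R) (n%:R) => x y; clear; lra.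
rewrite ler_wpM2r //; apply: le_trans (_ : expR (a * n%:R) * expR (- (be * n%:R / 6)) <= _).
  rewrite ler_wpM2r ?expR_ge0 //; apply: le_trans (hn2 n nn2).
  by rewrite ler_peMr ?addr_ge0 ?expR_ge0 // ler1n ltnW.
by rewrite -expRD ler_expR -(mulrA 2) a1; move: be_n0; move: (be * n%:R) => x; clear; lra.
Qed.

End SparseSwitch.

Section Final.
Local Open Scope ring_scope.
Variable R : realType.

Lemma few_pendants_rare (b B : R) : 0 < b -> B < 3 ->
  exists2 a : R, 0 < a & exists n0 : nat, forall n m p : nat, (n0 <= n)%N ->
    b * n%:R <= m%:R <= B * n%:R -> p%:R <= a * n%:R ->
    #|few_pendants R p n m|%:R <= expR (- (2 * a * n%:R)) * #|planar_graphs R n m|%:R.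
Proof.
move=> b0 B3; pose b' := Num.min b 1; pose B' := Num.max B 2.
have b'0 : 0 < b' by rewrite lt_min b0 ltr01.
have b'1 : b' <= 1 by rewrite ge_min lexx orbT.
have b'b : b' <= b by rewrite ge_min lexx.
have B'0 : 0 < B' by rewrite lt_max ltr0n orbT.
have B'3 : B' < 3 by rewrite gt_max B3; lra.
have BB' : B <= B' by rewrite le_max lexx.
(* With [e = 1 / 64] the dense case starts at [m / n = 65 / 64], where the sparse case ends. *)
have e0 : 0 < 64^-1 :> R by rewrite invr_gt0.
have e1 : 64^-1 <= 1 :> R by lra.
have [a1 a10 [n1 h1]] := few_pendants_sparse b'0 b'1.
have [a2 a20 [n2 h2]] := few_pendants_dense e0 e1 B'0 B'3.
pose a := Num.min a1 a2; exists a; first by rewrite lt_min a10 a20.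
exists (maxn n1 n2) => n m p; rewrite geq_max => /andP[nn1 nn2] /andP[bm mB] pa.
have aa1 : a <= a1 by rewrite ge_min lexx.
have aa2 : a <= a2 by rewrite ge_min lexx orbT.
have weak c : a <= c -> #|few_pendants R p n m|%:R <= expR (- (2 * c * n%:R)) * #|planar_graphs R n m|%:R ->
    #|few_pendants R p n m|%:R <= expR (- (2 * a * n%:R)) * #|planar_graphs R n m|%:R.
  move=> ac h; apply: le_trans h _; rewrite ler_wpM2r // ler_expR lerN2.
  by rewrite ler_wpM2r // ler_wpM2l.
have [ms|md] := leqP (64 * m) (65 * n).
  apply: (weak _ aa1 (h1 n m p nn1 _ ms _)); first by apply: le_trans bm; rewrite ler_wpM2r.
  by apply: le_trans pa _; rewrite ler_wpM2r.
apply: (weak _ aa2 (h2 n m p nn2 _ _ _)).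
- by move: (ltnW md); rewrite -(ler_nat R) !natrM; move: (n%:R) (m%:R) => x y; clear; lra.
- by apply: le_trans mB _; rewrite ler_wpM2r.
- by apply: le_trans pa _; rewrite ler_wpM2r.
Qed.

End Final.

Local Open Scope classical_set_scope.
Local Open Scope ring_scope.

Theorem theorem4p4 (R : realType) (b B : R) (hb : 0 < b) (hB : B < 3) :
  exists2 alpha : R, 0 < alpha &
    forall m : nat -> nat,
      (\forall n \near \oo, b * n%:R <= (m n)%:R <= B * n%:R) ->
      \forall n \near \oo,
        prob_planar R (m n)
          (fun E : {set {set 'I_n}} => #|pendant_edges E|%:R < alpha * n%:R)
        < expR (- (alpha * n%:R)).
Proof.
have [a a0 [n0 h]] := few_pendants_rare hb hB; exists a => // m hm; near=> n.
have bm : b * n%:R <= (m n)%:R <= B * n%:R by near: n.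
have nn0 : (n0 <= n)%N by near: n; exact: nbhs_infty_ge.
have n1 : (1 <= n)%N by near: n; exact: nbhs_infty_ge.
have an0 : 0 < a * n%:R by rewrite mulr_gt0 // ltr0n.
have pa : (Num.truncn (a * n%:R))%:R <= a * n%:R by rewrite truncn_le ltW.
have {}h := h n (m n) _ nn0 bm pa; rewrite /prob_planar.
(* If there are no graphs, the quotient is 0 because the inverse of 0 is 0. *)
have [->|N0] := posnP #|planar_graphs R n (m n)|; first by rewrite invr0 mulr0 expR_gt0.
(* The factor 2 in the exponent was carried along to obtain a strict inequality here. *)
apply: le_lt_trans (_ : expR (- (2 * a * n%:R)) < _); last first.
  by rewrite ltr_expR ltrN2 -mulrA; move: an0; move: (a * n%:R) => x x0; lra.
rewrite ler_pdivrMr ?ltr0n //; apply: le_trans h.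
rewrite ler_nat; apply/subset_leq_card/fintype.subsetP => E /finset.setIdP[EP lt].
by apply/finset.setIdP; split=> //; rewrite truncn_ge_nat ?ltW.
Unshelve. all: by end_near.
Qed.
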